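(* Let $\alpha\in[1,2)$ and assume $\beta<\infty$ and $\gamma^{(\alpha)}<\infty$. Let $p=p(\alpha,k)$ be the largest integer with $0\le p\le k$ and $p<(\alpha-1)/(2-\alpha)$, with $p=0$ if no such positive integer exists. Let $f:\mathbb{R}\to\mathbb{C}$ and $C$ be as follows: - if $\alpha=1$: $f$ is three times continuously differentiable with bounded derivatives of orders $1,2,3$, and $C=\|f'\|+\|f'''\|$; - if $\alpha\in(1,2)$: $f$ is $k+4$ times continuously differentiable with bounded derivatives of orders $1,\dots,k+4$, and $C=\|f'\|+\dots+\|f^{(k+4)}\|$. Then $$\Big|\int_{\mathbb{R}}f(u)\,d\mathbb{P}\{\mathbb{S}\le u\}-\int_{\mathbb{R}}f(u)\,dN_p(u)\Big|\le c\,C(\beta+\gamma^{(\alpha)}),$$ where $c>0$ depends only on $k$ and $\alpha$.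
   Context: **Setting.** Let $k\ge1$ and $n\ge1$ be integers. Let $X,X_1,\dots,X_n$ be i.i.d. random variables. Let $l$ be a real Borel function. For $j=1,\dots,k$, let $t_j$ be a real Borel function of $j$ variables that is invariant under permutations of its arguments. Put $L_i=l(X_i)$. For $A=\{i_1,\dots,i_j\}\subset\{1,\dots,n\}$ with $|A|=j$, put $T_A=t_j(X_{i_1},\dots,X_{i_j})$, and write $T_{1\dots j}=T_{\{1,\dots,j\}}$. Define - $\mathbb{L}=\sum_iL_i$, - $\mathbb{T}=\sum_{j=1}^k\sum_{|A|=j}T_A$, - $\mathbb{S}=\mathbb{L}+\mathbb{T}$. **Standing assumptions.** - $\mathbb{E}L_1=0$ and $n\,\mathbb{E}L_1^2=1$. - Each $t_j(X_1,\dots,X_j)$ is integrable and degenerate: $\mathbb{E}[t_j(X_1,\dots,X_j)\mid X_2,\dots,X_j]=0$ a.s. For $j=1$ this means $\mathbb{E}t_1(X_1)=0$. **Notation.** - $\beta=n\,\mathbb{E}|L_1|^3$. - $\gamma^{(\alpha)}=\sum_{j=1}^k\binom{n}{j}\mathbb{E}|T_{1\dots j}|^\alpha$. - $\kappa_j=\binom{n}{j}\mathbb{E}[L_1\cdots L_j\,\mathbb{T}]$. - $\Phi$ is the standard normal distribution function. - $N_0=\Phi$, and $N_p(x)=\Phi(x)+\sum_{j=1}^p(-1)^{j+1}\kappa_j\Phi^{(j+1)}(x)$. - $\|h\|=\sup_x|h(x)|$. *)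

(* Defs.v *)
From HB Require Import structures.
From mathcomp Require Import all_boot all_order all_algebra.
From mathcomp Require Import all_classical all_reals all_analysis.
From mathcomp Require Import complex.

Set Implicit Arguments.
Unset Strict Implicit.
Unset Printing Implicit Defensive.

Import Order.TTheory GRing.Theory Num.Theory.
Import numFieldNormedType.Exports.

Local Open Scope classical_set_scope.
Local Open Scope ring_scope.

Definition dern {R : realType} (j : nat) (g : R -> R) : R -> R :=
  iter j (fun h => derive1 h) g.

Definition Phi {R : realType} (x : R) : R :=
  Rintegral lebesgue_measure [set u : R | u <= x] (normal_pdf 0 1).

Definition Np {R : realType} (kappa : nat -> R) (p : nat) (x : R) : R :=
  Phi x + \sum_(1 <= j < p.+1) (-1) ^+ j.+1 * kappa j * dern j.+1 Phi x.

Definition p_alpha_k {R : realType} (alpha : R) (k : nat) : nat :=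
  \max_(0 <= j < k.+1 | (j%:R < (alpha - 1) / (2 - alpha))) j.

Definition cabs {R : rcfType} (z : R[i]) : R :=
  Num.sqrt (complex.Re z ^+ 2 + complex.Im z ^+ 2).

Definition cdern {R : realType} (j : nat) (f : R -> R[i]) : R -> R[i] :=
  fun x => Complex (dern j (fun u => complex.Re (f u)) x)
                   (dern j (fun u => complex.Im (f u)) x).

Definition rCn {R : realType} (m : nat) (g : R -> R) : Prop :=
  (forall j, (j < m)%N -> forall x : R, derivable (dern j g) x 1)
  /\ continuous (dern m g).

Definition cCn {R : realType} (m : nat) (f : R -> R[i]) : Prop :=
  rCn m (fun u => complex.Re (f u)) /\ rCn m (fun u => complex.Im (f u)).

Definition cbounded {R : realType} (h : R -> R[i]) : Prop :=
  exists M : R, forall x, cabs (h x) <= M.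

Definition supnorm {R : realType} (h : R -> R[i]) : R :=
  sup (range (fun x => cabs (h x))).

Definition cint {d} {T : measurableType d} {R : realType}
  (mu : {measure set T -> \bar R}) (D : set T) (h : T -> R[i]) : R[i] :=
  Complex (Rintegral mu D (fun w => complex.Re (h w)))
          (Rintegral mu D (fun w => complex.Im (h w))).

Definition mutually_independent {d} {Omega : measurableType d} {R : realType}
  (P : probability Omega R) {d'} {T : measurableType d'} (n : nat)
  (X : 'I_n -> Omega -> T) : Prop :=
  forall B : 'I_n -> set T, (forall i, measurable (B i)) ->
    P (\bigcap_(i in [set: 'I_n]) (X i @^-1` B i))
    = (\prod_(i < n) P (X i @^-1` B i))%E.

Definition identically_distributed {d} {Omega : measurableType d}
  {R : realType} (P : probability Omega R) {d'} {T : measurableType d'}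
  (n : nat) (X : 'I_n -> Omega -> T) : Prop :=
  forall i j (B : set T), measurable B -> P (X i @^-1` B) = P (X j @^-1` B).

Definition iid {d} {Omega : measurableType d} {R : realType}
  (P : probability Omega R) {d'} {T : measurableType d'} (n : nat)
  (X : 'I_n -> Omega -> T) : Prop :=
  (forall i, measurable_fun setT (X i)) /\
  mutually_independent P X /\ identically_distributed P X.

Section statistic.
Context {d} {Omega : measurableType d} {R : realType} {d'}
  {T : measurableType d'} (n : nat) (X : 'I_n -> Omega -> T)
  (l : T -> R) (t : forall j : nat, j.-tuple T -> R) (k : nat).

Definition Lv (i : 'I_n) (w : Omega) : R := l (X i w).

Definition TA (A : {set 'I_n}) (w : Omega) : R :=
  @t #|A| [tuple X (enum_val j) w | j < #|A|].

(* T_{1...j} = T_{{1,...,j}}  (0-based indices 0..j-1) *)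
Definition Tfirst (j : nat) : Omega -> R := TA [set i : 'I_n | (i < j)%N].

Definition TT (w : Omega) : R :=
  \sum_(A : {set 'I_n} | (0 < #|A| <= k)%N) TA A w.

Definition LL (w : Omega) : R := \sum_(i < n) Lv i w.

Definition SS (w : Omega) : R := LL w + TT w.

(* sigma(X_i : i in I) for I = {2, ..., j} (0-based 1..j-1) *)
Definition sigma_2_to (j : nat) : set (set Omega) :=
  <<s \big[setU/set0]_(i < n | (0 < i < j)%N)
        preimage_set_system setT (X i) measurable >>.

Variable P : probability Omega R.

(* E[ Y | G ] = 0 a.s.  (0 is a version of the conditional expectation):
   int_G Y dP = 0 for every G in the sigma-algebra *)
Definition cond_exp_zero (G : set (set Omega)) (Y : Omega -> R) : Prop :=
  forall A, G A -> (\int[P]_(w in A) (Y w)%:E = 0)%E.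

Definition beta_ (i1 : 'I_n) : R :=
  n%:R * Rintegral P setT (fun w => `|Lv i1 w| ^+ 3).

Definition gamma_ (alpha : R) : R :=
  \sum_(1 <= j < k.+1) 'C(n, j)%:R *
     Rintegral P setT (fun w => powR `|Tfirst j w| alpha).

Definition kappa (j : nat) : R :=
  'C(n, j)%:R *
    Rintegral P setT (fun w => (\prod_(i < n | (i < j)%N) Lv i w) * TT w).

End statistic.

(* Main.v *)
Require Import Defs.
From HB Require Import structures.
From mathcomp Require Import all_boot all_order all_algebra all_fingroup.
From mathcomp Require Import all_classical all_reals all_analysis measurable_realfun.
From mathcomp Require Import complex ring lra zify.

Set Implicit Arguments.
Unset Strict Implicit.
Unset Printing Implicit Defensive.

Import Order.TTheory GRing.Theory Num.Theory.
Import numFieldNormedType.Exports.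

Local Open Scope classical_set_scope.
Local Open Scope ring_scope.

(** Write S = L + T and let b be the exponent conjugate to alpha. Expanding f at L
    to first order in T leaves f'(L) T and a remainder O(|T|^alpha), which is controlled by
    gamma^(alpha) through a von Bahr--Esseen inequality for degenerate sums. Since T_A is
    degenerate, in E[f'(L) T_A] the function f' may be replaced by its iterated difference
    with steps L_i, i in A, at the sum of the L_i, i notin A. With |A| = j this difference
    is bounded by prod |L_i|^e with e = (2 + 1/j)/b when j b >= 2 j + 1 (that is, j > p),
    and is prod L_i * f^(j+1) up to a comparable error when j <= p. Young's inequality and
    E |L_i|^q <= 2 n^-1 beta^(q-2), 2 <= q <= 3, bound the resulting terms by
    E |T_A|^alpha + (2/n)^j beta, and summing over the C(n, j) sets A gives
    O(beta + gamma^(alpha)). What remains is E f(L) + sum_j kappa_j E f^(j+1)(L) up to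
    the removal of few summands from L; Lindeberg's method, with Gaussian smoothing as the
    comparison semigroup, replaces L by a standard normal variable, and integration by
    parts against the derivatives of Phi identifies the outcome as the integral of f
    against dN_p. *)

(** * Integrals over product laws *)

Section integrable_real_functions.
Context d (T : measurableType d) (R : realType) (mu : {measure set T -> \bar R}).
Implicit Types F G H : T -> R.

Definition integrableT F := mu.-integrable setT (EFin \o F).

Lemma integrableT_measurable F : integrableT F -> measurable_fun setT F.
Proof. by move=> /integrableP[/measurable_EFinP]. Qed.

Lemma integrableT_le F G : measurable_fun setT F ->
  (forall x, `|F x| <= G x) -> integrableT G -> integrableT F.
Proof.
move=> mF FG iG; apply: (le_integrable measurableT _ _ iG).
  exact/measurable_EFinP.
move=> x _ /=; rewrite lee_fin; apply: le_trans (FG x) _; exact: ler_norm.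
Qed.

Lemma integrableTD F G : integrableT F -> integrableT G ->
  integrableT (fun x => F x + G x).
Proof. move=> iF iG; exact: (integrableD measurableT iF iG). Qed.

Lemma integrableTB F G : integrableT F -> integrableT G ->
  integrableT (fun x => F x - G x).
Proof. move=> iF iG; exact: (integrableB measurableT iF iG). Qed.

Lemma integrableTZ (a : R) F : integrableT F -> integrableT (fun x => a * F x).
Proof. move=> iF; exact: (integrableZl measurableT a iF). Qed.

Lemma integrableT_norm F : integrableT F -> integrableT (fun x => `|F x|).
Proof. move=> iF; exact: (integrable_norm iF). Qed.

Lemma integrableT_sum I (s : seq I) (P : pred I) (F : I -> T -> R) :
  (forall i, P i -> integrableT (F i)) ->
  integrableT (fun x => \sum_(i <- s | P i) F i x).
Proof.
move=> iF; rewrite /integrableT.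
have -> : EFin \o (fun x => \sum_(i <- s | P i) F i x) =
   (fun x => (\sum_(i <- s | P i) (F i x)%:E)%E).
  by apply/funext => x /=; rewrite sumEFin.
exact: integrable_sum.
Qed.

Lemma integralT_sum I (s : seq I) (P : pred I) (F : I -> T -> R) :
  (forall i, P i -> integrableT (F i)) ->
  \int[mu]_x (\sum_(i <- s | P i) F i x) = \sum_(i <- s | P i) \int[mu]_x F i x.
Proof.
move=> iF; elim: s => [|a s IH].
  under eq_Rintegral do rewrite big_nil.
  by rewrite big_nil /Rintegral integral0.
rewrite big_cons -IH; under eq_Rintegral do rewrite big_cons.
case: ifPn => // Pa; rewrite RintegralD //; first exact: iF.
by apply: integrableT_sum.
Qed.

Lemma integralTD F G : integrableT F -> integrableT G ->
  \int[mu]_x (F x + G x) = \int[mu]_x F x + \int[mu]_x G x.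
Proof. by move=> iF iG; rewrite RintegralD. Qed.

Lemma integralTB F G : integrableT F -> integrableT G ->
  \int[mu]_x (F x - G x) = \int[mu]_x F x - \int[mu]_x G x.
Proof. by move=> iF iG; rewrite RintegralB. Qed.

Lemma integralTZ a F : integrableT F ->
  \int[mu]_x (a * F x) = a * \int[mu]_x F x.
Proof. by move=> iF; rewrite RintegralZl. Qed.

Lemma integralT_le F G : integrableT F -> integrableT G ->
  (forall x, F x <= G x) -> \int[mu]_x F x <= \int[mu]_x G x.
Proof. by move=> iF iG FG; apply: le_Rintegral. Qed.

Lemma integralT_norm_le F G : integrableT F -> integrableT G ->
  (forall x, `|F x| <= G x) -> `|\int[mu]_x F x| <= \int[mu]_x G x.
Proof.
move=> iF iG FG; apply: le_trans (le_normr_Rintegral measurableT iF) _.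
by apply: integralT_le => //; exact: integrableT_norm.
Qed.

Lemma integralT_EFin F : integrableT F ->
  (\int[mu]_x (F x)%:E)%E = (\int[mu]_x F x)%:E.
Proof. by move=> iF; rewrite /Rintegral fineK //; exact: integrable_fin_num. Qed.

Lemma integralT_eq F G : (forall x, F x = G x) -> \int[mu]_x F x = \int[mu]_x G x.
Proof. by move=> FG; apply: eq_Rintegral => x _. Qed.

Lemma eq_integrableT F G : (forall x, F x = G x) -> integrableT F -> integrableT G.
Proof. by move=> FG; have -> : F = G by exact/funext. Qed.

Lemma integrableT_ltey F : measurable_fun setT F -> (forall x, 0 <= F x) ->
  (\int[mu]_x (F x)%:E < +oo)%E -> integrableT F.
Proof.
move=> mF F0 Foo; apply/integrableP; split; first exact/measurable_EFinP.
by under eq_integral do rewrite /= ger0_norm //.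
Qed.

End integrable_real_functions.

Section integrable_probability.
Context d (T : measurableType d) (R : realType) (P : probability T R).
Implicit Types F G H : T -> R.

Lemma integrableT_cst (a : R) : integrableT P (fun=> a).
Proof. exact: finite_measure_integrable_cst. Qed.

Lemma integralT_cst (a : R) : \int[P]_x a = a.
Proof.
rewrite Rintegral_cst; last exact: measurableT.
by rewrite [X in fine X](@probability_setT _ _ _ P) mulr1.
Qed.

End integrable_probability.

Section merge.
Context (T : Type) (n : nat).
Implicit Types (A B : {set 'I_n}) (x y z : n.-tuple T).

Definition merge A x y : n.-tuple T :=
  [tuple if i \in A then tnth y i else tnth x i | i < n].

Lemma tnth_merge A x y i :
  tnth (merge A x y) i = if i \in A then tnth y i else tnth x i.
Proof. by rewrite tnth_mktuple. Qed.

Lemma merge_in A x y i : i \in A -> tnth (merge A x y) i = tnth y i.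
Proof. by move=> iA; rewrite tnth_merge iA. Qed.

Lemma merge_notin A x y i : i \notin A -> tnth (merge A x y) i = tnth x i.
Proof. by move=> /negbTE iA; rewrite tnth_merge iA. Qed.

Definition depends_on (S : Type) A (F : n.-tuple T -> S) :=
  forall x y, (forall i, i \in A -> tnth x i = tnth y i) -> F x = F y.

Lemma depends_onS (S : Type) (A B : {set 'I_n}) (F : n.-tuple T -> S) :
  A \subset B -> depends_on A F -> depends_on B F.
Proof.
by move=> /fintype.subsetP AB FA x y xy; apply: FA => i iA; apply: xy; exact: AB.
Qed.

Lemma depends_on_merge (S : Type) (A B : {set 'I_n}) (F : n.-tuple T -> S) x y :
  depends_on A F -> A \subset B -> F (merge B x y) = F y.
Proof. by move=> FA /fintype.subsetP AB; apply: FA => i /AB; exact: merge_in. Qed.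

Lemma depends_on_mergeC (S : Type) (A B : {set 'I_n}) (F : n.-tuple T -> S) x y :
  depends_on A F -> A \subset ~: B -> F (merge B x y) = F x.
Proof.
by move=> FA /fintype.subsetP AB; apply: FA => i /AB; rewrite inE; exact: merge_notin.
Qed.

End merge.

Lemma measurable_merge d (T : measurableType d) n (A : {set 'I_n}) :
  measurable_fun [set: n.-tuple T * n.-tuple T] (fun p => merge A p.1 p.2).
Proof.
apply/measurable_fun_tnthP => i; rewrite /comp.
under eq_fun do rewrite tnth_merge; case: (i \in A).
  exact: (measurableT_comp (measurable_tnth i) measurable_snd).
exact: (measurableT_comp (measurable_tnth i) measurable_fst).
Qed.

Section rectangles.
Context d (T : measurableType d) (n : nat).

Definition rectangle (B : 'I_n -> set T) : set (n.-tuple T) :=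
  [set x | forall i, B i (tnth x i)].

Definition rectangles : set (set (n.-tuple T)) :=
  [set U | exists2 B : 'I_n -> set T, (forall i, measurable (B i)) & U = rectangle B].

Lemma rectangleE B : rectangle B =
  \bigcap_(i in [set: 'I_n]) ((fun x : n.-tuple T => tnth x i) @^-1` B i).
Proof.
by apply/seteqP; split=> x /=; [move=> Bx i _; exact: Bx | move=> Bx i; exact: Bx].
Qed.

Lemma measurable_rectangle B : (forall i, measurable (B i)) -> measurable (rectangle B).
Proof.
move=> mB; rewrite rectangleE; apply: fin_bigcap_measurable; first exact: finite_finset.
by move=> i _; rewrite -[X in measurable X]setTI; exact: measurable_tnth.
Qed.

Lemma measurable_tuple_rectangles : <<s rectangles >> = measurable.
Proof.
apply/seteqP; split.
  apply: smallest_sub; first exact: sigma_algebra_measurable.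
  by move=> _ [B mB ->]; exact: measurable_rectangle.
apply: smallest_sub; first exact: smallest_sigma_algebra.
rewrite -bigcup_seq /=; apply: bigcup_sub => i _ _ [A mA <-].
apply: sub_sigma_algebra; exists (fun j => if j == i then A else setT).
  by move=> j; case: ifP.
apply/seteqP; split=> x /=.
  by move=> [_ Ax] j; case: eqP => // ->.
by move=> /(_ i); rewrite eqxx.
Qed.

Lemma setI_closed_rectangles : setI_closed rectangles.
Proof.
move=> _ _ [A mA ->] [B mB ->]; exists (fun i => A i `&` B i).
  by move=> i; exact: measurableI.
apply/seteqP; split=> x /=; first by move=> [? ?] i.
by move=> h; split=> i; have [] := h i.
Qed.

Lemma tuple_measure_unique (R : realType) (P : probability (n.-tuple T) R)
    (m : {measure set (n.-tuple T) -> \bar R}) :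
  (forall B, (forall i, measurable (B i)) -> P (rectangle B) = m (rectangle B)) ->
  forall U, measurable U -> P U = m U.
Proof.
move=> Pm U; rewrite -measurable_tuple_rectangles => mU.
apply: (@g_sigma_algebra_measure_unique _ R _ rectangles _ (fun=> setT)) => //.
- by move=> _ [B mB ->]; exact: measurable_rectangle.
- by move=> _; exists (fun=> setT) => //; apply/seteqP; split.
- by rewrite bigcup_const //; exists 0%N.
- exact: setI_closed_rectangles.
- by move=> _ [B mB ->]; exact: Pm.
- by move=> _; rewrite [X in (X < _)%E](@probability_setT _ _ _ P) ltry.
Qed.

End rectangles.

Section exchangeable_product.
Context d (T : measurableType d) (R : realType) (n : nat).
Variable M : probability (n.-tuple T) R.

Definition product_law := forall B : 'I_n -> set T, (forall i, measurable (B i)) ->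
  M (rectangle B) = (\prod_(i < n) M [set x | B i (tnth x i)])%E.

Definition identical_marginals := forall i j (B : set T), measurable B ->
  M [set x | B (tnth x i)] = M [set x | B (tnth x j)].

Hypothesis MX : product_law.

Lemma merge_law (A : {set 'I_n}) U : measurable U ->
  M U = (M \x M)%E [set p | U (merge A p.1 p.2)].
Proof.
move=> mU; rewrite (@tuple_measure_unique _ _ _ _ M
  (pushforward (M \x M)%E (fun p => merge A p.1 p.2))) //.
  exact: measurable_merge.
move=> mf B mB; rewrite /= /pushforward.
pose B1 i := if i \in A then setT else B i.
pose B2 i := if i \in A then B i else setT.
have mB1 i : measurable (B1 i) by rewrite /B1; case: ifP.
have mB2 i : measurable (B2 i) by rewrite /B2; case: ifP.
have -> : (fun p : n.-tuple T * n.-tuple T => merge A p.1 p.2) @^-1` rectangle B =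
    rectangle B1 `*` rectangle B2.
  apply/seteqP; split=> -[x y] /=.
    move=> xyB; split=> i; have := xyB i; rewrite tnth_merge /B1 /B2; by case: ifP.
  by move=> [xB yB] i; have := xB i; have := yB i; rewrite tnth_merge /B1 /B2; case: ifP.
rewrite product_measure1E; [|exact: measurable_rectangle|exact: measurable_rectangle].
rewrite (MX mB); apply: etrans (esym (congr2 mule (MX mB1) (MX mB2))).
rewrite -big_split /=; apply: eq_bigr => i _; rewrite /B1 /B2.
have MT : M [set x | [set: T] (tnth x i)] = 1%E := @probability_setT _ _ _ M.
by case: ifP => _; rewrite MT ?mul1e ?mule1.
Qed.

Lemma ge0_integral_merge A (F : n.-tuple T -> \bar R) :
  measurable_fun setT F -> (forall x, (0 <= F x)%E) ->
  (\int[M]_x F x = \int[M]_x \int[M]_y F (merge A x y))%E.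
Proof.
move=> mF F0.
rewrite (eq_measure_integral (pushforward (M \x M)%E (fun p => merge A p.1 p.2))).
- exact: measurable_merge.
- move=> mf; rewrite ge0_integral_pushforward // preimage_setT fubini_tonelli1 //.
    exact: measurableT_comp.
  by move=> p; exact: F0.
- by move=> mf U mU _; exact: merge_law.
Qed.

Lemma integrable_merge A (F : n.-tuple T -> \bar R) : M.-integrable setT F ->
  (M \x M)%E.-integrable setT (fun p => F (merge A p.1 p.2)).
Proof.
move=> /integrableP[mF Foo].
have mFm : measurable_fun setT (fun p => F (merge A p.1 p.2)).
  exact: (measurableT_comp mF (measurable_merge A)).
apply/integrable12ltyP => //=.
rewrite -(ge0_integral_merge A (F := fun x => `|F x|%E)) //.
exact: measurableT_comp.
Qed.

Lemma integral_merge A (F : n.-tuple T -> \bar R) : M.-integrable setT F ->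
  (\int[M]_x F x = \int[M]_x \int[M]_y F (merge A x y))%E.
Proof.
move=> iF; have mF := measurable_int _ iF.
have iFm := integrable_merge A iF.
rewrite (eq_measure_integral (pushforward (M \x M)%E (fun p => merge A p.1 p.2))).
- exact: measurable_merge.
- move=> mf; rewrite integral_pushforward // preimage_setT.
  by rewrite -(integral12_prod_meas1 iFm).
- by move=> mf U mU _; exact: merge_law.
Qed.

End exchangeable_product.

Section product_law_integrals.
Context d (T : measurableType d) (R : realType) (n : nat).
Variable M : probability (n.-tuple T) R.
Hypothesis MX : product_law M.
Implicit Types (A B : {set 'I_n}) (F G H : n.-tuple T -> R).

Lemma integrable_indep A G H : depends_on A G -> depends_on (~: A) H ->
  integrableT M G -> integrableT M H -> integrableT M (fun x => G x * H x).
Proof.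
move=> GA HA iG iH.
have mG := integrableT_measurable iG; have mH := integrableT_measurable iH.
have mGH : measurable_fun setT (fun x => G x * H x) by exact: measurable_funM.
apply/integrableP; split; first exact/measurable_EFinP.
rewrite (ge0_integral_merge MX A) //; last first.
  by apply: measurableT_comp => //; exact/measurable_EFinP.
rewrite (eq_integral (fun x => (`|H x|%:E * (\int[M]_y `|G y|)%:E)%E)); last first.
  move=> x _.
  rewrite (eq_integral (fun y => (`|H x|%:E * (`|G y|)%:E)%E)); last first.
    move=> y _ /=; rewrite -EFinM (depends_on_merge x y GA) //.
    by rewrite (depends_on_mergeC x y HA) // normrM mulrC.
  rewrite ge0_integralZl //; first by rewrite integralT_EFin //; exact: integrableT_norm.
  by apply/measurable_EFinP; exact: measurableT_comp.
rewrite ge0_integralZr //; last 2 first.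
  by apply/measurable_EFinP; exact: measurableT_comp.
  by rewrite lee_fin Rintegral_ge0.
rewrite integralT_EFin; last exact: integrableT_norm.
by rewrite -EFinM ltry.
Qed.

Lemma integral_indep A G H : depends_on A G -> depends_on (~: A) H ->
  integrableT M G -> integrableT M H ->
  \int[M]_x (G x * H x) = (\int[M]_x G x) * \int[M]_x H x.
Proof.
move=> GA HA iG iH; have iGH := integrable_indep GA HA iG iH.
rewrite {1}/Rintegral (integral_merge MX A (F := fun x => (G x * H x)%:E)) //.
rewrite (eq_integral (fun x => ((\int[M]_y G y)%:E * (H x)%:E)%E)); last first.
  move=> x _.
  rewrite (eq_integral (fun y => ((H x)%:E * (G y)%:E)%E)); last first.
    move=> y _ /=; rewrite -EFinM (depends_on_merge x y GA) //.
    by rewrite (depends_on_mergeC x y HA) // mulrC.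
  by rewrite integralZl // integralT_EFin // muleC.
by rewrite integralZl // integralT_EFin // -EFinM.
Qed.

Lemma integral_ae_degenerate i (F G : n.-tuple T -> R) :
  depends_on (~: [set i]) G -> integrableT M F ->
  integrableT M (fun x => G x * F x) ->
  {ae M, forall x, (\int[M]_y (F (merge [set i] x y))%:E = 0)%E} ->
  \int[M]_x (G x * F x) = 0.
Proof.
move=> Gi iF iGF F0.
rewrite /Rintegral (integral_merge MX [set i] (F := fun x => (G x * F x)%:E)) //.
have iFm := integrable_merge MX [set i] iF.
have iGFm := integrable_merge MX [set i] iGF.
rewrite (ae_eq_integral (fun=> 0%E)) //; first by rewrite integral0.
- exact: (measurable_int _ (integrable_fubini_F iGFm)).
- have := ae_integrable1 iFm; apply: filterS2 F0 => x F0 iFx _ /=.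
  rewrite (eq_integral (fun y => ((G x)%:E * (F (merge [set i] x y))%:E)%E)).
    by rewrite integralZl // F0 mule0.
  by move=> y _; rewrite -EFinM (depends_on_mergeC x y Gi).
Qed.

(* The set [0 < D] with [D x := \int[M]_y F (merge [set i] x y)] does not depend on the
   coordinate i, so that the hypothesis applies to it and makes D vanish almost everywhere. *)
Lemma ae_degenerate i A F : depends_on A F -> integrableT M F ->
  (forall U, measurable U -> depends_on (A :\ i) U ->
     (\int[M]_(x in U) (F x)%:E = 0)%E) ->
  {ae M, forall x, (\int[M]_y (F (merge [set i] x y))%:E = 0)%E}.
Proof.
move=> FA iF F0.
pose D x := (\int[M]_y (F (merge [set i] x y))%:E)%E.
have iFm := integrable_merge MX [set i] iF.
have iD : M.-integrable setT D := integrable_fubini_F iFm.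
have mD := measurable_int _ iD.
have depD : depends_on (A :\ i) D.
  move=> x y xy; apply: eq_integral => z _; congr (_%:E); apply: FA => j jA.
  rewrite !tnth_merge inE; case: eqP => // /eqP ji; apply: xy.
  by rewrite !inE ji jA.
have DU U : measurable U -> depends_on (A :\ i) U ->
    (\int[M]_(x in U) D x = 0)%E.
  move=> mU dU; rewrite -(F0 U) // [RHS]integral_mkcond.
  rewrite (integral_merge MX [set i]); last first.
    by apply/(integrable_mkcond _ mU); apply: (integrableS measurableT).
  rewrite integral_mkcond; apply: eq_integral => x _; rewrite /patch.
  have UE y : (merge [set i] x y \in U) = (x \in U).
    congr (asbool _); apply: dU => j; rewrite !inE => /andP[ji _].
    by rewrite merge_notin // inE.
  case: ifPn => xU; last by rewrite integral0_eq // => y _; rewrite UE (negbTE xU).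
  by apply: eq_integral => y _; rewrite UE xU.
have D0 : (\int[M]_x `|D x| = 0)%E.
  have mp : measurable [set x | (0%:E < D x)%E].
    by rewrite -[X in measurable X]setTI; exact: emeasurable_fun_o_infty.
  have mn : measurable [set x | (D x < 0%:E)%E].
    by rewrite -[X in measurable X]setTI; exact: emeasurable_fun_infty_o.
  have pD : (\int[M]_x (D^\+ x) = 0)%E.
    rewrite -(DU _ mp); last by move=> x y xy; rewrite /= (depD _ _ xy).
    rewrite [RHS]integral_mkcond; apply: eq_integral => x _.
    rewrite /patch funeposE; case: ifPn; rewrite ?inE ?notin_setE /= => D0.
      by rewrite max_l // ltW.
    by rewrite max_r // leNgt; apply/negP.
  have nD : (\int[M]_x (D^\- x) = 0)%E.
    have := DU _ mn; rewrite integral_mkcond => DUn.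
    rewrite -[RHS]oppe0 -DUn; last by move=> x y xy; rewrite /= (depD _ _ xy).
    rewrite -integralN; last first.
      apply: integrable_add_def => //; apply/(integrable_mkcond _ mn).
      exact: (integrableS measurableT).
    apply: eq_integral => x _.
    rewrite /patch funenegE; case: ifPn; rewrite ?inE ?notin_setE /= => D0.
      by rewrite max_l // oppe_ge0 ltW.
    by rewrite oppr0 max_r // oppe_le0 leNgt; apply/negP.
  rewrite -/(abse \o D) fune_abse ge0_integralD //; last 2 first.
  - exact: measurable_funepos.
  - exact: measurable_funeneg.
  by rewrite pD nD adde0.
have /(_ D0) := (ae_eq_integral_abs M measurableT mD).1.
by apply: filterS => x /(_ Logic.I).
Qed.

End product_law_integrals.

(** * The von Bahr--Esseen inequality for degenerate sums *)

Section powers.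
Context (R : realType).
Implicit Types a s u v x y : R.

Lemma powR_mono s x y : 0 <= s -> 0 <= x -> x <= y -> x `^ s <= y `^ s.
Proof.
by move=> s0 x0 xy; apply: ge0_ler_powR; rewrite ?nnegrE //; exact: le_trans xy.
Qed.

Lemma powR_subadd s x y : 0 <= s <= 1 -> 0 <= x -> 0 <= y ->
  (x + y) `^ s <= x `^ s + y `^ s.
Proof.
move=> /andP[s0 s1] x0 y0; have [xy0|xy0] := eqVneq (x + y) 0.
  have /eqP -> : x == 0 by lra.
  by rewrite add0r lerDr powR_ge0.
have xy : 0 < x + y by rewrite lt_def xy0 addr_ge0.
have H z : 0 <= z -> z <= x + y -> z / (x + y) * (x + y) `^ s <= z `^ s.
  move=> z0 zxy; rewrite -[X in _ <= X `^ _](divfK xy0) powRM ?divr_ge0 ?(ltW xy) //.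
  rewrite ler_wpM2r ?powR_ge0 //.
  have [->|z1] := eqVneq z 0; first by rewrite mul0r powR_ge0.
  rewrite ger1_powR // ler_pdivrMr // mul1r zxy andbT divr_gt0 //.
  by rewrite lt_def z1.
apply: le_trans (lerD (H x x0 _) (H y y0 _)); rewrite ?lerDl ?lerDr //.
by rewrite -mulrDl -mulrDl divff // mul1r.
Qed.

Lemma powR_norm_add a x y : 0 <= a <= 2 ->
  `|x + y| `^ a <= 4 * (`|x| `^ a + `|y| `^ a).
Proof.
move=> /andP[a0 a2].
have H (z w : R) : `|z| <= `|w| -> `|z + w| `^ a <= 4 * `|w| `^ a.
  move=> zw; apply: (@le_trans _ _ ((2 * `|w|) `^ a)).
    by apply: powR_mono => //; apply: le_trans (ler_normD _ _) _; lra.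
  rewrite powRM // ler_wpM2r ?powR_ge0 //.
  apply: (@le_trans _ _ (2 `^ 2)); first by apply: ler_powR => //; lra.
  by rewrite powR_mulrn //; lra.
have p1 := powR_ge0 `|x| a; have p2 := powR_ge0 `|y| a.
have [xy|/ltW xy] := leP `|x| `|y|; first by have := H _ _ xy; lra.
by have := H _ _ xy; rewrite [y + x]addrC; lra.
Qed.

Lemma powR_mulB1 a x y : 1 <= a -> 0 <= x -> 0 <= y ->
  x * y `^ (a - 1) <= x `^ a + y `^ a.
Proof.
move=> a1 x0 y0; have a0 : 0 < a by lra.
have p1 := powR_ge0 x a; have p2 := powR_ge0 y a.
have [xy|/ltW yx] := leP x y.
  have := mulr_powRB1 y0 a0; have : x * y `^ (a - 1) <= y * y `^ (a - 1).
    by rewrite ler_wpM2r // powR_ge0.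
  lra.
have := mulr_powRB1 x0 a0; have : x * y `^ (a - 1) <= x * x `^ (a - 1).
  by rewrite ler_wpM2l // powR_mono //; lra.
lra.
Qed.

Definition spow s u := Num.sg u * `|u| `^ s.

Lemma spowN s u : spow s (- u) = - spow s u.
Proof. by rewrite /spow sgrN normrN mulNr. Qed.

Lemma ge0_spow s u : 0 < s -> 0 <= u -> spow s u = u `^ s.
Proof.
move=> s0; rewrite le_eqVlt => /predU1P[<-|u0].
  by rewrite /spow sgr0 mul0r powR0 // gt_eqF.
by rewrite /spow gtr0_sg // mul1r gtr0_norm.
Qed.

Lemma spow_holder s u v : 0 < s <= 1 -> `|spow s u - spow s v| <= 2 * `|u - v| `^ s.
Proof.
move=> /andP[s0 s1].
have pos x y : 0 <= x -> 0 <= y -> `|spow s x - spow s y| <= `|x - y| `^ s.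
  move=> x0 y0; rewrite !ge0_spow //.
  wlog xy : x y x0 y0 / x <= y.
    move=> W; have [xy|/ltW xy] := leP x y; first exact: W.
    by rewrite distrC [`|x - y|]distrC; exact: W.
  rewrite distrC [`|x - y|]distrC !ger0_norm ?subr_ge0 //; last exact: powR_mono (ltW s0) _ _.
  rewrite lerBlDr -[X in X `^ _ <= _](subrK x) powR_subadd ?subr_ge0 // s1 andbT; lra.
have neg x y : 0 <= x -> 0 <= y -> `|spow s x - spow s (- y)| <= 2 * `|x - - y| `^ s.
  move=> x0 y0; rewrite spowN !opprK !ge0_spow // !ger0_norm ?addr_ge0 ?powR_ge0 //.
  have : x `^ s <= (x + y) `^ s by rewrite powR_mono ?lerDl // ltW.
  have : y `^ s <= (x + y) `^ s by rewrite powR_mono ?lerDr // ltW.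
  lra.
have := powR_ge0 `|u - v| s.
have [u0|/ltW u0] := leP 0 u; have [v0|/ltW v0] := leP 0 v.
- by have := pos u v u0 v0; lra.
- by have := neg u (- v) u0; rewrite oppr_ge0 opprK => /(_ v0).
- have := neg v (- u) v0; rewrite oppr_ge0 opprK => /(_ u0).
  by rewrite distrC [`|v - u|]distrC.
- have := pos (- u) (- v); rewrite !oppr_ge0 => /(_ u0 v0).
  by rewrite !spowN opprK addrC opprK [- u + v]addrC distrC [`|v - u|]distrC; lra.
Qed.

Lemma measurable_spow s : 0 < s -> measurable_fun setT (spow s).
Proof.
move=> s0.
have -> : spow s = fun u => Num.max u 0 `^ s - Num.max (- u) 0 `^ s.
  apply/funext => u; case: (lerP 0 u) => [u0|/ltW u0].
    by rewrite ge0_spow // max_r ?oppr_le0 // powR0 ?subr0 // gt_eqF.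
  rewrite -[u in LHS]opprK spowN ge0_spow ?oppr_ge0 // max_l ?oppr_ge0 //.
  by rewrite powR0 ?sub0r // gt_eqF.
apply: measurable_funB.
  have m1 : measurable_fun setT (fun u : R => Num.max u 0) by exact: measurable_maxr.
  exact: (measurableT_comp (measurable_powR s) m1).
have m2 : measurable_fun setT (fun u : R => Num.max (- u) 0).
  by apply: measurable_maxr => //; exact: measurableT_comp.
exact: (measurableT_comp (measurable_powR s) m2).
Qed.

(* Convexity of [|.|^a] at [u + v] instead of [u], so that no differentiation is needed. *)
Lemma powR_normD_le a u v : 1 < a < 2 ->
  `|u + v| `^ a <= `|u| `^ a + a * (spow (a - 1) u * v) + 4 * `|v| `^ a.
Proof.
move=> /andP[a1 a2]; have a0 : 0 < a by lra.
set b := u + v; set s := a - 1.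
have s0 : 0 < s by rewrite /s; lra.
have bb : spow s b * b = `|b| `^ a.
  rewrite /spow mulrAC -normrEsg mulrC -(mulr_powRB1 (normr_ge0 b) a0) //.
  by rewrite mulrC.
have tangent : a * (spow s b * u) <= `|u| `^ a + s * `|b| `^ a.
  apply: (@le_trans _ _ (a * (`|u| * `|b| `^ s))).
    rewrite ler_wpM2l ?(ltW a0) // /spow.
    apply: le_trans (ler_norm _) _; rewrite !normrM mulrC ler_wpM2l //.
    rewrite (ger0_norm (powR_ge0 _ _)) ler_piMl ?powR_ge0 //.
    by rewrite normr_sg; case: (b != 0).
  have e1 : a^-1 + (a / s)^-1 = 1 by rewrite /s invf_div; field; lra.
  have := @conjugate_powR _ `|u| (`|b| `^ s) a (a / s) (normr_ge0 _) (powR_ge0 _ _)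
    a0 (divr_gt0 a0 s0) e1.
  rewrite -powRrM [s * _]mulrC divfK ?gt_eqF // invf_div => H.
  have := ler_wpM2l (ltW a0) H; rewrite mulrDr => H2; apply: le_trans H2 _.
  rewrite le_eqVlt; apply/orP; left; apply/eqP; field; lra.
have hol : a * ((spow s b - spow s u) * v) <= 4 * `|v| `^ a.
  apply: (@le_trans _ _ (a * (2 * `|v| `^ s * `|v|))).
    rewrite ler_wpM2l ?(ltW a0) //; apply: le_trans (ler_norm _) _.
    rewrite normrM ler_wpM2r //.
    have := @spow_holder s b u; rewrite /b [u + v]addrC addrK; apply.
    by rewrite s0 /s; lra.
  have := mulr_powRB1 (normr_ge0 v) a0; rewrite -/s => e.
  rewrite -mulrA [X in 2 * X]mulrC e; have := powR_ge0 `|v| a; nra.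
have : a * `|b| `^ a = a * (spow s b * u) + a * (spow s b * v).
  by rewrite -bb /b; ring.
move: hol; rewrite mulrBl; rewrite /s in tangent *; lra.
Qed.

End powers.

Section finite_moments.
Context d (T : measurableType d) (R : realType) (P : probability T R).
Implicit Types (F G : T -> R) (a : R).

Definition finite_moment a F :=
  measurable_fun setT F /\ integrableT P (fun x => `|F x| `^ a).

Lemma measurable_norm_powR a F : measurable_fun setT F ->
  measurable_fun setT (fun x => `|F x| `^ a).
Proof.
move=> mF; apply: (measurableT_comp (measurable_powR a)).
exact: measurableT_comp.
Qed.

Lemma finite_momentD a F G : 0 <= a <= 2 ->
  finite_moment a F -> finite_moment a G -> finite_moment a (fun x => F x + G x).
Proof.
move=> a02 [mF iF] [mG iG]; split; first exact: measurable_funD.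
apply: (@integrableT_le _ _ _ _ _ (fun x => 4 * (`|F x| `^ a + `|G x| `^ a))).
- by apply: measurable_norm_powR; exact: measurable_funD.
- by move=> x; rewrite ger0_norm ?powR_ge0 //; exact: powR_norm_add.
- by apply: integrableTZ; exact: integrableTD.
Qed.

Lemma finite_moment0 a : a != 0 -> finite_moment a (fun=> 0).
Proof.
move=> a0; split => //; rewrite normr0 powR0 //; exact: integrableT_cst.
Qed.

Lemma finite_moment_sum a I (s : seq I) (Q : pred I) (F : I -> T -> R) :
  0 < a <= 2 -> (forall i, Q i -> finite_moment a (F i)) ->
  finite_moment a (fun x => \sum_(i <- s | Q i) F i x).
Proof.
move=> /andP[a0 a2] iF; elim: s => [|i s IH].
  have -> : (fun x => \sum_(i <- [::] | Q i) F i x) = fun=> 0.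
    by apply/funext => x; rewrite big_nil.
  by apply: finite_moment0; rewrite gt_eqF.
have -> : (fun x => \sum_(j <- i :: s | Q j) F j x) =
    if Q i then fun x => F i x + \sum_(j <- s | Q j) F j x
    else fun x => \sum_(j <- s | Q j) F j x.
  by apply/funext => x; rewrite big_cons; case: (Q i).
by case: ifPn => // Qi; apply: finite_momentD; rewrite ?a2 ?(ltW a0) //; exact: iF.
Qed.

Lemma finite_moment_integrable a F : 1 <= a -> finite_moment a F -> integrableT P F.
Proof.
move=> a1 [mF iF].
apply: (@integrableT_le _ _ _ _ _ (fun x => 1 + `|F x| `^ a)) => //.
  move=> x; have [F1|/ltW F1] := leP `|F x| 1; first by rewrite (le_trans F1) // lerDl powR_ge0.
  by apply: le_trans (le1r_powR F1 a1) _; rewrite lerDr.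
by apply: integrableTD => //; exact: integrableT_cst.
Qed.

Lemma integrable_spow_mul a F G : 1 < a ->
  finite_moment a F -> finite_moment a G ->
  integrableT P (fun x => spow (a - 1) (F x) * G x).
Proof.
move=> a1 [mF iF] [mG iG].
apply: (@integrableT_le _ _ _ _ _ (fun x => `|G x| `^ a + `|F x| `^ a)).
- apply: measurable_funM => //; apply: (measurableT_comp (measurable_spow _) mF).
  by rewrite subr_gt0.
- move=> x; rewrite /spow !normrM normr_sg (ger0_norm (powR_ge0 _ _)).
  apply: le_trans (powR_mulB1 (ltW a1) (normr_ge0 (G x)) (normr_ge0 (F x))).
  rewrite [leRHS]mulrC ler_wpM2r // ler_piMl ?powR_ge0 //.
  by case: (F x != 0).
- exact: integrableTD.
Qed.

End finite_moments.

Section von_bahr_esseen.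
Context d (T : measurableType d) (R : realType) (n : nat).
Variable M : probability (n.-tuple T) R.

Definition degenerate (i : 'I_n) (F : n.-tuple T -> R) :=
  forall G, depends_on (~: [set i]) G -> integrableT M (fun x => G x * F x) ->
  \int[M]_x (G x * F x) = 0.

Variables (a : R) (F : {set 'I_n} -> n.-tuple T -> R).
Hypothesis a12 : 1 < a < 2.

(* Induction on [j]; the sets are split according to their largest element [m] outside of
   [D]. The block with largest element [m] is degenerate in [m], hence orthogonal to any
   function of the sum of the earlier blocks, and [m] joins [D] for the inner induction. *)
Lemma degenerate_norm_sum (j : nat) (D : {set 'I_n}) (Q : pred {set 'I_n}) :
  (forall A, Q A -> [/\ D \subset A, (#|A| <= #|D| + j)%N,
     depends_on A (F A), finite_moment M a (F A) &
     forall i, i \in A -> degenerate i (F A)]) ->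
  \int[M]_x (`|\sum_(A | Q A) F A x| `^ a) <=
    4 ^+ j * \sum_(A | Q A) \int[M]_x (`|F A x| `^ a).
Proof.
have [a1 a2] := andP a12; have a0 : 0 < a by lra.
have single D0 (Q0 : pred {set 'I_n}) : (forall A, Q0 A -> A = D0) ->
    \int[M]_x (`|\sum_(A | Q0 A) F A x| `^ a) <=
      \sum_(A | Q0 A) \int[M]_x (`|F A x| `^ a).
  move=> Q0D; have [Q0D0|nQ0D0] := boolP (Q0 D0).
    have E : Q0 =1 pred1 D0 by move=> A; apply/idP/eqP => [/Q0D|->].
    rewrite (eq_bigl _ _ E) big_pred1_eq; under eq_Rintegral do
      rewrite (eq_bigl _ _ E) big_pred1_eq.
    by [].
  have E : Q0 =1 pred0 by move=> A; apply/negbTE/negP => /[dup] /Q0D ->; apply/negP.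
  rewrite (eq_bigl _ _ E) big_pred0_eq; under eq_Rintegral do
    rewrite (eq_bigl _ _ E) big_pred0_eq normr0 powR0 ?gt_eqF //.
  by rewrite Rintegral_cst ?mul0r.
elim: j D Q => [|j IHj] D Q HQ.
  rewrite expr0 mul1r; apply: (single D) => A /HQ[DA cA _ _ _].
  by apply/eqP; rewrite eq_sym eqEcard DA; rewrite addn0 in cA.
pose Qm m := [pred A | Q A & [forall i, (i \in A :\: D) ==> (i < m)%N]].
suff H m : (m <= n)%N -> \int[M]_x (`|\sum_(A | Qm m A) F A x| `^ a) <=
    4 ^+ j.+1 * \sum_(A | Qm m A) \int[M]_x (`|F A x| `^ a).
  have E : Q =1 Qm n.
    move=> A /=; case: (Q A) => //=; apply/esym/forallP => i; apply/implyP => _.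
    exact: ltn_ord.
  rewrite (eq_bigl _ _ E); under eq_Rintegral do rewrite (eq_bigl _ _ E).
  exact: H.
elim: m => [_|m IHm mn].
  apply: (@le_trans _ _ (\sum_(A | Qm 0%N A) \int[M]_x (`|F A x| `^ a))).
    apply: (single D) => A /= /andP[/HQ[DA _ _ _ _] /forallP A0].
    apply/eqP; rewrite finset.eqEsubset DA andbT; apply/fintype.subsetP => i iA.
    by apply/negPn/negP => iD; have := A0 i; rewrite inE iD iA.
  rewrite ler_peMl ?exprn_ege1 //; last by lra.
  by apply: sumr_ge0 => A _; apply: Rintegral_ge0 => x _; exact: powR_ge0.
pose mo := Ordinal mn.
pose Rm := [pred A | Qm m.+1 A & mo \in A :\: D].
have splitQ (V : nmodType) (f : {set 'I_n} -> V) :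
    \sum_(A | Qm m.+1 A) f A = (\sum_(A | Qm m A) f A) + \sum_(A | Rm A) f A.
  rewrite (bigID (fun A => mo \in A :\: D)) /= addrC; congr (_ + _).
  apply: eq_bigl => A /=; rewrite -andbA; congr (_ && _).
  apply/andP/forallP => [[/forallP Am moA] i|Am].
    apply/implyP => iA; have /implyP/(_ iA) := Am i.
    rewrite ltnS leq_eqVlt => /orP[/eqP im|//].
    by move: moA; rewrite (_ : mo = i) ?iA //; apply/val_inj.
  split; last by apply/negP => moA; have /implyP/(_ moA) := Am mo; rewrite ltnn.
  by apply/forallP => i; apply/implyP => iA; have /implyP/(_ iA)/ltnW := Am i.
pose U x := \sum_(A | Qm m A) F A x; pose V x := \sum_(A | Rm A) F A x.
have QmQ m' A : Qm m' A -> Q A by move=> /andP[].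
have RmQ A : Rm A -> Q A by move=> /andP[/andP[]].
have a02 : 0 < a <= 2 by rewrite a0 ltW.
have fU : finite_moment M a U.
  by apply: finite_moment_sum => // A /QmQ /HQ[].
have fV : finite_moment M a V.
  by apply: finite_moment_sum => // A /RmQ /HQ[].
have cross : \int[M]_x (spow (a - 1) (U x) * V x) = 0.
  under eq_Rintegral do rewrite /V mulr_sumr.
  rewrite integralT_sum; last first.
    by move=> A /RmQ /HQ[_ _ _ fA _]; exact: integrable_spow_mul.
  apply: big1 => A RA; have [_ _ _ fA degA] := HQ _ (RmQ _ RA).
  have moA : mo \in A by move: RA => /andP[_]; rewrite inE => /andP[].
  have moD : mo \notin D by move: RA => /andP[_]; rewrite inE => /andP[].
  apply: (degA mo moA); last exact: integrable_spow_mul.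
  move=> x y xy; congr spow; apply: eq_bigr => B /= /andP[QB /forallP Bm].
  have [_ _ dB _ _] := HQ _ QB; apply: dB => i iB; apply: xy.
  rewrite !inE; apply/eqP => imo; have := Bm i.
  by rewrite inE iB imo moD /= ltnn.
have VIH : \int[M]_x (`|V x| `^ a) <= 4 ^+ j * \sum_(A | Rm A) \int[M]_x (`|F A x| `^ a).
  apply: (IHj (mo |: D)) => A RA; have [DA cA dA fA degA] := HQ _ (RmQ _ RA).
  move: RA => /andP[_]; rewrite inE => /andP[moD moA].
  split => //; last by rewrite cardsU1 moD add1n addSnnS.
  by apply/fintype.subsetP => i; rewrite !inE => /orP[/eqP ->//|]; exact: (fintype.subsetP DA).
rewrite splitQ mulrDr.
under eq_Rintegral do rewrite splitQ.
have [mU iU] := fU; have [mV iV] := fV.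
have iUV := integrable_spow_mul a1 fU fV.
apply: (@le_trans _ _ (\int[M]_x (`|U x| `^ a + a * (spow (a - 1) (U x) * V x) + 4 * `|V x| `^ a))).
  apply: integralT_le; last by move=> x; exact: powR_normD_le.
    by have [] : finite_moment M a (fun x => U x + V x) by apply: finite_momentD; rewrite ?ltW.
  apply: integrableTD; last exact: integrableTZ.
  by apply: integrableTD => //; exact: integrableTZ.
rewrite integralTD; [|by apply: integrableTD => //; exact: integrableTZ|exact: integrableTZ].
rewrite integralTD //; last exact: integrableTZ.
rewrite !integralTZ // cross mulr0 addr0 lerD //; first exact: IHm (ltnW mn).
by rewrite exprS -mulrA ler_wpM2l.
Qed.

End von_bahr_esseen.

(** * Iterated differences *)

Section taylor.
Context (R : realType).
Implicit Types (f : R -> R) (K x y : R).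

Lemma mean_value f f' x y : (forall z : R, is_derive z 1 f (f' z)) ->
  exists2 c, `|c - x| <= `|y| & f (x + y) - f x = f' c * y.
Proof.
move=> df.
have cf : continuous f.
  move=> z; apply: differentiable_continuous; apply/derivable1_diffP.
  by have [] := df z.
have [y0|y0|<-] := ltrgtP 0 y; last first.
- by exists x; rewrite ?subrr // addr0 mulr0 subrr.
- have xy : x + y < x by lra.
  have [c] := @MVT _ f f' _ _ xy (fun z _ => df z) (continuous_subspaceT cf).
  rewrite in_itv /= => /andP[c1 c2] E; exists c; last by move: E; lra.
  by rewrite !ler0_norm; lra.
- have xy : x < x + y by lra.
  have [c] := @MVT _ f f' _ _ xy (fun z _ => df z) (continuous_subspaceT cf).
  rewrite in_itv /= => /andP[c1 c2] E; exists c; last by move: E; lra.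
  by rewrite !ger0_norm; lra.
Qed.

Lemma taylor1 f f' K x y : (forall z : R, is_derive z 1 f (f' z)) ->
  (forall z : R, `|f' z| <= K) -> `|f (x + y) - f x| <= K * `|y|.
Proof.
move=> df fK; have [c _ ->] := mean_value x y df.
by rewrite normrM ler_wpM2r.
Qed.

Lemma taylor2 f f' f'' K x y : (forall z : R, is_derive z 1 f (f' z)) ->
  (forall z : R, is_derive z 1 f' (f'' z)) -> (forall z : R, `|f'' z| <= K) ->
  `|f (x + y) - f x - f' x * y| <= K * `|y| ^+ 2.
Proof.
move=> df df' fK; have [c cx ->] := mean_value x y df.
rewrite -mulrBl normrM expr2 mulrA ler_wpM2r //.
have := taylor1 x (c - x) df' fK; rewrite subrKC => H; apply: le_trans H _.
by rewrite ler_wpM2l // (le_trans _ (fK x)).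
Qed.

Lemma taylor3 f f' f'' f3 K x y : (forall z : R, is_derive z 1 f (f' z)) ->
  (forall z : R, is_derive z 1 f' (f'' z)) -> (forall z : R, is_derive z 1 f'' (f3 z)) ->
  (forall z : R, `|f3 z| <= K) ->
  `|f (x + y) - f x - f' x * y - f'' x * (y ^+ 2 / 2)| <= K * `|y| ^+ 3.
Proof.
move=> df df' df'' fK.
pose g z := f z - f' x * z - f'' x * ((z - x) ^+ 2 / 2).
pose g' z := f' z - f' x - f'' x * (z - x).
have dg (z : R) : is_derive z 1 g (g' z).
  have := df z => dfz; rewrite /g; apply: is_derive_eq.
  by rewrite /g' /GRing.scale /=; field.
have [c cx] := mean_value x y dg.
have -> : g (x + y) - g x = f (x + y) - f x - f' x * y - f'' x * (y ^+ 2 / 2).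
  by rewrite /g; field.
move=> ->; rewrite normrM exprSr mulrA ler_wpM2r // /g'.
have := taylor2 x (c - x) df' df'' fK; rewrite subrKC => H; apply: le_trans H _.
by rewrite ler_wpM2l ?(le_trans _ (fK x)) // lerXn2r // nnegrE.
Qed.

Definition smooth K m (h : nat -> R -> R) :=
  (forall i, (i < m)%N -> forall z : R, is_derive z 1 (h i) (h i.+1 z)) /\
  (forall i, (i <= m)%N -> forall z : R, `|h i z| <= K).

Fixpoint diff (s : seq R) (h : R -> R) (u : R) : R :=
  if s is a :: s' then diff s' h (u + a) - diff s' h u else h u.

Lemma diff_cons a s h u :
  diff (a :: s) h u = diff s (fun v => h (v + a) - h v) u.
Proof.
rewrite /=; elim: s u => //= b s IH u.
by rewrite -!IH [u + b + a]addrAC; ring.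
Qed.

Lemma interpolation (K v y e : R) : 0 <= e <= 1 -> 0 <= v -> v <= 2 * K -> v <= K * y ->
  0 <= y -> v <= 2 * K * y `^ e.
Proof.
move=> /andP[e0 e1] v0 v1 v2 y0; have p0 := powR_ge0 y e.
have [y1|/ltW y1] := leP 1 y.
  have := powR_mono e0 ler01 y1; rewrite powR1 => h1.
  have K0 : 0 <= 2 * K by exact: le_trans v1.
  by apply: le_trans v1 _; rewrite ler_peMr.
have [yE|yn] := eqVneq y 0.
  have K0 : 0 <= 2 * K by exact: le_trans v1.
  by apply: le_trans v2 _; rewrite yE mulr0 mulr_ge0 // -yE.
have ye : y <= y `^ e by rewrite ger1_powR // y1 lt_def yn y0.
have K0 : 0 <= K by lra.
have := ler_wpM2l K0 ye; have := mulr_ge0 K0 p0; lra.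
Qed.

Lemma smooth_diff K m h a : smooth K m.+1 h ->
  forall i, (i <= m)%N -> forall z : R, `|h i (z + a) - h i z| <= K * `|a|.
Proof.
move=> [dh hK] i im z; apply: (taylor1 z a (dh i _)) => //.
exact: hK.
Qed.

Lemma is_derive_shiftr f f' (a z : R) : (forall x : R, is_derive x 1 f (f' x)) ->
  is_derive z 1 (fun v => f (v + a)) (f' (z + a)).
Proof.
move=> df; have ds : is_derive z 1 (fun v : R => v + a) 1.
  by apply: is_derive_eq; rewrite ?addr0.
by have := @is_derive1_comp R f (fun v : R => v + a) z _ _ (df (z + a)) ds; rewrite mulr1.
Qed.

Lemma smooth_diffS K m h a C : smooth K m.+1 h ->
  (forall i, (i <= m)%N -> forall z : R, `|h i (z + a) - h i z| <= C) ->
  smooth C m (fun i v => h i (v + a) - h i v).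
Proof.
move=> [dh hK] hC; split=> // i im z.
have d2 := dh i (leqW im) z.
exact: is_deriveB (is_derive_shiftr a z (dh i (leqW im))) d2.
Qed.

Lemma diff_bound s m h K e u : 0 <= e <= 1 -> (size s <= m)%N -> smooth K m h ->
  `|diff s (h 0%N) u| <= 2 ^+ size s * K * \prod_(a <- s) `|a| `^ e.
Proof.
move=> e01; elim: s m h K => [|a s IH] [|m] h K //= sm [dh hK].
- by rewrite big_nil expr0 mul1r mulr1 hK.
- by rewrite big_nil expr0 mul1r mulr1 hK.
have sh : smooth K m.+1 h by [].
have := diff_cons a s (h 0%N) u => /= ->.
have hC : forall i, (i <= m)%N -> forall z : R, `|h i (z + a) - h i z| <= 2 * K * `|a| `^ e.
  move=> i im z; apply: interpolation => //; last exact: smooth_diff sh _ im z.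
  by apply: le_trans (ler_normB _ _) _; rewrite mulrDl mul1r lerD // hK // leqW.
apply: le_trans (IH m _ _ sm (smooth_diffS sh hC)) _.
by rewrite big_cons exprSr le_eqVlt; apply/orP; left; apply/eqP; ring.
Qed.

Lemma diff_main s m h K e u : 0 <= e <= 1 -> (size s < m)%N -> smooth K m h ->
  `|diff s (h 0%N) u - (\prod_(a <- s) a) * h (size s) u| <=
    2 * K * \prod_(a <- s) `|a| * \sum_(a <- s) `|a| `^ e.
Proof.
move=> e01; elim: s m h K => [|a s IH] m h K sm sh.
  by rewrite /= !big_nil mul1r subrr normr0 mulr0.
case: m sm sh => // m sm sh; have [dh hK] := sh.
have hC := @smooth_diff _ _ _ a sh.
have := IH m _ _ sm (smooth_diffS sh hC); rewrite -diff_cons /= => {}IH.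
rewrite !big_cons /=.
have hr : `|h (size s) (u + a) - h (size s) u - h (size s).+1 u * a| <=
    2 * (K * `|a|) * `|a| `^ e.
  apply: interpolation => //.
    apply: le_trans (ler_normB _ _) _; rewrite mulrDl mul1r lerD //.
      exact: hC (ltnW sm) u.
    by rewrite normrM ler_wpM2r // hK // leqW.
  have m2 : ((size s).+1 < m.+1)%N by [].
  have := taylor2 u a (dh _ (ltnW sm)) (dh _ m2) (fun z => hK (size s).+2 m2 z).
  by rewrite expr2 mulrA.
set D := diff _ _ _ - diff _ _ _ in IH *.
set p := \prod_(b <- s) b in IH *; set q := \prod_(b <- s) `|b| in IH *.
have pq : `|p| = q by rewrite /p /q normr_prod.
set S := \sum_(b <- s) _ in IH *.
rewrite (_ : D - a * p * h (size s).+1 u =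
   (D - p * (h (size s) (u + a) - h (size s) u)) +
   p * (h (size s) (u + a) - h (size s) u - h (size s).+1 u * a)); last by ring.
apply: le_trans (ler_normD _ _) _; rewrite normrM pq.
apply: (@le_trans _ _ (2 * (K * `|a|) * q * S + q * (2 * (K * `|a|) * `|a| `^ e))).
  by rewrite lerD // ler_wpM2l // -pq.
by rewrite le_eqVlt; apply/orP; left; apply/eqP; ring.
Qed.

End taylor.

Lemma exists_perm_imset (T : finType) (A B : {set T}) (a b : T) :
  #|A| = #|B| -> a \in A -> b \in B ->
  exists s : {perm T}, s @: B = A /\ s b = a.
Proof.
move=> cAB aA bB.
pose lA := enum A ++ enum (~: A); pose lB := enum B ++ enum (~: B).
have szA : size lA = #|T| by rewrite size_cat -!cardE cardsC.
have szB : size lB = #|T| by rewrite size_cat -!cardE cardsC.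
have memB i : i \in lB by rewrite mem_cat !mem_enum inE orbN.
have uA : uniq lA.
  rewrite cat_uniq !enum_uniq andbT /=; apply/hasPn => i.
  by rewrite !mem_enum inE.
pose f i := nth i lA (index i lB).
have idx i : (index i lB < size lA)%N by rewrite szA -szB index_mem.
have finj : injective f.
  move=> i j; rewrite /f (set_nth_default j) // => /eqP.
  rewrite nth_uniq // => /eqP E.
  by rewrite -(nth_index i (memB i)) -[RHS](nth_index i (memB j)) E.
have fA i : i \in B -> f i \in A.
  move=> iB; rewrite /f /lA nth_cat.
  have -> : (index i lB < size (enum A))%N.
    by rewrite -cardE cAB cardE /lB index_cat mem_enum iB index_mem mem_enum.
  rewrite -mem_enum mem_nth //.
  by rewrite -cardE cAB cardE /lB index_cat mem_enum iB index_mem mem_enum.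
exists (perm finj * tperm (f b) a)%g; split; last by rewrite permM permE tpermL.
apply/eqP; rewrite eqEcard card_imset; last exact: perm_inj.
rewrite cAB leqnn andbT; apply/fintype.subsetP => _ /imsetP[i iB ->].
rewrite permM permE; case: tpermP => [//|_|_ _]; [exact: fA|exact: fA].
Qed.

Section permute.
Context (T : Type) (n : nat).

Definition permute (s : {perm 'I_n}) (x : n.-tuple T) : n.-tuple T :=
  [tuple tnth x (s i) | i < n].

Lemma tnth_permute s x i : tnth (permute s x) i = tnth x (s i).
Proof. by rewrite tnth_mktuple. Qed.

Lemma permuteK s : cancel (permute s) (permute s^-1%g).
Proof. by move=> x; apply: eq_from_tnth => i; rewrite !tnth_permute permKV. Qed.

Lemma permuteVK s : cancel (permute s^-1%g) (permute s).
Proof. by move=> x; apply: eq_from_tnth => i; rewrite !tnth_permute permK. Qed.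

End permute.

Lemma measurable_permute d (T : measurableType d) n (s : {perm 'I_n}) :
  measurable_fun setT (@permute T n s).
Proof.
apply/measurable_fun_tnthP => i; rewrite /comp.
by under eq_fun do rewrite tnth_permute; exact: measurable_tnth.
Qed.

Section exchangeability.
Context d (T : measurableType d) (R : realType) (n : nat).
Variable M : probability (n.-tuple T) R.
Hypotheses (MX : product_law M) (Mid : identical_marginals M).
Variable s : {perm 'I_n}.

Lemma permute_law U : measurable U -> M U = M (permute s @^-1` U).
Proof.
move=> mU; rewrite (@tuple_measure_unique _ _ _ _ M (pushforward M (permute s))) //.
  exact: measurable_permute.
move=> mf B mB; rewrite /= /pushforward.
have -> : permute s @^-1` rectangle B = rectangle (B \o s^-1%g).
  apply/seteqP; split=> x /= xB i.
    by have := xB (s^-1%g i); rewrite tnth_permute permKV.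
  by rewrite tnth_permute; have := xB (s i); rewrite /= permK.
rewrite (MX mB); apply: etrans (esym (MX (fun i => mB (s^-1%g i)))).
rewrite [RHS](reindex_inj (@perm_inj _ s)) /=; apply: eq_bigr => i _.
by rewrite permK; exact: Mid.
Qed.

Lemma ge0_integral_permute (F : n.-tuple T -> \bar R) :
  measurable_fun setT F -> (forall x, (0 <= F x)%E) ->
  (\int[M]_x F (permute s x) = \int[M]_x F x)%E.
Proof.
move=> mF F0.
rewrite [RHS](eq_measure_integral (pushforward M (permute s))).
- exact: measurable_permute.
- by move=> mf; rewrite ge0_integral_pushforward // preimage_setT.
- by move=> mf U mU _; exact: permute_law.
Qed.

Lemma integrable_permute (F : n.-tuple T -> R) :
  integrableT M F -> integrableT M (F \o permute s).
Proof.
move=> iF; have mF := integrableT_measurable iF.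
apply/integrableP; split.
  by apply/measurable_EFinP; exact: measurableT_comp mF (measurable_permute s).
move/integrableP : iF => [_].
rewrite -(@ge0_integral_permute (fun x => `|(F x)%:E|%E)) //.
by apply: measurableT_comp => //; exact/measurable_EFinP.
Qed.

Lemma integral_permute (F : n.-tuple T -> R) : integrableT M F ->
  \int[M]_x F (permute s x) = \int[M]_x F x.
Proof.
move=> iF; have mF := integrableT_measurable iF; congr fine.
rewrite [RHS](eq_measure_integral (pushforward M (permute s))).
- exact: measurable_permute.
- move=> mf; rewrite integral_pushforward // ?preimage_setT //.
    exact/measurable_EFinP.
  exact: integrable_permute.
- by move=> mf U mU _; exact: permute_law.
Qed.

End exchangeability.

Lemma degenerate_permute d (T : measurableType d) (R : realType) n
    (M : probability (n.-tuple T) R) (s : {perm 'I_n}) i (F : n.-tuple T -> R) :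
  product_law M -> identical_marginals M ->
  degenerate M i F -> degenerate M (s i) (F \o permute s).
Proof.
move=> MX Mid Fi G Gi iGF.
pose H x := G (permute s^-1%g x) * F x.
have E x : G x * (F \o permute s) x = H (permute s x) by rewrite /H permuteK.
have iH : integrableT M H.
  apply: eq_integrableT (integrable_permute MX Mid (s^-1)%g iGF) => x.
  by rewrite /H /= permuteVK.
under eq_Rintegral do rewrite E.
rewrite (integral_permute MX Mid s iH); apply: Fi => // x y xy.
apply: Gi => j; rewrite !tnth_permute !inE => ji; apply: xy.
by rewrite !inE; apply: contra ji => /eqP <-; rewrite permKV.
Qed.

Section symmetric_statistics.
Context d (T : measurableType d) (R : realType) (n k : nat).
Variable t : forall j : nat, j.-tuple T -> R.
Hypothesis t_measurable : forall j, (1 <= j <= k)%N -> measurable_fun setT (@t j).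
Hypothesis t_symmetric : forall j (v : j.-tuple T) (sg : 'I_j -> 'I_j), (1 <= j <= k)%N ->
  injective sg -> t [tuple tnth v (sg i) | i < j] = t v.

Definition coord (i : 'I_n) (x : n.-tuple T) := tnth x i.
Definition first (j : nat) : {set 'I_n} := [set i : 'I_n | (i < j)%N].

Local Notation TA := (TA coord t).

Lemma card_first j : (j <= n)%N -> #|first j| = j.
Proof.
move=> jn; have -> : first j = [set widen_ord jn i | i : 'I_j].
  apply/setP => i; rewrite inE; apply/idP/imsetP => [ij|[i' _ ->] /=].
    by exists (Ordinal ij) => //; apply/val_inj.
  exact: (ltn_ord i').
rewrite card_imset ?card_ord // => i i' /(congr1 val) /= E; exact/val_inj.
Qed.

Lemma depends_on_TA (A : {set 'I_n}) : depends_on A (TA A).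
Proof.
move=> x y xy; congr (@t _ _); apply: eq_from_tnth => i.
by rewrite !tnth_mktuple; apply: xy; exact: enum_valP.
Qed.

Lemma measurable_TA (A : {set 'I_n}) : (1 <= #|A| <= k)%N -> measurable_fun setT (TA A).
Proof.
move=> Ak; apply: (measurableT_comp (t_measurable Ak)).
apply/measurable_fun_tnthP => i; rewrite /comp.
by under eq_fun do rewrite tnth_mktuple; exact: measurable_tnth.
Qed.

Let t_reindex j j' (e : j = j') (v : j.-tuple T) (sg : 'I_j' -> 'I_j) :
  (1 <= j <= k)%N -> injective sg -> t [tuple tnth v (sg i) | i < j'] = t v.
Proof. by case: _ / e sg => sg; exact: t_symmetric. Qed.

Lemma TA_permute (s : {perm 'I_n}) (A B : {set 'I_n}) x : s @: B = A ->
  (1 <= #|B| <= k)%N -> TA A x = TA B (permute s x).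
Proof.
move=> sB Bk.
have cAB : #|A| = #|B| by rewrite -sB card_imset //; exact: perm_inj.
have sA i : s (enum_val (A := B) i) \in A by rewrite -sB imset_f // enum_valP.
pose sg i := enum_rank_in (sA i) (s (enum_val (A := B) i)).
have sgE i : enum_val (sg i) = s (enum_val (A := B) i) by rewrite enum_rankK_in.
rewrite /Defs.TA -(@t_reindex _ _ cAB _ sg); last 2 first.
- by rewrite cAB.
- move=> i j /(congr1 (@enum_val _ _)); rewrite !sgE => /perm_inj; exact: enum_val_inj.
congr (@t _ _); apply: eq_from_tnth => i.
by rewrite !tnth_mktuple sgE /coord tnth_permute.
Qed.

Variable M : probability (n.-tuple T) R.
Hypotheses (MX : product_law M) (Mid : identical_marginals M).

Lemma integral_TA_permute (s : {perm 'I_n}) (A B : {set 'I_n}) (g : R -> R) :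
  s @: B = A -> (1 <= #|B| <= k)%N -> integrableT M (g \o TA B) ->
  integrableT M (g \o TA A) /\ \int[M]_x g (TA A x) = \int[M]_x g (TA B x).
Proof.
move=> sB Bk iB; split.
  apply: eq_integrableT (integrable_permute MX Mid s iB) => x /=.
  by rewrite (TA_permute x sB Bk).
under eq_Rintegral do rewrite (TA_permute _ sB Bk).
exact: (integral_permute MX Mid s iB).
Qed.

End symmetric_statistics.

Lemma young_le (R : realType) (a b x y : R) : 1 < a -> a^-1 + b^-1 = 1 -> 0 <= x -> 0 <= y ->
  x * y <= x `^ a + y `^ b.
Proof.
move=> a1 ab x0 y0; have a0 : 0 < a by lra.
have ia : 0 < a^-1 < 1 by rewrite invr_gt0 a0 invf_lt1.
have ib : 0 < b^-1 < 1 by lra.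
have b0 : 0 < b by rewrite -invr_gt0; lra.
apply: le_trans (conjugate_powR x0 y0 a0 b0 ab) _.
by rewrite lerD // ler_piMr ?powR_ge0 //; lra.
Qed.

Lemma prod_powR (R : realType) I (s : seq I) (f : I -> R) (r : R) :
  (forall i, 0 <= f i) -> (\prod_(i <- s) f i) `^ r = \prod_(i <- s) (f i `^ r).
Proof.
move=> f0; elim: s => [|i s IH]; first by rewrite !big_nil powR1.
by rewrite !big_cons powRM ?IH // prodr_ge0.
Qed.

Lemma sum_powR (R : realType) I (s : seq I) (f : I -> R) (b : R) : 0 < b ->
  \prod_(i <- s) (b `^ f i) = b `^ (\sum_(i <- s) f i).
Proof.
move=> b0; elim: s => [|i s IH]; first by rewrite !big_nil powRr0.
by rewrite !big_cons IH powRD // (gt_eqF b0) implybT.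
Qed.

Section independent_products.
Context d (T : measurableType d) (R : realType) (n : nat).
Variable M : probability (n.-tuple T) R.
Hypothesis MX : product_law M.

Lemma depends_on_coord (S : Type) (f : T -> S) i :
  depends_on [set i] (fun x : n.-tuple T => f (tnth x i)).
Proof. by move=> x y xy; rewrite (xy i) // inE. Qed.

Lemma integral_prod_indep (f : 'I_n -> T -> R) (s : seq 'I_n) : uniq s ->
  (forall i, integrableT M (fun x => f i (tnth x i))) ->
  integrableT M (fun x => \prod_(i <- s) f i (tnth x i)) /\
  \int[M]_x (\prod_(i <- s) f i (tnth x i)) = \prod_(i <- s) \int[M]_x f i (tnth x i).
Proof.
move=> + fi; elim: s => [_|i s IH /= /andP[nis us]].
  split; first by under eq_fun do rewrite big_nil; exact: integrableT_cst.
  by under eq_Rintegral do rewrite big_nil; rewrite big_nil integralT_cst.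
have [iI eI] := IH us.
have ds : depends_on (~: [set i]) (fun x : n.-tuple T => \prod_(j <- s) f j (tnth x j)).
  move=> x y xy; rewrite !big_seq; apply: eq_bigr => j js; rewrite xy // !inE.
  by apply: contra nis => /eqP <-.
have di := @depends_on_coord _ (f i) i.
split.
  under eq_fun do rewrite big_cons.
  exact: (integrable_indep MX di ds (fi i) iI).
under eq_Rintegral do rewrite big_cons.
by rewrite (integral_indep MX di ds (fi i) iI) eI big_cons.
Qed.

End independent_products.

Section linear_part.
Context d (T : measurableType d) (R : realType) (n : nat).
Variable M : probability (n.-tuple T) R.
Hypothesis MX : product_law M.
Variables (l : T -> R) (beta : R).
Hypothesis n0 : (0 < n)%N.
Hypothesis l_measurable : measurable_fun setT l.
Local Notation L i x := (l (tnth x i)).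
Local Notation N := (n%:R : R).
Hypothesis L2 : forall i, integrableT M (fun x => L i x ^+ 2) /\
  N * \int[M]_x (L i x ^+ 2) = 1.
Hypothesis L3 : forall i, integrableT M (fun x => `|L i x| ^+ 3) /\
  N * \int[M]_x (`|L i x| ^+ 3) = beta.

Let N0 : 0 < N. Proof. by rewrite ltr0n. Qed.

Lemma measurable_L i : measurable_fun setT (fun x : n.-tuple T => L i x).
Proof. exact: (measurableT_comp l_measurable (measurable_tnth i)). Qed.

Lemma beta_gt0 : Num.sqrt N^-1 <= 3 * beta /\ 0 < beta.
Proof.
have i0 : 'I_n by exact: Ordinal n0.
have [i2 e2] := L2 i0; have [i3 e3] := L3 i0.
set s := Num.sqrt N^-1.
have s0 : 0 < s by rewrite sqrtr_gt0 invr_gt0.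
have s2 : s ^+ 2 = N^-1 by rewrite sqr_sqrtr // invr_ge0 ltW.
have H : \int[M]_x (L i0 x ^+ 2) <=
    \int[M]_x (s ^+ 2 / 4 + 2 / s * `|L i0 x| ^+ 3).
  apply: integralT_le => //.
    by apply: integrableTD; [exact: integrableT_cst|exact: integrableTZ].
  move=> x; rewrite -real_normK ?num_real //; set y := `|_|.
  have y0 : 0 <= y by rewrite /y.
  have [ys|/ltW ys] := leP y (s / 2).
    apply: (@le_trans _ _ (s ^+ 2 / 4)).
      by rewrite !expr2; nra.
    by rewrite lerDl mulr_ge0 ?exprn_ge0 // divr_ge0 // ltW.
  apply: (@le_trans _ _ (2 / s * y ^+ 3)); last by rewrite lerDr divr_ge0 ?sqr_ge0.
  have -> : 2 / s * y ^+ 3 = (2 * y / s) * y ^+ 2 by field; rewrite gt_eqF.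
  by rewrite ler_peMl ?sqr_ge0 // ler_pdivlMr //; lra.
rewrite integralTD ?integralT_cst ?integralTZ // in H; last 2 first.
- exact: integrableT_cst.
- exact: integrableTZ.
have {}H : 1 <= N * (s ^+ 2 / 4) + 2 / s * beta.
  by have := ler_wpM2l (ltW N0) H; rewrite e2 mulrDr [N * (2 / s * _)]mulrCA e3.
have : 3 / 4 <= 2 / s * beta.
  by move: H; rewrite s2 mulrA divff ?gt_eqF //; lra.
rewrite mulrAC ler_pdivlMr // => H'.
by split; lra.
Qed.

Lemma moment_L i q : 2 <= q <= 3 -> integrableT M (fun x => `|L i x| `^ q) /\
  \int[M]_x (`|L i x| `^ q) <= 2 * N^-1 * beta `^ (q - 2).
Proof.
move=> /andP[q2 q3]; have [i2 e2] := L2 i; have [i3 e3] := L3 i.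
have [_ b0] := beta_gt0.
pose G x := beta `^ (q - 2) * L i x ^+ 2 + beta `^ (q - 3) * `|L i x| ^+ 3.
have iG : integrableT M G by apply: integrableTD; exact: integrableTZ.
have FG x : `|L i x| `^ q <= G x.
  rewrite /G; have -> : L i x ^+ 2 = `|L i x| ^+ 2 by rewrite real_normK // num_real.
  set y := `|L i x|; have y0 : 0 <= y by rewrite /y.
  have [->|yn] := eqVneq y 0.
    by rewrite powR0 ?addr_ge0 ?mulr_ge0 ?powR_ge0 //; lra.
  have yp : 0 < y by rewrite lt_def yn.
  have e : y `^ q = y `^ (q - 2) * y ^+ 2.
    by rewrite -powR_mulrn // -powRD ?(negbTE yn) ?implybT //; congr (_ `^ _); ring.
  have e' : y `^ q = y `^ (q - 3) * y ^+ 3.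
    by rewrite -powR_mulrn // -powRD ?(negbTE yn) ?implybT //; congr (_ `^ _); ring.
  have [yb|/ltW yb] := leP y beta.
    rewrite e; apply: (@le_trans _ _ (beta `^ (q - 2) * y ^+ 2)).
      by rewrite ler_wpM2r ?sqr_ge0 // powR_mono //; lra.
    by rewrite lerDl mulr_ge0 ?powR_ge0 ?exprn_ge0.
  rewrite e'; apply: (@le_trans _ _ (beta `^ (q - 3) * y ^+ 3)).
    rewrite ler_wpM2r ?exprn_ge0 //.
    have E (z : R) : z `^ (q - 3) = (z `^ (3 - q))^-1 by rewrite -powRN opprB.
    rewrite !E lef_pV2 ?posrE ?powR_gt0 //.
    by apply: powR_mono => //; lra.
  by rewrite lerDr mulr_ge0 ?powR_ge0 ?exprn_ge0.
have iF : integrableT M (fun x => `|L i x| `^ q).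
  apply: (integrableT_le _ _ iG); first exact: (measurable_norm_powR _ (measurable_L i)).
  by move=> x; rewrite ger0_norm ?powR_ge0.
split=> //; apply: le_trans (integralT_le iF iG FG) _.
rewrite integralTD ?integralTZ //; [|exact: integrableTZ|exact: integrableTZ].
have -> : \int[M]_x (L i x ^+ 2) = N^-1.
  by apply: (mulfI (lt0r_neq0 N0)); rewrite e2 divff // gt_eqF.
have -> : \int[M]_x (`|L i x| ^+ 3) = N^-1 * beta.
  by rewrite -e3 mulKf // gt_eqF.
have -> : beta `^ (q - 2) = beta `^ (q - 3) * beta.
  rewrite -[X in _ = _ * X]powRr1 ?ltW // -powRD ?(gt_eqF b0) ?implybT //.
  by congr (_ `^ _); ring.
by rewrite le_eqVlt; apply/orP; left; apply/eqP; ring.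
Qed.

Lemma moment_prod_L (s : seq 'I_n) (q : 'I_n -> R) (th : R) : uniq s ->
  (forall i, 2 <= q i <= 3) -> \sum_(i <- s) (q i - 2) = th ->
  integrableT M (fun x => \prod_(i <- s) `|L i x| `^ q i) /\
  \int[M]_x (\prod_(i <- s) `|L i x| `^ q i) <= (2 * N^-1) ^+ size s * beta `^ th.
Proof.
move=> us q23 <-; have [_ b0] := beta_gt0.
have := @integral_prod_indep _ _ _ _ M MX (fun i y => `|l y| `^ q i) s us
  (fun i => (moment_L i (q23 i)).1).
move=> [iI eI]; split=> //; rewrite eI.
rewrite -(sum_powR _ _ b0).
elim: (s) => [|i s' IH]; first by rewrite !big_nil expr0 mulr1.
rewrite !big_cons exprS mulrACA; apply: ler_pM => //.
- by apply: Rintegral_ge0 => x _; exact: powR_ge0.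
- by apply: prodr_ge0 => j _; apply: Rintegral_ge0 => x _; exact: powR_ge0.
- exact: (moment_L i (q23 i)).2.
Qed.

End linear_part.

(** * The contribution of a single set of indices *)

Section one_subset.
Context d (T : measurableType d) (R : realType) (n : nat).
Variable M : probability (n.-tuple T) R.
Hypothesis MX : product_law M.
Variables (l : T -> R) (beta : R).
Hypothesis n0 : (0 < n)%N.
Hypothesis l_measurable : measurable_fun setT l.
Local Notation L i x := (l (tnth x i)).
Local Notation N := (n%:R : R).
Hypothesis L2 : forall i, integrableT M (fun x => L i x ^+ 2) /\
  N * \int[M]_x (L i x ^+ 2) = 1.
Hypothesis L3 : forall i, integrableT M (fun x => `|L i x| ^+ 3) /\
  N * \int[M]_x (`|L i x| ^+ 3) = beta.

Definition outside (s : seq 'I_n) : {set 'I_n} := [set i : 'I_n | i \notin s].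

Lemma depends_on_outside_diff (h : R -> R) (s : seq 'I_n) (W : n.-tuple T -> R) i :
  i \notin s -> depends_on (~: [set i]) W ->
  depends_on (~: [set i]) (fun x => diff [seq L j x | j <- s] h (W x)).
Proof.
move=> nis Wi x y xy; rewrite (Wi x y xy); congr (diff _ _ _).
apply/eq_in_map => j js; rewrite xy // !inE.
by apply: contra nis => /eqP <-.
Qed.

Lemma measurable_diff (h : R -> R) (s : seq 'I_n) (W : n.-tuple T -> R) :
  measurable_fun setT h -> measurable_fun setT W ->
  measurable_fun setT (fun x => diff [seq L j x | j <- s] h (W x)).
Proof.
move=> mh; elim: s W => [|i s IH] W mW /=; first exact: measurableT_comp.
apply: measurable_funB; last exact: IH.
apply: (IH (fun x => W x + L i x)).
by apply: measurable_funD => //; exact: (measurable_L l_measurable i).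
Qed.

Lemma diff_bounded (h : R -> R) (K : R) (s : seq R) u : (forall v, `|h v| <= K) ->
  `|diff s h u| <= 2 ^+ size s * K.
Proof.
move=> hK; elim: s u => [|a s IH] u /=; first by rewrite expr0 mul1r.
apply: le_trans (ler_normB _ _) _; rewrite exprS.
by have := IH u; have := IH (u + a); lra.
Qed.

Lemma integral_degenerate_diff (F : n.-tuple T -> R) (h : R -> R) (K : R) (s : seq 'I_n)
    (W : n.-tuple T -> R) :
  integrableT M F -> (forall i, i \in s -> degenerate M i F) ->
  measurable_fun setT h -> (forall v, `|h v| <= K) -> uniq s ->
  measurable_fun setT W -> depends_on (outside s) W ->
  \int[M]_x (F x * h (W x + \sum_(i <- s) L i x)) =
  \int[M]_x (F x * diff [seq L i x | i <- s] h (W x)).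
Proof.
move=> iF + mh hK; elim: s W => [|i s IH] W Fs us mW dW.
  by apply: eq_Rintegral => x _; rewrite big_nil addr0.
have [nis us'] := andP us.
have dWi : depends_on (~: [set i]) W.
  apply: depends_onS dW; apply/fintype.subsetP => j.
  by rewrite !inE negb_or => /andP[].
have mWi : measurable_fun setT (fun x => W x + L i x).
  by apply: measurable_funD => //; exact: (measurable_L l_measurable i).
have iFd V : measurable_fun setT V ->
    integrableT M (fun x => F x * diff [seq L j x | j <- s] h (V x)).
  move=> mV; apply: (@integrableT_le _ _ _ _ _ (fun x => 2 ^+ size s * K * `|F x|)).
  - apply: measurable_funM; first exact: integrableT_measurable iF.
    exact: measurable_diff.
  - move=> x; rewrite normrM mulrC ler_wpM2r //.
    by have := diff_bounded [seq L j x | j <- s] (V x) hK; rewrite size_map.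
  - by apply: integrableTZ; exact: integrableT_norm.
transitivity (\int[M]_x (F x * diff [seq L j x | j <- s] h (W x + L i x))).
  rewrite -(IH (fun x => W x + L i x)) //.
  - by apply: eq_Rintegral => x _; rewrite big_cons addrA.
  - by move=> j js; apply: Fs; rewrite inE js orbT.
  - move=> x y xy; congr (_ + _).
      by apply: dW => j; rewrite !inE negb_or => /andP[_ js]; apply: xy; rewrite inE.
    by rewrite xy // inE.
transitivity (\int[M]_x (F x * diff [seq L j x | j <- i :: s] h (W x)
    + F x * diff [seq L j x | j <- s] h (W x))).
  by apply: eq_Rintegral => x _ /=; ring.
rewrite integralTD; last 2 first.
- by apply: eq_integrableT (integrableTB (iFd _ mWi) (iFd _ mW)) => x /=; ring.
- exact: iFd.
rewrite -[RHS]addr0; congr (_ + _).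
under eq_Rintegral do rewrite mulrC.
apply: (Fs i); first by rewrite inE eqxx.
- exact: depends_on_outside_diff.
- by apply: eq_integrableT (iFd _ mW) => x; rewrite mulrC.
Qed.

Section exponents.
Variables (a b : R) (j : nat).
Hypotheses (a12 : 1 < a < 2) (ab : a^-1 + b^-1 = 1).

Lemma conjugate_gt2 : 2 < b.
Proof.
have [a1 a2] := andP a12; have a0 : 0 < a by lra.
have ia : a^-1 < 1 by rewrite invf_lt1.
have b0 : 0 < b by rewrite -invr_gt0; move: ab ia; lra.
have e : a + b = a * b by rewrite -[RHS]mulr1 -ab; field; rewrite !gt_eqF.
by rewrite ltNge; apply/negP => b2; nra.
Qed.

Variables (F : n.-tuple T -> R) (s : seq 'I_n).
Hypotheses (fF : finite_moment M a F) (us : uniq s) (sj : size s = j) (j0 : (0 < j)%N).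

Let Fa := \int[M]_x (`|F x| `^ a).
Let rest := (2 * N^-1) ^+ j * beta.

Lemma young_prod_L (q : 'I_n -> R) :
  (forall i, 2 <= q i <= 3) -> \sum_(i <- s) (q i - 2) = 1 ->
  integrableT M (fun x => `|F x| * \prod_(i <- s) `|L i x| `^ (q i / b)) /\
  \int[M]_x (`|F x| * \prod_(i <- s) `|L i x| `^ (q i / b)) <= Fa + rest.
Proof.
move=> q23 qs; have [mF iF] := fF; have b2 := conjugate_gt2.
have [iP eP] := moment_prod_L MX n0 l_measurable L2 L3 us q23 qs.
pose G x := `|F x| `^ a + \prod_(i <- s) `|L i x| `^ q i.
have iG : integrableT M G by exact: integrableTD.
have FG x : `|F x| * \prod_(i <- s) `|L i x| `^ (q i / b) <= G x.
  have -> : G x = `|F x| `^ a + (\prod_(i <- s) `|L i x| `^ (q i / b)) `^ b.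
    rewrite /G prod_powR; last by move=> i; exact: powR_ge0.
    by congr (_ + _); apply: eq_bigr => i _; rewrite -powRrM divfK // gt_eqF //; lra.
  apply: young_le => //; first by case/andP: a12.
  by apply: prodr_ge0 => i _; exact: powR_ge0.
have iFV : integrableT M (fun x => `|F x| * \prod_(i <- s) `|L i x| `^ (q i / b)).
  apply: (integrableT_le _ _ iG).
    apply: measurable_funM; first exact: measurableT_comp.
    apply: measurable_prod => i _; apply: (measurableT_comp (measurable_powR _)).
    by apply: measurableT_comp => //; exact: (measurable_L l_measurable i).
  move=> x; rewrite ger0_norm // mulr_ge0 // prodr_ge0 // => i _; exact: powR_ge0.
split=> //; apply: le_trans (integralT_le iFV iG FG) _.
rewrite integralTD // lerD2l /rest -sj; move: eP; rewrite powRr1 // ltW //.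
by have [] := beta_gt0 n0 L2 L3.
Qed.

Lemma young_prod_sum (I : eqType) (r : seq I) (q : I -> 'I_n -> R) (c : R)
    (V : n.-tuple T -> R) : 0 <= c ->
  (forall m i, 2 <= q m i <= 3) ->
  (forall m, m \in r -> \sum_(i <- s) (q m i - 2) = 1) ->
  measurable_fun setT V ->
  (forall x, `|V x| <= c * \sum_(m <- r) \prod_(i <- s) `|L i x| `^ (q m i / b)) ->
  integrableT M (fun x => F x * V x) /\
  `|\int[M]_x (F x * V x)| <= c * (size r)%:R * (Fa + rest).
Proof.
move=> c0 q23 qs mV VL; have [mF iF] := fF.
pose G x := c * \sum_(m <- r | m \in r) (`|F x| * \prod_(i <- s) `|L i x| `^ (q m i / b)).
have iGm m : m \in r ->
    integrableT M (fun x => `|F x| * \prod_(i <- s) `|L i x| `^ (q m i / b)).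
  by move=> mr; exact: (young_prod_L (q23 m) (qs m mr)).1.
have iS := integrableT_sum r iGm.
have iG : integrableT M G by exact: integrableTZ.
have FG x : `|F x * V x| <= G x.
  by rewrite /G normrM -mulr_sumr mulrCA ler_wpM2l // -big_seq.
have iFV : integrableT M (fun x => F x * V x).
  by apply: (integrableT_le _ FG iG); exact: measurable_funM.
split=> //; apply: le_trans (integralT_norm_le iFV iG FG) _.
rewrite integralTZ // -mulrA ler_wpM2l // integralT_sum //.
apply: (@le_trans _ _ (\sum_(m <- r | m \in r) (Fa + rest))).
  by apply: ler_sum => m mr; exact: (young_prod_L (q23 m) (qs m mr)).2.
by rewrite -big_seq big_const_seq count_predT iter_addr_0 mulr_natl.
Qed.

Lemma high_order (K : R) (h : nat -> R -> R) (W : n.-tuple T -> R) : 2 * j%:R + 1 <= j%:R * b ->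
  smooth K j h -> measurable_fun setT (h 0%N) -> measurable_fun setT W ->
  `|\int[M]_x (F x * diff [seq L i x | i <- s] (h 0%N) (W x))| <=
    2 ^+ j * K * (Fa + rest).
Proof.
move=> jb hK mh mW.
have K0 : 0 <= K by apply: le_trans (hK.2 0%N _ 0).
have jr : 1 <= j%:R :> R by rewrite ler1n.
have b2 := conjugate_gt2.
pose q := 2 + j%:R^-1 : R.
have q1 : 0 < (j%:R^-1 : R) <= 1 by rewrite invr_gt0 invf_le1 ?ltr0n ?j0.
have [] := @young_prod_sum unit [:: tt] (fun _ _ => q) (2 ^+ j * K)
  (fun x => diff [seq L i x | i <- s] (h 0%N) (W x)).
- by rewrite mulr_ge0 ?exprn_ge0.
- by move=> _ _; rewrite /q; lra.
- move=> _ _; rewrite big_const_seq count_predT sj iter_addr_0 /q addrAC subrr add0r.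
  by rewrite -[_ *+ _]mulr_natr mulVf // gt_eqF //; lra.
- exact: measurable_diff.
- move=> x; have := @diff_bound R [seq L i x | i <- s] j h K (q / b) (W x).
  rewrite size_map sj !big_map big_seq1; apply => //.
  rewrite divr_ge0 /=; [|by rewrite /q; lra|lra].
  rewrite ler_pdivrMr; last lra.
  rewrite mul1r /q -(ler_pM2l (_ : 0 < j%:R)); last lra.
  by rewrite mulrDr divff ?gt_eqF; lra.
- by rewrite mulr1.
Qed.

Section low_order.
Hypothesis jb : j%:R * b < 2 * j%:R + 1.

Lemma conjugate_le3 : b <= 3.
Proof.
have jr : 1 <= j%:R :> R by rewrite ler1n.
by rewrite leNgt; apply/negP => b3; move: jb; nra.
Qed.

Let e := (2 * j%:R + 1 - j%:R * b) / b.

Lemma low_order (K : R) (h : nat -> R -> R) (W : n.-tuple T -> R) :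
  smooth K j.+1 h -> (forall i, (i <= j)%N -> measurable_fun setT (h i)) ->
  measurable_fun setT W ->
  let V x := diff [seq L i x | i <- s] (h 0%N) (W x)
             - (\prod_(i <- s) L i x) * h j (W x) in
  integrableT M (fun x => F x * V x) /\
  `|\int[M]_x (F x * V x)| <= 2 * K * j%:R * (Fa + rest).
Proof.
move=> hK mh mW V.
have K0 : 0 <= K by apply: le_trans (hK.2 0%N _ 0).
have jr : 1 <= j%:R :> R by rewrite ler1n.
have b2 := conjugate_gt2; have b3 := conjugate_le3; have jb' := jb.
pose q (m i : 'I_n) : R := if i == m then 2 * j%:R + 1 - (j%:R - 1) * b else b.
have q1 : 2 <= 2 * j%:R + 1 - (j%:R - 1) * b <= 3 by apply/andP; split; nra.
have bp : 0 < b by lra.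
have e01 : 0 <= e <= 1.
  rewrite /e divr_ge0 /=; [|lra|lra].
  rewrite ler_pdivrMr // mul1r; nra.
rewrite -[X in 2 * K * X%:R]sj.
apply: (@young_prod_sum _ s q (2 * K) V).
- by rewrite mulr_ge0.
- by move=> m i; rewrite /q; case: eqP => // _; lra.
- move=> m ms; rewrite (bigD1_seq m) //= /q eqxx.
  rewrite (eq_bigr (fun=> b - 2)); last by move=> i /negbTE ->.
  rewrite big_const_seq iter_addr_0.
  have -> : count (fun i => i != m) s = j.-1.
    have := count_predC (pred1 m) s; rewrite count_uniq_mem // ms sj add1n => <-.
    by [].
  have jE : j%:R = j.-1%:R + 1 :> R by rewrite natr1 prednK.
  rewrite -[_ *+ _]mulr_natr jE; ring.
- apply: measurable_funB; first by apply: measurable_diff => //; exact: mh.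
  apply: measurable_funM; last by apply: measurableT_comp => //; exact: mh.
  by apply: measurable_prod => i _; exact: (measurable_L l_measurable i).
- move=> x; have := @diff_main R [seq L i x | i <- s] j.+1 h K e (W x) e01.
  rewrite size_map sj !big_map => /(_ (ltnSn _) hK) H; apply: le_trans H _.
  rewrite -mulrA ler_wpM2l ?mulr_ge0 // mulr_sumr.
  rewrite big_seq [leRHS]big_seq; apply: ler_sum => m ms.
  rewrite (bigD1_seq m) //= [leRHS](bigD1_seq m) //= /q eqxx mulrAC.
  rewrite le_eqVlt; apply/orP; left; apply/eqP; congr (_ * _).
    rewrite -{1}[`|l (tnth x m)|]powRr1 // -powRD.
      by congr (_ `^ _); rewrite /e; field; rewrite gt_eqF.
    by apply/implyP => /eqP; move: e01; lra.
  by apply: eq_bigr => i /negbTE ->; rewrite divff ?gt_eqF // powRr1.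
Qed.

Lemma mixed_moment :
  integrableT M (fun x => F x * \prod_(i <- s) L i x) /\
  `|\int[M]_x (F x * \prod_(i <- s) L i x)| * Num.min 1 beta <= Fa + rest.
Proof.
have [mF iF] := fF; have b2 := conjugate_gt2; have b3 := conjugate_le3; have jb' := jb.
have jr : 1 <= j%:R :> R by rewrite ler1n.
have [_ bt0] := beta_gt0 n0 L2 L3.
set dl := Num.min 1 beta.
have dl0 : 0 < dl by rewrite lt_min ltr01.
have b23 : 2 <= b <= 3 by lra.
have eth : \sum_(i <- s) (b - 2) = j%:R * (b - 2).
  by rewrite big_const_seq count_predT sj iter_addr_0 mulr_natl.
have [iP eP] := moment_prod_L MX n0 l_measurable L2 L3 us (fun=> b23) eth.
have mFL : measurable_fun setT (fun x => F x * \prod_(i <- s) L i x).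
  apply: measurable_funM => //.
  by apply: measurable_prod => i _; exact: (measurable_L l_measurable i).
have H x (c : R) : 0 <= c -> `|F x * \prod_(i <- s) L i x| * c <=
    `|F x| `^ a + c `^ b * \prod_(i <- s) `|L i x| `^ b.
  move=> c0; rewrite -prod_powR // -normr_prod -powRM //.
  rewrite normrM -mulrA [_ * c]mulrC; apply: young_le => //.
  - by case/andP: a12.
  - by rewrite mulr_ge0.
have iFL : integrableT M (fun x => F x * \prod_(i <- s) L i x).
  apply: (@integrableT_le _ _ _ _ _
    (fun x => `|F x| `^ a + 1 `^ b * \prod_(i <- s) `|L i x| `^ b)) => //.
    by move=> x; have := H x 1 ler01; rewrite mulr1.
  by apply: integrableTD => //; exact: integrableTZ.
split=> //.
apply: (@le_trans _ _ (\int[M]_x (dl * `|F x * \prod_(i <- s) L i x|))).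
  rewrite integralTZ; last exact: integrableT_norm.
  rewrite mulrC ler_wpM2l ?(ltW dl0) //.
  by apply: integralT_norm_le => //; exact: integrableT_norm.
apply: (@le_trans _ _ (\int[M]_x (`|F x| `^ a + dl `^ b * \prod_(i <- s) `|L i x| `^ b))).
  apply: integralT_le.
  - by apply: integrableTZ; exact: integrableT_norm.
  - by apply: integrableTD => //; exact: integrableTZ.
  - by move=> x; rewrite mulrC; apply: H; exact: ltW.
rewrite integralTD // ?integralTZ //; last exact: integrableTZ.
rewrite lerD2l /rest -sj.
apply: le_trans (ler_wpM2l (powR_ge0 _ _) eP) _.
rewrite mulrCA ler_wpM2l ?exprn_ge0 ?mulr_ge0 ?invr_ge0 ?ler0n //.
rewrite /dl; have [b1|/ltW b1] := leP beta 1.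
  rewrite -powRD ?(gt_eqF bt0) ?implybT // -[leRHS](powRr1 (ltW bt0)).
  apply: ger_powR; first by rewrite bt0.
  by nra.
rewrite powR1 mul1r -[leRHS](powRr1 (ltW bt0)); apply: ler_powR => //.
by lra.
Qed.

End low_order.

End exponents.

End one_subset.

(** * Gaussian smoothing *)

Section gaussian_density.
Context (R : realType).
Implicit Types (s x y : R) (m : nat).

Definition gauss s y : R := normal_pdf 0 s y.

Lemma gaussE s y : 0 < s ->
  gauss s y = normal_peak s * expR (- (y ^+ 2 / (s ^+ 2 *+ 2))).
Proof.
move=> s0; rewrite /gauss /normal_pdf gt_eqF // /normal_fun subr0.
by rewrite mulNr.
Qed.

Lemma gauss_ge0 s y : 0 <= gauss s y. Proof. exact: normal_pdf_ge0. Qed.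

Lemma continuous_gauss s : 0 < s -> continuous (gauss s).
Proof. by move=> s0; apply: continuous_normal_pdf; rewrite gt_eqF. Qed.

Lemma measurable_gauss s : measurable_fun setT (gauss s).
Proof. exact: measurable_normal_pdf. Qed.

Lemma integrable_gauss s : integrableT lebesgue_measure (gauss s).
Proof. exact: integrable_normal_pdf. Qed.

Lemma integral_gauss s : \int[lebesgue_measure]_y gauss s y = 1.
Proof. by rewrite /Rintegral integral_normal_pdf. Qed.

Lemma expR_ge1 x : 0 <= x -> 1 <= expR x.
Proof. by move=> x0; rewrite -expR0 ler_expR. Qed.

Lemma exprn_le_expR m x : 0 <= x -> x ^+ m <= m`!%:R * expR x.
Proof.
move=> x0; case: m => [|m]; first by rewrite expr0 fact0 mul1r expR_ge1.
rewrite mulrC -ler_pdivrMr ?ltr0n ?fact_gt0 //.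
by apply: le_trans (expR_ge1Dxn m x0); rewrite lerDr.
Qed.

Definition moment_cst m : R := 2 * (1 + 4 ^+ m * m`!%:R).

Lemma gauss_moment_le m s y : 0 < s ->
  `|y| ^+ m * gauss s y <= moment_cst m * s ^+ m * gauss (Num.sqrt 2 * s) y.
Proof.
move=> s0.
have q0 : 0 < Num.sqrt 2 :> R by rewrite sqrtr_gt0.
have q2 : Num.sqrt 2 ^+ 2 = 2 :> R by rewrite sqr_sqrtr.
rewrite !gaussE ?mulr_gt0 // exprMn q2.
have peakE : normal_peak s <= 2 * normal_peak (Num.sqrt 2 * s).
  have qle2 : Num.sqrt 2 <= 2 :> R.
    by rewrite -(@ler_pXn2r R 2) // ?nnegrE ?sqrtr_ge0 // q2; lra.
  have E (p : R) : 2 * s ^+ 2 * p *+ 2 = 2 * (s ^+ 2 * p *+ 2) by rewrite -mulrA mulrnAr.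
  rewrite /normal_peak exprMn q2 E [in leRHS]sqrtrM // invfM mulrA.
  rewrite ler_peMl ?invr_ge0 ?sqrtr_ge0 //.
  by rewrite ler_pdivlMr // mul1r.
set w := y ^+ 2 / (4 * s ^+ 2).
have s2 : 0 < s ^+ 2 by rewrite exprn_gt0.
have w0 : 0 <= w by rewrite divr_ge0 ?sqr_ge0 // mulr_ge0 // ltW.
have e1 : y ^+ 2 / (s ^+ 2 *+ 2) = w + w.
  by rewrite /w -mulr_natr; field; rewrite gt_eqF.
have e2 : y ^+ 2 / (2 * s ^+ 2 *+ 2) = w.
  by rewrite /w -mulr_natr; congr (_ / _); ring.
rewrite e1 e2 opprD expRD.
have poly : `|y| ^+ m * expR (- w) <= (1 + 4 ^+ m * m`!%:R) * s ^+ m.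
  rewrite expRN ler_pdivrMr ?expR_gt0 //.
  have -> : `|y| ^+ m = s ^+ m * (`|y| / s) ^+ m.
    by rewrite -exprMn mulrC divfK // gt_eqF.
  rewrite [_ * s ^+ m]mulrC -mulrA ler_pM2l ?exprn_gt0 //.
  set u := `|y| / s.
  have u0 : 0 <= u by rewrite divr_ge0 // ltW.
  have uw : u ^+ 2 = 4 * w.
    rewrite /u /w expr_div_n real_normK ?num_real //; field; rewrite gt_eqF //.
  have h1 : u ^+ m <= 1 + (u ^+ 2) ^+ m.
    have [u1|/ltW u1] := leP u 1.
      by apply: (@le_trans _ _ 1); rewrite ?exprn_ile1 // lerDl exprn_ge0 // sqr_ge0.
    rewrite -exprM mulnC; apply: (@le_trans _ _ (u ^+ (m * 2))).
      by rewrite ler_weXn2l // leq_pmulr.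
    by rewrite lerDr.
  apply: le_trans h1 _; rewrite uw exprMn mulrDl lerD //.
    by rewrite mul1r expR_ge1.
  by rewrite -mulrA ler_wpM2l ?exprn_ge0 // exprn_le_expR.
rewrite /moment_cst.
have -> : `|y| ^+ m * (normal_peak s * (expR (- w) * expR (- w))) =
  (`|y| ^+ m * expR (- w)) * normal_peak s * expR (- w) by ring.
have -> : 2 * (1 + 4 ^+ m * m`!%:R) * s ^+ m *
     (normal_peak (Num.sqrt 2 * s) * expR (- w)) =
  ((1 + 4 ^+ m * m`!%:R) * s ^+ m) * (2 * normal_peak (Num.sqrt 2 * s)) * expR (- w).
  by ring.
by rewrite ler_wpM2r ?expR_ge0 // ler_pM ?normal_peak_ge0 ?mulr_ge0 ?exprn_ge0 ?expR_ge0.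
Qed.

Lemma is_derive_gauss_fun (c s y : R) : 0 < s ->
  is_derive y 1 (fun y => c * expR (- (y ^+ 2 / (s ^+ 2 *+ 2))))
    (- (y / s ^+ 2) * (c * expR (- (y ^+ 2 / (s ^+ 2 *+ 2))))).
Proof.
move=> s0.
have s2 : s ^+ 2 != 0 by rewrite gt_eqF // exprn_gt0.
have d1 : is_derive y 1 (fun z : R => - (z ^+ 2 / (s ^+ 2 *+ 2))) (- (y / s ^+ 2)).
  have d0 : is_derive y 1 (fun z : R => z ^+ 2) (2 * y).
    by apply: is_derive_eq; rewrite /GRing.scale /=; ring.
  have h : is_derive y 1 (fun z : R => (- (s ^+ 2 *+ 2)^-1) * z ^+ 2)
     (- (s ^+ 2 *+ 2)^-1 * (2 * y)) := is_deriveZ (- (s ^+ 2 *+ 2)^-1) d0.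
  have -> : (fun z : R => - (z ^+ 2 / (s ^+ 2 *+ 2))) =
     (fun z : R => (- (s ^+ 2 *+ 2)^-1) * z ^+ 2).
    by apply/funext => z; rewrite mulNr mulrC.
  apply: (is_derive_eq h).
  rewrite -mulr_natr; field; by rewrite gt_eqF.
have d2 := @is_derive1_comp R expR (fun z : R => - (z ^+ 2 / (s ^+ 2 *+ 2))) y _ _
  (is_derive_expR _) d1.
have d3 : is_derive y 1 (fun y => c * expR (- (y ^+ 2 / (s ^+ 2 *+ 2))))
  (c * (expR (- (y ^+ 2 / (s ^+ 2 *+ 2))) * - (y / s ^+ 2))) := is_deriveZ c d2.
by apply: (is_derive_eq d3); rewrite mulrA mulrC.
Qed.

Lemma is_derive_gauss s y : 0 < s -> is_derive y 1 (gauss s) (- (y / s ^+ 2) * gauss s y).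
Proof.
move=> s0; rewrite gaussE //.
have -> : gauss s = fun y => normal_peak s * expR (- (y ^+ 2 / (s ^+ 2 *+ 2))).
  by apply/funext => z; rewrite gaussE.
exact: is_derive_gauss_fun.
Qed.

End gaussian_density.

Section whole_line.
Context (R : realType).
Local Notation mu := (@lebesgue_measure R).

Lemma integral_segment_derive (F f : R -> R) (a b : R) : a < b ->
  (forall x : R, is_derive x 1 F (f x)) -> continuous f ->
  (\int[mu]_(x in `[a, b]) (f x)%:E = (F b - F a)%:E)%E.
Proof.
move=> ab dF cf.
have cF : continuous F.
  move=> z; apply: differentiable_continuous; apply/derivable1_diffP.
  by have [] := dF z.
rewrite EFinB; apply: continuous_FTC2 => //.
- exact: continuous_subspaceT.
- split.
  + by move=> x _; have [] := dF x.
  + exact: cvg_at_right_filter (cF a).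
  + exact: cvg_at_left_filter (cF b).
- by move=> x _; rewrite derive1E derive_val.
Qed.

Lemma integral_derive0 (F f : R -> R) (C : R) :
  (forall x : R, is_derive x 1 F (f x)) -> continuous f -> integrableT mu f ->
  (forall x, `|x| * `|F x| <= C) -> \int[mu]_x f x = 0.
Proof.
move=> dF cf iF FC.
have C0 : 0 <= C by apply: le_trans (FC 0); rewrite mulr_ge0.
pose J (m : nat) : set R := `[- m.+1%:R, m.+1%:R]%classic.
pose fn (m : nat) : R -> \bar R := (EFin \o f) \_ (J m).
have Jab (m : nat) : - m.+1%:R < m.+1%:R :> R by rewrite gtrN // ltr0n.
have mf := integrableT_measurable iF.
have [] := @dominated_convergence _ _ _ mu setT measurableT fn (EFin \o f)
  (fun x => `|f x|%:E).
- move=> m; apply/(measurable_restrictT _ _).1 => //.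
  + exact: measurable_itv.
  + by apply: measurable_funTS; exact/measurable_EFinP.
- exact/measurable_EFinP.
- apply: aeW => x _.
  apply: (@cvg_trans _ ((fun=> (f x)%:E) @ \oo)); last exact: cvg_cst.
  apply: near_eq_cvg; near=> m; rewrite /fn /patch mem_set // /J /= in_itv /= -ler_norml.
  apply: ltW; apply: (@lt_trans _ _ m%:R); last by rewrite ltr_nat.
  near: m; exact: nbhs_infty_gtr.
- exact: integrableT_norm iF.
- apply: aeW => x m _; rewrite /fn /patch; case: ifP => // _.
  by rewrite abse0 lee_fin.
move=> _ _.
have intfn m : (\int[mu]_x fn m x)%E = (F m.+1%:R - F (- m.+1%:R))%:E.
  by rewrite -(integral_segment_derive (Jab m) dF cf) [RHS]integral_mkcond.
have cv0 : (\int[mu]_x fn m x)%E @[m --> \oo] --> 0%E.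
  under eq_fun do rewrite intfn.
  apply: cvg_EFin; first by apply: nearW => m.
  have b m : `|F m.+1%:R - F (- m.+1%:R)| <= 2 * C * harmonic m.
    rewrite /harmonic ler_pdivlMr ?ltr0n //.
    have := FC m.+1%:R; have := FC (- m.+1%:R); rewrite normrN ger0_norm ?ler0n //.
    have := ler_normB (F m.+1%:R) (F (- m.+1%:R)); rewrite -(ler_pM2l (_ : 0 < m.+1%:R)) ?ltr0n //.
    rewrite mulrDr [_ * m.+1%:R]mulrC; lra.
  have h0 : 2 * C * harmonic m @[m --> \oo] --> (0 : R).
    by rewrite -[X in _ --> X](mulr0 (2 * C)); apply: cvgM; [exact: cvg_cst|exact: cvg_harmonic].
  apply: norm_cvg0.
  apply: (squeeze_cvgr _ (cvg_cst 0) h0).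
  by apply: nearW => m /=; rewrite normr_ge0 b.
move=> cv; have := cvg_unique _ cv cv0 => /(_ (@ereal_hausdorff R)) E.
by rewrite /Rintegral E.
Unshelve. all: by end_near. Qed.

Lemma lebesgue_translation (x : R) (A : set R) : measurable A ->
  mu A = mu [set y | A (x + y)].
Proof.
move=> mA.
have mt : measurable_fun [set: measurableTypeR R] (fun y : R => x + y).
  by apply: measurable_funD.
apply: (@lebesgue_measure_unique R
  (pushforward mu (fun y : measurableTypeR R => x + y : measurableTypeR R)) _ A mA).
move=> _ [[a b] _ <-] /=.
rewrite /pushforward.
have -> : (fun y : R => x + y) @^-1` `]a, b]%classic = `]a - x, b - x]%classic.
  by apply/seteqP; split=> y /=; rewrite !in_itv /=; lra.
rewrite !lebesgue_measure_itv /= !lte_fin ltrD2r; case: ifP => // _.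
by rewrite -!EFinB; congr (_%:E); ring.
Qed.

End whole_line.

Lemma complete_square (R : realFieldType) (A B w y : R) : 0 < A -> 0 < B ->
  - (w - y) ^+ 2 / (2 * B) - y ^+ 2 / (2 * A) =
  - w ^+ 2 / (2 * (A + B)) - (y - A * w / (A + B)) ^+ 2 / (2 * (A * B / (A + B))).
Proof.
move=> A0 B0.
have [C CE] : exists C, C = A + B by exists (A + B).
have C0 : C != 0 by rewrite CE gt_eqF // addr_gt0.
have A1 : A != 0 by rewrite gt_eqF.
have B1 : B != 0 by rewrite gt_eqF.
rewrite -CE.
have [z zE] : exists z, z = y - A * w / C by exists (y - A * w / C).
rewrite -zE.
have -> : w - y = B * w / C - z.
  by rewrite zE (_ : B = C - A); [field|rewrite CE; ring].
have -> : y = z + A * w / C by rewrite zE; ring.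
have -> : A * B / C = (A^-1 + B^-1)^-1.
  have -> : A^-1 + B^-1 = C / (A * B) by rewrite CE; field; rewrite ?A1 ?B1.
  by rewrite invf_div.
have -> : - (B * w / C - z) ^+ 2 / (2 * B) =
    - (B / C * w ^+ 2 / (2 * C)) + w * z / C - z ^+ 2 / (2 * B).
  by field; rewrite ?B1 ?C0.
have -> : (z + A * w / C) ^+ 2 / (2 * A) =
    A / C * w ^+ 2 / (2 * C) + w * z / C + z ^+ 2 / (2 * A).
  by field; rewrite ?A1 ?C0.
have -> : - w ^+ 2 / (2 * C) = - ((A / C + B / C) * w ^+ 2 / (2 * C)).
  by rewrite -mulrDl -CE divff // mul1r mulNr.
rewrite !invfM invrK; field.
by rewrite ?A1 ?B1 ?C0.
Qed.

Section gaussian_integrals.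
Context (R : realType).
Local Notation mu := (@lebesgue_measure R).
Implicit Types (s x y w : R) (m : nat).

Lemma measurable_translation x : measurable_fun [set: measurableTypeR R] (fun y : R => x + y).
Proof. exact: measurable_funD. Qed.

Lemma ge0_integral_translation x (F : R -> \bar R) : measurable_fun setT F ->
  (forall y, (0 <= F y)%E) -> (\int[mu]_y F (x + y)%R = \int[mu]_y F y)%E.
Proof.
move=> mF F0.
rewrite [RHS](eq_measure_integral (pushforward mu
  (fun y : measurableTypeR R => x + y : measurableTypeR R))).
- exact: measurable_translation.
- by move=> mt; rewrite ge0_integral_pushforward // preimage_setT.
- by move=> mt A mA _; exact: lebesgue_translation.
Qed.

Lemma integrable_translation x (F : R -> R) :
  integrableT mu F -> integrableT mu (fun y => F (x + y)).
Proof.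
move=> iF; have mF := integrableT_measurable iF.
apply/integrableP; split.
  apply/measurable_EFinP; exact: (measurableT_comp mF (measurable_translation x)).
move/integrableP : iF => [_].
rewrite -(@ge0_integral_translation x (fun x => `|(F x)%:E|%E)) //.
by apply: measurableT_comp => //; exact/measurable_EFinP.
Qed.

Lemma integral_translation x (F : R -> R) : integrableT mu F ->
  \int[mu]_y F (x + y) = \int[mu]_y F y.
Proof.
move=> iF; have mF := integrableT_measurable iF; congr fine.
rewrite [RHS](eq_measure_integral (pushforward mu
  (fun y : measurableTypeR R => x + y : measurableTypeR R))).
- exact: measurable_translation.
- move=> mt; rewrite integral_pushforward // ?preimage_setT //.
    exact/measurable_EFinP.
  exact: (integrable_translation x iF).
- by move=> mt A mA _; exact: lebesgue_translation.
Qed.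

Lemma sqrt2_mul_gt0 s : 0 < s -> 0 < Num.sqrt 2 * s.
Proof. by move=> s0; rewrite mulr_gt0 // sqrtr_gt0. Qed.

Lemma integrable_gauss_moment m s : 0 < s ->
  integrableT mu (fun y => `|y| ^+ m * gauss s y).
Proof.
move=> s0.
apply: (@integrableT_le _ _ R mu (fun y => `|y| ^+ m * gauss s y)
  (fun y => moment_cst R m * s ^+ m * gauss (Num.sqrt 2 * s) y)).
- apply: measurable_funM; last exact: measurable_gauss.
  by apply: measurable_funX; exact: normr_measurable.
- move=> y; rewrite ger0_norm ?mulr_ge0 ?exprn_ge0 ?gauss_ge0 //.
  exact: gauss_moment_le.
- by apply: integrableTZ; exact: integrable_gauss.
Qed.

Lemma integrable_mul_gauss m s (A : R) (h : R -> R) : 0 < s -> measurable_fun setT h ->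
  (forall y, `|h y| <= A * (1 + `|y| ^+ m)) -> integrableT mu (fun y => h y * gauss s y).
Proof.
move=> s0 mh hA.
apply: (@integrableT_le _ _ R mu (fun y => h y * gauss s y)
  (fun y => A * (gauss s y + `|y| ^+ m * gauss s y))).
- by apply: measurable_funM => //; exact: measurable_gauss.
- move=> y; rewrite normrM (ger0_norm (gauss_ge0 _ _)).
  have -> : A * (gauss s y + `|y| ^+ m * gauss s y) = A * (1 + `|y| ^+ m) * gauss s y by ring.
  by rewrite ler_wpM2r ?gauss_ge0.
- apply: integrableTZ; apply: integrableTD; first exact: integrable_gauss.
  exact: integrable_gauss_moment.
Qed.

Lemma moment_cst_ge0 m : 0 <= moment_cst R m.
Proof. by rewrite /moment_cst mulr_ge0 // addr_ge0 // mulr_ge0 ?exprn_ge0. Qed.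

Lemma gauss_moment_bounded m s y : 0 < s ->
  `|y| ^+ m * gauss s y <= moment_cst R m * s ^+ m * normal_peak (Num.sqrt 2 * s).
Proof.
move=> s0; apply: le_trans (gauss_moment_le m y s0) _.
rewrite ler_wpM2l ?mulr_ge0 ?exprn_ge0 ?moment_cst_ge0 ?(ltW s0) //.
by apply: normal_pdf_ub; rewrite gt_eqF // sqrt2_mul_gt0.
Qed.

Lemma gauss_third_moment s : 0 < s ->
  \int[mu]_y (`|y| ^+ 3 * gauss s y) <= moment_cst R 3 * s ^+ 3.
Proof.
move=> s0.
apply: (@le_trans _ _ (\int[mu]_y (moment_cst R 3 * s ^+ 3 * gauss (Num.sqrt 2 * s) y))).
  apply: integralT_le; first exact: integrable_gauss_moment.
    by apply: integrableTZ; exact: integrable_gauss.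
  by move=> y; exact: gauss_moment_le.
by rewrite integralTZ ?integral_gauss ?mulr1 //; exact: integrable_gauss.
Qed.

Lemma gauss_mean s : 0 < s -> \int[mu]_y (y * gauss s y) = 0.
Proof.
move=> s0; have s2 : s ^+ 2 != 0 by rewrite gt_eqF // exprn_gt0.
apply: (@integral_derive0 R (fun y => - s ^+ 2 * gauss s y) (fun y => y * gauss s y)
   (s ^+ 2 * (moment_cst R 1 * s ^+ 1 * normal_peak (Num.sqrt 2 * s)))).
- move=> x; have h := is_deriveZ (- s ^+ 2) (is_derive_gauss x s0).
  by apply: (is_derive_eq h); rewrite /GRing.scale /=; field; rewrite gt_eqF.
- by move=> y; apply: cvgM; [exact: cvg_id|exact: continuous_gauss].
- apply: (@integrable_mul_gauss 1 s 1 id) => // y.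
  by rewrite mul1r expr1 lerDr.
- move=> y; rewrite normrM normrN (ger0_norm (sqr_ge0 s)) (ger0_norm (gauss_ge0 _ _)).
  rewrite mulrCA ler_wpM2l ?sqr_ge0 //.
  by have := gauss_moment_bounded 1 y s0; rewrite expr1.
Qed.

Lemma gauss_variance s : 0 < s -> \int[mu]_y (y ^+ 2 * gauss s y) = s ^+ 2.
Proof.
move=> s0; have s2 : s ^+ 2 != 0 by rewrite gt_eqF // exprn_gt0.
have i2 : integrableT mu (fun y => y ^+ 2 * gauss s y).
  apply: (@integrable_mul_gauss 2 s 1 (fun y => y ^+ 2)) => // y.
  by rewrite mul1r normrX lerDr.
have i0 := integrable_gauss s.
have : \int[mu]_y (y ^+ 2 * gauss s y - s ^+ 2 * gauss s y) = 0.
  apply: (@integral_derive0 R (fun y => - s ^+ 2 * (y * gauss s y))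
     (fun y => y ^+ 2 * gauss s y - s ^+ 2 * gauss s y)
   (s ^+ 2 * (moment_cst R 2 * s ^+ 2 * normal_peak (Num.sqrt 2 * s)))).
  - move=> x; have h := is_deriveZ (- s ^+ 2) (is_deriveM (is_derive_id x 1) (is_derive_gauss x s0)).
    by apply: (is_derive_eq h); rewrite /GRing.scale /=; field; rewrite gt_eqF.
  - move=> y; apply: cvgB; (apply: cvgM; last exact: continuous_gauss).
      exact: exprn_continuous.
    exact: cvg_cst.
  - by apply: integrableTB => //; exact: integrableTZ.
  - move=> y; rewrite !normrM normrN (ger0_norm (sqr_ge0 s)) (ger0_norm (gauss_ge0 _ _)).
    rewrite mulrCA ler_wpM2l ?sqr_ge0 // mulrA -expr2.
    exact: gauss_moment_bounded.
rewrite integralTB //; last exact: integrableTZ.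
by rewrite integralTZ // integral_gauss mulr1 => /eqP; rewrite subr_eq0 => /eqP.
Qed.

Lemma gauss_product (s1 s2 s3 w y : R) : 0 < s1 -> 0 < s2 -> 0 < s3 ->
  s3 ^+ 2 = s1 ^+ 2 + s2 ^+ 2 ->
  gauss s2 (w - y) * gauss s1 y =
  gauss s3 w * normal_pdf (s1 ^+ 2 * w / s3 ^+ 2) (s1 * s2 / s3) y.
Proof.
move=> s10 s20 s30 s3E.
have s40 : 0 < s1 * s2 / s3 by rewrite divr_gt0 // mulr_gt0.
have [A0 B0] : 0 < s1 ^+ 2 /\ 0 < s2 ^+ 2 by rewrite !exprn_gt0.
have C0 : s3 ^+ 2 != 0 by rewrite gt_eqF // exprn_gt0.
rewrite !gaussE // /normal_pdf gt_eqF // /normal_fun.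
rewrite mulrACA [RHS]mulrACA -!expRD expr_div_n exprMn; congr (_ * expR _); last first.
  have m2 (x : R) : x *+ 2 = 2 * x by rewrite mulr_natl.
  rewrite (m2 (s1 ^+ 2)) (m2 (s2 ^+ 2)) (m2 (s3 ^+ 2)) (m2 (_ / _)) -!mulNr s3E.
  by have := complete_square w y A0 B0; rewrite -!mulNr.
rewrite /normal_peak -!invfM -!sqrtrM ?mulrn_wge0 ?mulr_ge0 ?sqr_ge0 ?pi_ge0
  ?(ltW s10) ?(ltW s20) ?(ltW s30) //.
congr ((Num.sqrt _)^-1); rewrite expr_div_n exprMn; move: A0 B0 C0.
move: (pi : R) (s1 ^+ 2) (s2 ^+ 2) (s3 ^+ 2) => p A B C A0 B0 C0.
have m2 (x : R) : x *+ 2 = 2 * x by rewrite mulr_natl.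
by rewrite !(m2 (_ * p)); field.
Qed.

Lemma gauss_convolution (s1 s2 s3 w : R) : 0 < s1 -> 0 < s2 -> 0 < s3 ->
  s3 ^+ 2 = s1 ^+ 2 + s2 ^+ 2 ->
  (\int[mu]_y (gauss s2 (w - y) * gauss s1 y)%:E = (gauss s3 w)%:E)%E.
Proof.
move=> s10 s20 s30 s3E.
under eq_integral do rewrite (gauss_product _ _ s10 s20 s30 s3E) EFinM.
rewrite integralZl //=; last exact: integrable_normal_pdf.
by rewrite integral_normal_pdf mule1.
Qed.

End gaussian_integrals.

Section smoothing.
Context (R : realType).
Local Notation mu := (@lebesgue_measure R).
Implicit Types (s x y w A : R) (h : R -> R).

Definition lip A h := forall x y, `|h (x + y) - h x| <= A * `|y|.

Lemma lip_continuous A h : lip A h -> continuous h.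
Proof.
move=> hA x; apply/cvgrPdist_lt => e e0.
have A0 : 0 <= A by have := hA 0 1; rewrite normr1 mulr1; apply: le_trans.
have d0 : 0 < e / (A + 1) by rewrite divr_gt0 // ltr_wpDl.
near=> z.
have -> : h x - h z = h (z + (x - z)) - h z by rewrite subrKC.
apply: le_lt_trans (hA _ _) _.
have : `|x - z| < e / (A + 1).
  by near: z; exact: cvgr_dist_lt.
rewrite ltr_pdivlMr ?ltr_wpDl //.
have := normr_ge0 (x - z); nra.
Unshelve. all: by end_near. Qed.

Lemma lip_measurable A h : lip A h -> measurable_fun setT h.
Proof. by move=> /lip_continuous; exact: continuous_measurable_fun. Qed.

Lemma lip_growth A h : lip A h -> forall x y, `|h (x + y)| <= (`|h x| + A) * (1 + `|y| ^+ 1).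
Proof.
move=> hA x y.
have A0 : 0 <= A by have := hA 0 1; rewrite normr1 mulr1; apply: le_trans.
have := hA x y; have := ler_normB (h (x + y) - h x) (- h x).
rewrite opprK subrK normrN expr1; have := normr_ge0 y; have := normr_ge0 (h x); nra.
Qed.

Lemma integrable_smoothing s A h x : 0 < s -> lip A h ->
  integrableT mu (fun y => h (x + y) * gauss s y).
Proof.
move=> s0 hA; apply: (@integrable_mul_gauss R 1 s (`|h x| + A) (fun y => h (x + y))) => //.
  exact: (measurableT_comp (lip_measurable hA) (measurable_translation x)).
by move=> y; exact: lip_growth.
Qed.

Definition smoothing s h x := \int[mu]_y (h (x + y) * gauss s y).

Lemma gauss_average_le s (F G : R -> R) (c : R) : 0 < s ->
  integrableT mu (fun y => F y * gauss s y) ->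
  integrableT mu (fun y => G y * gauss s y) ->
  (forall y, `|F y| <= c * G y) ->
  `|\int[mu]_y (F y * gauss s y)| <= c * \int[mu]_y (G y * gauss s y).
Proof.
move=> s0 iF iG FG.
rewrite -integralTZ //; apply: integralT_norm_le => //; first exact: integrableTZ.
move=> y; rewrite normrM (ger0_norm (gauss_ge0 _ _)) mulrA.
by rewrite ler_wpM2r // gauss_ge0.
Qed.

Lemma gauss_average_bounded s (F : R -> R) (c : R) : 0 < s ->
  integrableT mu (fun y => F y * gauss s y) -> (forall y, `|F y| <= c) ->
  `|\int[mu]_y (F y * gauss s y)| <= c.
Proof.
move=> s0 iF Fc.
have -> : c = c * \int[mu]_y (1 * gauss s y).
  by under eq_Rintegral do rewrite mul1r; rewrite integral_gauss mulr1.
apply: gauss_average_le => //; last by move=> y; rewrite mulr1.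
by apply: eq_integrableT (integrable_gauss s) => y; rewrite mul1r.
Qed.

Lemma lip_smoothing s A h : 0 < s -> lip A h -> lip A (smoothing s h).
Proof.
move=> s0 hA x y; rewrite /smoothing -integralTB; try exact: integrable_smoothing.
rewrite (_ : \int[mu]_u _ = \int[mu]_u ((h (x + y + u) - h (x + u)) * gauss s u)); last first.
  by apply: integralT_eq => u; ring.
apply: gauss_average_bounded => //; last by move=> u; rewrite addrAC; exact: hA.
apply: eq_integrableT (integrableTB (integrable_smoothing (x + y) s0 hA)
  (integrable_smoothing x s0 hA)) => u.
by rewrite /=; ring.
Qed.

Lemma smoothing_bounded s A c h : 0 < s -> lip A h -> (forall x, `|h x| <= c) ->
  forall x, `|smoothing s h x| <= c.
Proof.
by move=> s0 hA hc x; apply: gauss_average_bounded => //; exact: integrable_smoothing hA.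
Qed.

Lemma smoothing_smoothing s1 s2 s3 A h : 0 < s1 -> 0 < s2 -> 0 < s3 ->
  s3 ^+ 2 = s1 ^+ 2 + s2 ^+ 2 -> lip A h ->
  smoothing s1 (smoothing s2 h) = smoothing s3 h.
Proof.
move=> s10 s20 s30 s3E hA; apply/funext => x.
pose D (p : measurableTypeR R * measurableTypeR R) : R :=
  h p.2 * (gauss s2 (p.2 - x - p.1) * gauss s1 p.1).
have mh := lip_measurable hA.
have mD : measurable_fun setT D.
  apply: measurable_funM; first exact: (measurableT_comp mh measurable_snd).
  apply: measurable_funM.
    apply: (measurableT_comp (measurable_gauss s2)).
    apply: measurable_funB => //; exact: measurable_funB.
  exact: (measurableT_comp (measurable_gauss s1) measurable_fst).
have innery (k : R -> R) w : measurable_fun setT k ->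
  (\int[mu]_y ((k w)%:E * (gauss s2 (w - x - y) * gauss s1 y)%:E) =
    (k w * gauss s3 (w - x))%:E)%E.
  move=> mk; rewrite integralZl //.
    by rewrite (gauss_convolution _ s10 s20 s30 s3E) EFinM.
  apply/integrableP; split.
    apply/measurable_EFinP; apply: measurable_funM; last exact: measurable_gauss.
    by apply: (measurableT_comp (measurable_gauss s2)); exact: measurable_funB.
  under eq_integral do rewrite /= ger0_norm ?mulr_ge0 ?gauss_ge0 //.
  by rewrite (gauss_convolution _ s10 s20 s30 s3E) ltry.
have shift (k : R -> R) : (fun w => k (x + (- x + w))) = k.
  by apply/funext => w; rewrite addrA subrr add0r.
have i3 : integrableT mu (fun w => h w * gauss s3 (w - x)).
  apply: eq_integrableT (integrable_translation (- x) (integrable_smoothing x s30 hA)) => w.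
  by rewrite addrA subrr add0r addrC.
have iD : (mu \x mu)%E.-integrable setT (EFin \o D).
  apply/integrable21ltyP; first exact/measurable_EFinP.
  have E w : (\int[mu]_y `|(EFin \o D) (y, w)| = (`|h w| * gauss s3 (w - x))%:E)%E.
    rewrite -(innery (fun w => `|h w|)); last exact: measurableT_comp.
    apply: eq_integral => y _; rewrite /D /= normrM.
    by rewrite [`|_ * gauss s1 _|]ger0_norm ?mulr_ge0 ?gauss_ge0.
  under eq_integral do rewrite E.
  have := integrableT_norm i3 => /integrableP[_]; apply: le_lt_trans.
  rewrite le_eqVlt; apply/orP; left; apply/eqP; apply: eq_integral => w _ /=.
  by rewrite normr_id normrM [`|gauss _ _|]ger0_norm ?gauss_ge0.
have := Fubini iD => F; rewrite /smoothing.
rewrite -(integral_translation (- x) (integrable_smoothing x s30 hA)).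
apply: (congr1 fine).
transitivity (\int[mu]_y \int[mu]_w (D (y, w))%:E)%E; last first.
  rewrite F; apply: eq_integral => w _.
  by rewrite addNKr [- x + w]addrC -innery.
apply: eq_integral => y _.
rewrite -(integral_translation (- (x + y)) (integrable_smoothing (x + y) s20 hA)).
rewrite mulrC EFinM.
have i2 : integrableT mu (fun w => h (x + y + (- (x + y) + w)) * gauss s2 (- (x + y) + w)).
  exact: (integrable_translation (- (x + y)) (integrable_smoothing (x + y) s20 hA)).
transitivity ((gauss s1 y)%:E * \int[mu]_w (h (x + y + (- (x + y) + w)) *
    gauss s2 (- (x + y) + w))%:E)%E; first by rewrite (integralT_EFin i2).
apply: (etrans (esym (integralZl measurableT i2 (gauss s1 y)))).
apply: eq_integral => w _; rewrite /D /= addNKr -EFinM; congr (_%:E).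
by rewrite (_ : - (x + y) + w = w - x - y); ring.
Qed.

(* [g1] and [g2] stand for the derivatives of [g0], but only this expansion is asked for, so
   that stability under smoothing needs no differentiation under the integral sign. [A]
   serves for integrability only. *)
Definition taylor_class (K : R) (g0 g1 g2 : R -> R) := exists A,
  [/\ lip A g0, lip A g1, lip A g2, (forall x, `|g1 x| <= A) & (forall x, `|g2 x| <= A)] /\
  (forall x y, `|g0 (x + y) - g0 x - g1 x * y - g2 x * (y ^+ 2 / 2)| <= K * `|y| ^+ 3).

Lemma taylor_class_smoothing s K g0 g1 g2 : 0 < s -> taylor_class K g0 g1 g2 ->
  taylor_class K (smoothing s g0) (smoothing s g1) (smoothing s g2).
Proof.
move=> s0 [A [[l0 l1 l2 b1 b2] tay]]; exists A; split.
  split; [exact: lip_smoothing|exact: lip_smoothing|exact: lip_smoothing| |].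
    exact: smoothing_bounded l1 b1.
  exact: smoothing_bounded l2 b2.
move=> x y; have i0 := integrable_smoothing x s0 l0.
have i0' := integrable_smoothing (x + y) s0 l0.
have i1 := integrableTZ y (integrable_smoothing x s0 l1).
have i2 := integrableTZ (y ^+ 2 / 2) (integrable_smoothing x s0 l2).
have i01 := integrableTB i0' i0.
have i012 := integrableTB i01 i1.
rewrite /smoothing [_ * y]mulrC [_ * (y ^+ 2 / 2)]mulrC.
rewrite -(integralTZ y (integrable_smoothing x s0 l1)).
rewrite -(integralTZ (y ^+ 2 / 2) (integrable_smoothing x s0 l2)).
rewrite -(integralTB i0' i0) -(integralTB i01 i1) -(integralTB i012 i2).
have E u : (g0 (x + y + u) * gauss s u - g0 (x + u) * gauss s u - y * (g1 (x + u) * gauss s u)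
    - y ^+ 2 / 2 * (g2 (x + u) * gauss s u)) =
  (g0 (x + u + y) - g0 (x + u) - g1 (x + u) * y - g2 (x + u) * (y ^+ 2 / 2)) * gauss s u.
  by rewrite [x + y + u]addrAC; ring.
under eq_Rintegral do rewrite E.
apply: gauss_average_bounded => //.
apply: eq_integrableT (integrableTB i012 i2) => u; exact: E.
Qed.

Lemma gauss_step s K g0 g1 g2 x : 0 < s -> taylor_class K g0 g1 g2 ->
  `|smoothing s g0 x - g0 x - s ^+ 2 / 2 * g2 x| <= K * (moment_cst R 3 * s ^+ 3).
Proof.
move=> s0 [A [[l0 l1 l2 b1 b2] tay]].
have i0 := integrable_smoothing x s0 l0.
have ic : integrableT mu (fun y => g0 x * gauss s y) := integrableTZ _ (integrable_gauss s).
have iy : integrableT mu (fun y => y * gauss s y).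
  apply: (@integrable_mul_gauss R 1 s 1 id) => // y.
  by rewrite mul1r expr1 lerDr.
have iy2 : integrableT mu (fun y => y ^+ 2 * gauss s y).
  apply: (@integrable_mul_gauss R 2 s 1 (fun y => y ^+ 2)) => // y.
  by rewrite mul1r normrX lerDr.
have i1 := integrableTZ (g1 x) iy.
have i2 := integrableTZ (g2 x / 2) iy2.
have i01 := integrableTB i0 ic; have i012 := integrableTB i01 i1.
have K0 : 0 <= K by have := le_trans (normr_ge0 _) (tay 0 1); rewrite normr1 expr1n mulr1.
have -> : smoothing s g0 x - g0 x - s ^+ 2 / 2 * g2 x =
   \int[mu]_y ((g0 (x + y) - g0 x - g1 x * y - g2 x * (y ^+ 2 / 2)) * gauss s y).
  have E y : (g0 (x + y) - g0 x - g1 x * y - g2 x * (y ^+ 2 / 2)) * gauss s y =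
    g0 (x + y) * gauss s y - g0 x * gauss s y - g1 x * (y * gauss s y)
      - g2 x / 2 * (y ^+ 2 * gauss s y) by ring.
  under eq_Rintegral do rewrite E.
  rewrite (integralTB i012 i2) (integralTB i01 i1) (integralTB i0 ic).
  rewrite !integralTZ ?integral_gauss ?gauss_mean ?gauss_variance //; last exact: integrable_gauss.
  by rewrite /smoothing; ring.
apply: (@le_trans _ _ (K * \int[mu]_y (`|y| ^+ 3 * gauss s y))); last first.
  by rewrite ler_wpM2l // gauss_third_moment.
apply: gauss_average_le => //; last exact: integrable_gauss_moment.
apply: eq_integrableT (integrableTB i012 i2) => y /=; ring.
Qed.

End smoothing.

(** * Normal approximation of the linear part *)

Section lindeberg.
Context d (T : measurableType d) (R : realType) (n : nat).
Variable M : probability (n.-tuple T) R.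
Hypothesis MX : product_law M.
Variables (l : T -> R) (beta : R).
Hypothesis n0 : (0 < n)%N.
Hypothesis l_measurable : measurable_fun setT l.
Local Notation L i x := (l (tnth x i)).
Local Notation N := (n%:R : R).
Hypothesis L1 : forall i, integrableT M (fun x => L i x) /\ \int[M]_x (L i x) = 0.
Hypothesis L2 : forall i, integrableT M (fun x => L i x ^+ 2) /\
  N * \int[M]_x (L i x ^+ 2) = 1.
Hypothesis L3 : forall i, integrableT M (fun x => `|L i x| ^+ 3) /\
  N * \int[M]_x (`|L i x| ^+ 3) = beta.
Local Notation sigma := (Num.sqrt N^-1).

Let N0 : 0 < N. Proof. by rewrite ltr0n. Qed.

Let sigma_gt0 : 0 < sigma. Proof. by rewrite sqrtr_gt0 invr_gt0. Qed.

Let sigma2 : sigma ^+ 2 = N^-1. Proof. by rewrite sqr_sqrtr // invr_ge0 ltW. Qed.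

Lemma integrable_lip A (g : R -> R) (W : n.-tuple T -> R) :
  lip A g -> integrableT M W -> integrableT M (fun x => g (W x)).
Proof.
move=> gA iW.
apply: (@integrableT_le _ _ R M (fun x => g (W x)) (fun x => (`|g 0| + A) * (1 + `|W x|))).
- exact: (measurableT_comp (lip_measurable gA) (integrableT_measurable iW)).
- by move=> x; have := lip_growth gA 0 (W x); rewrite add0r expr1.
- apply: integrableTZ; apply: integrableTD; first exact: integrableT_cst.
  exact: integrableT_norm.
Qed.

Lemma lindeberg_step K g0 g1 g2 i (W : n.-tuple T -> R) : taylor_class K g0 g1 g2 ->
  depends_on (~: [set i]) W -> integrableT M W ->
  `|\int[M]_x g0 (W x + L i x) - \int[M]_x g0 (W x) - N^-1 / 2 * \int[M]_x g2 (W x)|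
    <= K * (beta / N).
Proof.
move=> [A [[l0 l1 l2 b1 b2] tay]] Wi iW.
have [i1 e1] := L1 i; have [i2 e2] := L2 i; have [i3 e3] := L3 i.
have iWL : integrableT M (fun x => W x + L i x) by exact: integrableTD.
have j0 := integrable_lip l0 iWL; have j0' := integrable_lip l0 iW.
have j1 := integrable_lip l1 iW; have j2 := integrable_lip l2 iW.
have dL : depends_on [set i] (fun x : n.-tuple T => L i x) by exact: depends_on_coord.
have dL2 : depends_on [set i] (fun x : n.-tuple T => L i x ^+ 2).
  by move=> x y xy; rewrite (xy i) // inE.
have d1 : depends_on (~: [set i]) (fun x => g1 (W x)) by move=> x y xy; rewrite (Wi x y xy).
have d2 : depends_on (~: [set i]) (fun x => g2 (W x)) by move=> x y xy; rewrite (Wi x y xy).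
have m1 := integrable_indep MX dL d1 i1 j1.
have m2 := integrable_indep MX dL2 d2 i2 j2.
have E1 : \int[M]_x (L i x * g1 (W x)) = 0.
  by rewrite (integral_indep MX dL d1 i1 j1) e1 mul0r.
have E2 : \int[M]_x (L i x ^+ 2 * g2 (W x)) = N^-1 * \int[M]_x g2 (W x).
  rewrite (integral_indep MX dL2 d2 i2 j2); congr (_ * _).
  by apply: (mulfI (lt0r_neq0 N0)); rewrite e2 divff // gt_eqF.
have k01 := integrableTB j0 j0'.
have k012 := integrableTB k01 m1.
have m2' := integrableTZ 2^-1 m2.
have k := integrableTB k012 m2'.
have -> : \int[M]_x g0 (W x + L i x) - \int[M]_x g0 (W x) - N^-1 / 2 * \int[M]_x g2 (W x) =
  \int[M]_x (g0 (W x + L i x) - g0 (W x) - L i x * g1 (W x) - 2^-1 * (L i x ^+ 2 * g2 (W x))).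
  rewrite (integralTB k012 m2') (integralTB k01 m1) (integralTB j0 j0') E1.
  by rewrite integralTZ // E2; ring.
have -> : beta / N = \int[M]_x (`|L i x| ^+ 3) by rewrite -e3 mulrC mulKf // gt_eqF.
rewrite -integralTZ //; apply: integralT_norm_le => //; first exact: integrableTZ.
move=> x; have := tay (W x) (L i x); apply: le_trans.
by rewrite le_eqVlt; apply/orP; left; apply/eqP; congr (`|_|); ring.
Qed.

Lemma lindeberg_sum (s : seq 'I_n) K g0 g1 g2 : uniq s -> taylor_class K g0 g1 g2 ->
  `|\int[M]_x g0 (\sum_(i <- s) L i x) - iter (size s) (smoothing sigma) g0 0| <=
    (size s)%:R * (K * (beta / N + moment_cst R 3 * sigma ^+ 3)).
Proof.
elim: s g0 g1 g2 => [|i s IH] g0 g1 g2.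
  move=> _ _; under eq_Rintegral do rewrite big_nil.
  by rewrite integralT_cst subrr normr0 mul0r.
rewrite cons_uniq (_ : size (i :: s) = (size s).+1) // => /andP[nis us] cl.
have cl' := taylor_class_smoothing sigma_gt0 cl.
have {}IH := IH _ _ _ us cl'.
pose W x := \sum_(i <- s) L i x.
have iW : integrableT M W by apply: integrableT_sum => j _; exact: (L1 j).1.
have dW : depends_on (~: [set i]) W.
  move=> x y xy; rewrite /W !big_seq; apply: eq_bigr => j js; rewrite xy // !inE.
  by apply: contra nis => /eqP <-.
have st := lindeberg_step cl dW iW.
have [A [[l0 l1 l2 b1 b2] tay]] := cl.
have j0 := integrable_lip l0 iW; have j2 := integrable_lip l2 iW.
have js := integrable_lip (lip_smoothing sigma_gt0 l0) iW.
have gs : `|\int[M]_x smoothing sigma g0 (W x) - \int[M]_x g0 (W x) -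
    N^-1 / 2 * \int[M]_x g2 (W x)| <= K * (moment_cst R 3 * sigma ^+ 3).
  have k := integrableTB js j0; have m := integrableTZ (N^-1 / 2) j2.
  rewrite -(integralTZ _ j2) -(integralTB js j0) -(integralTB k m).
  rewrite -[leRHS](integralT_cst M); apply: integralT_norm_le.
  - exact: integrableTB.
  - exact: integrableT_cst.
  - by move=> x; have := gauss_step (W x) sigma_gt0 cl; rewrite sigma2.
rewrite -iterSr in IH.
have -> : \int[M]_x g0 (\sum_(j <- i :: s) L j x) = \int[M]_x g0 (W x + L i x).
  by apply: eq_Rintegral => x _; rewrite big_cons addrC.
rewrite -natr1.
have {}IH : `|\int[M]_x smoothing sigma g0 (W x) - iter (size s).+1 (smoothing sigma) g0 0|
    <= (size s)%:R * (K * (beta / N + moment_cst R 3 * sigma ^+ 3)) := IH.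
move: st gs IH; set a := \int[M]_x g0 (W x + L i x); set b := \int[M]_x g0 (W x).
set c := _ * \int[M]_x g2 (W x); set e := \int[M]_x smoothing sigma g0 (W x).
set f := iter _ _ _ _; rewrite !ler_norml => /andP[? ?] /andP[? ?] /andP[? ?].
by apply/andP; split; lra.
Qed.

Lemma iter_smoothing (m : nat) A (h : R -> R) s : (0 < m)%N -> 0 < s -> lip A h ->
  iter m (smoothing s) h = smoothing (s * Num.sqrt m%:R) h.
Proof.
case: m => [|m] m0 s0 hA; first by rewrite ltnn in m0.
elim: m {m0} => [|m IH]; first by rewrite [Num.sqrt _]sqrtr1 mulr1.
have q (k : nat) : 0 < s * Num.sqrt k.+1%:R by rewrite mulr_gt0 // sqrtr_gt0 ltr0n.
rewrite iterS IH; apply: (smoothing_smoothing s0 (q _) (q _) _ hA).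
have e (k : nat) : (s * Num.sqrt k%:R) ^+ 2 = s ^+ 2 * k%:R.
  by rewrite exprMn sqr_sqrtr // ler0n.
by rewrite !e -[m.+2%:R]natr1 mulrDr mulr1 addrC.
Qed.

Definition lindeberg_cst : R := 1 + 3 * moment_cst R 3.

Lemma normal_approximation K g0 g1 g2 : taylor_class K g0 g1 g2 ->
  `|\int[M]_x g0 (\sum_i L i x) - \int[lebesgue_measure]_y (g0 y * gauss 1 y)| <=
    lindeberg_cst * K * beta.
Proof.
move=> cl; have [A [[l0 l1 l2 b1 b2] tay]] := cl.
have K0 : 0 <= K by have := le_trans (normr_ge0 _) (tay 0 1); rewrite normr1 expr1n mulr1.
have := lindeberg_sum (enum_uniq 'I_n) cl.
rewrite -cardE card_ord (iter_smoothing n0 sigma_gt0 l0).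
have -> : sigma * Num.sqrt N = 1.
  by rewrite -sqrtrM ?invr_ge0 ?(ltW N0) // mulVf ?sqrtr1 // gt_eqF.
have -> : smoothing 1 g0 0 = \int[lebesgue_measure]_y (g0 y * gauss 1 y).
  by apply: integralT_eq => y; rewrite add0r.
under eq_Rintegral do rewrite big_enum /=.
move=> H; apply: le_trans H _.
have [hs b0] := beta_gt0 n0 L2 L3.
have -> : N * (K * (beta / N + moment_cst R 3 * sigma ^+ 3)) =
   K * (beta + moment_cst R 3 * (N * sigma ^+ 2) * sigma) by field; rewrite gt_eqF.
rewrite sigma2 divff ?gt_eqF // mulr1 /lindeberg_cst [leRHS]mulrAC mulrC ler_wpM2r //.
have := moment_cst_ge0 R 3; nra.
Qed.

Lemma first_moment_L i : \int[M]_x `|L i x| <= sigma.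
Proof.
have [i1 _] := L1 i; have [i2 e2] := L2 i.
apply: (@le_trans _ _ (\int[M]_x (sigma / 2 + (2 * sigma)^-1 * L i x ^+ 2))).
  apply: integralT_le; first exact: integrableT_norm.
    by apply: integrableTD; [exact: integrableT_cst|exact: integrableTZ].
  move=> x; have -> : L i x ^+ 2 = `|L i x| ^+ 2 by rewrite real_normK // num_real.
  set y := `|L i x|; rewrite -subr_ge0.
  have -> : sigma / 2 + (2 * sigma)^-1 * y ^+ 2 - y = (y - sigma) ^+ 2 / (2 * sigma).
    by field; rewrite gt_eqF.
  by rewrite divr_ge0 ?sqr_ge0 // mulr_ge0 // ltW.
rewrite integralTD ?integralT_cst ?integralTZ //; last 2 first.
- exact: integrableT_cst.
- exact: integrableTZ.
have -> : \int[M]_x (L i x ^+ 2) = sigma ^+ 2.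
  by apply: (mulfI (lt0r_neq0 N0)); rewrite e2 sigma2 divff // gt_eqF.
by rewrite le_eqVlt; apply/orP; left; apply/eqP; field; rewrite gt_eqF.
Qed.

Lemma normal_approximation_subset K g0 g1 g2 (A : {set 'I_n}) :
  taylor_class K g0 g1 g2 -> lip K g0 -> (forall y, `|g0 y| <= K) ->
  `|\int[M]_x g0 (\sum_(i in ~: A) L i x) - \int[lebesgue_measure]_y (g0 y * gauss 1 y)| <=
    (lindeberg_cst + 3 * #|A|%:R + 2) * K * Num.min 1 beta.
Proof.
move=> cl lK bK.
have K0 : 0 <= K by apply: le_trans (bK 0).
have c3 := moment_cst_ge0 R 3.
have lc : 0 <= lindeberg_cst by rewrite /lindeberg_cst; lra.
have iL (B : {set 'I_n}) : integrableT M (fun x => \sum_(i in B) L i x).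
  by apply: integrableT_sum => j _; exact: (L1 j).1.
have iLT : integrableT M (fun x => \sum_i L i x).
  by apply: integrableT_sum => j _; exact: (L1 j).1.
have jW := integrable_lip lK (iL (~: A)); have jT := integrable_lip lK iLT.
have [hs b0] := beta_gt0 n0 L2 L3.
have A0 : 0 <= #|A|%:R :> R by rewrite ler0n.
have [b1|/ltW b1] := leP beta 1.
  have na := normal_approximation cl.
  have dist : `|\int[M]_x g0 (\sum_(i in ~: A) L i x) - \int[M]_x g0 (\sum_i L i x)| <=
      K * (#|A|%:R * sigma).
    rewrite -(integralTB jW jT).
    apply: (@le_trans _ _ (\int[M]_x (K * `|\sum_(i in A) L i x|))).
      apply: integralT_norm_le; first exact: integrableTB.
        by apply: integrableTZ; exact: integrableT_norm.
      move=> x; rewrite distrC.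
      have -> : \sum_i L i x = \sum_(i in ~: A) L i x + \sum_(i in A) L i x.
        rewrite (bigID [in A]) /= addrC; congr (_ + _).
        by apply: eq_bigl => i; rewrite inE.
      exact: lK.
    rewrite integralTZ; last exact: integrableT_norm.
    rewrite ler_wpM2l //.
    apply: (@le_trans _ _ (\int[M]_x (\sum_(i in A) `|L i x|))).
      apply: integralT_le; first exact: integrableT_norm.
        by apply: integrableT_sum => j _; apply: integrableT_norm; exact: (L1 j).1.
      by move=> x; exact: ler_norm_sum.
    rewrite integralT_sum; last by move=> j _; apply: integrableT_norm; exact: (L1 j).1.
    apply: (@le_trans _ _ (\sum_(i in A) sigma)).
      by apply: ler_sum => i _; exact: first_moment_L.
    by rewrite sumr_const mulr_natl.
  set u := \int[M]_x g0 (\sum_(i in ~: A) _) in dist *.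
  set v := \int[M]_x g0 (\sum_i _) in dist na.
  set w := \int[lebesgue_measure]_y _ in na *.
  have := ler_normD (u - v) (v - w); rewrite addrA subrK.
  have : K * (#|A|%:R * sigma) <= K * (#|A|%:R * (3 * beta)) by rewrite !ler_wpM2l.
  have : 0 <= K * beta by rewrite mulr_ge0 // ltW.
  lra.
have bu : `|\int[M]_x g0 (\sum_(i in ~: A) L i x)| <= K.
  rewrite -[leRHS](integralT_cst M); apply: integralT_norm_le => //.
  exact: integrableT_cst.
have bw : `|\int[lebesgue_measure]_y (g0 y * gauss 1 y)| <= K.
  apply: gauss_average_bounded => //.
  by apply: eq_integrableT (integrable_smoothing 0 ltr01 lK) => y; rewrite add0r.
apply: le_trans (ler_normB _ _) _; nra.
Qed.

End lindeberg.

Lemma order_bounds (j k : nat) : (j <= k)%N ->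
  [/\ (j.+1 <= k.+3)%N, (forall i, (i <= j)%N -> (i.+1 < k + 4)%N), (j.+1 <= k.+1)%N
    & (1 <= j.+1 <= k + 4)%N].
Proof. by move=> jk; split; lia. Qed.

Lemma bin_le_expn n j : ('C(n, j) <= n ^ j)%N.
Proof.
apply: (@leq_trans (n ^_ j)); first by rewrite -bin_ffact leq_pmulr // fact_gt0.
elim: j => [|j IH]; first by rewrite ffactn0.
by rewrite ffactnSr expnSr leq_mul // leq_subr.
Qed.

Lemma sum_by_card (R : nzRingType) n k (f : nat -> R) :
  \sum_(A : {set 'I_n} | (1 <= #|A| <= k)%N) f #|A| =
  \sum_(1 <= j < k.+1) 'C(n, j)%:R * f j.
Proof.
transitivity (\sum_(1 <= j < k.+1) \sum_(A : {set 'I_n} | j == #|A|) f #|A|).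
  rewrite (exchange_big_dep xpredT) //= big_mkcond /=; apply: eq_bigr => A _.
  by rewrite big_nat1_eq ltnS.
apply: eq_bigr => j _.
rewrite (eq_bigr (fun=> f j)); last by move=> A /eqP <-.
rewrite sumr_const mulr_natl; congr (_ *+ _).
rewrite -[n in RHS]card_ord -card_draws; apply: eq_card => A.
by rewrite !inE eq_sym.
Qed.

(** * The expansion *)

Section expansion.
Context d (T : measurableType d) (R : realType) (n k p : nat).
Variable M : probability (n.-tuple T) R.
Hypothesis MX : product_law M.
Variables (l : T -> R) (beta : R).
Hypothesis n0 : (0 < n)%N.
Hypothesis l_measurable : measurable_fun setT l.
Local Notation L i x := (l (tnth x i)).
Local Notation N := (n%:R : R).
Hypothesis L1 : forall i, integrableT M (fun x => L i x) /\ \int[M]_x (L i x) = 0.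
Hypothesis L2 : forall i, integrableT M (fun x => L i x ^+ 2) /\
  N * \int[M]_x (L i x ^+ 2) = 1.
Hypothesis L3 : forall i, integrableT M (fun x => `|L i x| ^+ 3) /\
  N * \int[M]_x (`|L i x| ^+ 3) = beta.
Variables (a b : R) (K : R) (g : nat -> R -> R).
Hypotheses (a12 : 1 < a < 2) (ab : a^-1 + b^-1 = 1).
Hypothesis p_cutoff : forall j, (1 <= j <= k)%N ->
  (j <= p)%N = (j%:R * b < 2 * j%:R + 1).
Hypothesis pk : (p <= k)%N.
Hypothesis g_derive : forall i, (i < k + 4)%N -> forall x : R, is_derive x 1 (g i) (g i.+1 x).
Hypothesis g_bound : forall i, (1 <= i <= k + 4)%N -> forall x, `|g i x| <= K.
Variables (F : {set 'I_n} -> n.-tuple T -> R) (tau mm : nat -> R).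
Hypothesis F_depends : forall A : {set 'I_n}, (1 <= #|A| <= k)%N -> depends_on A (F A).
Hypothesis F_moment : forall A : {set 'I_n}, (1 <= #|A| <= k)%N ->
  finite_moment M a (F A) /\ \int[M]_x (`|F A x| `^ a) = tau #|A|.
Hypothesis F_degenerate : forall (A : {set 'I_n}) i, (1 <= #|A| <= k)%N -> i \in A ->
  degenerate M i (F A).
Hypothesis F_mixed : forall A : {set 'I_n}, (1 <= #|A| <= p)%N ->
  \int[M]_x (F A x * \prod_(i in A) L i x) = mm #|A|.

Local Notation normal_mean h := (\int[lebesgue_measure]_y (h y * gauss 1 y)).
Let S (x : n.-tuple T) := \sum_i L i x.
Let TT (x : n.-tuple T) := \sum_(A : {set 'I_n} | (1 <= #|A| <= k)%N) F A x.
Let gamma := \sum_(1 <= j < k.+1) 'C(n, j)%:R * tau j.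
Let rest j := (2 * N^-1) ^+ j * beta.

Let K0 : 0 <= K.
Proof. by apply: le_trans (g_bound (i := 1) _ 0) => //; rewrite addn4. Qed.

Lemma continuous_g i : (i < k + 4)%N -> continuous (g i).
Proof.
move=> ik x; apply: differentiable_continuous; apply/derivable1_diffP.
by have [] := g_derive ik x.
Qed.

Lemma measurable_g i : (i < k + 4)%N -> measurable_fun setT (g i).
Proof. by move=> ik; apply: continuous_measurable_fun; exact: continuous_g. Qed.

Lemma lip_g i : (i < k + 4)%N -> lip K (g i).
Proof.
move=> ik x y; apply: (taylor1 _ _ (g_derive ik)) => z.
by apply: g_bound; rewrite ltnS.
Qed.

Lemma taylor_class_g i : (i <= k.+1)%N -> taylor_class K (g i) (g i.+1) (g i.+2).
Proof.
move=> ik.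
have [h0 h1 h2] : [/\ (i < k + 4)%N, (i.+1 < k + 4)%N & (i.+2 < k + 4)%N] by split; lia.
exists K; split; first split; try exact: lip_g.
- by move=> x; apply: g_bound; lia.
- by move=> x; apply: g_bound; lia.
- move=> x y; apply: (taylor3 _ _ (g_derive h0) (g_derive h1) (g_derive h2)) => z.
  by apply: g_bound; lia.
Qed.

Lemma smooth_g j : (j <= k.+3)%N -> smooth K j (fun i => g i.+1).
Proof.
move=> jk; split=> i ij z; first by apply: g_derive; lia.
by apply: g_bound; lia.
Qed.

Let iS : integrableT M S.
Proof. by apply: integrableT_sum => i _; exact: (L1 i).1. Qed.

Let S_split (A : {set 'I_n}) x :
  S x = \sum_(i in ~: A) L i x + \sum_(i <- enum A) L i x.
Proof.
rewrite /S (bigID [in A]) /= addrC big_enum /=; congr (_ + _).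
by apply: eq_bigl => i; rewrite inE.
Qed.

Let dW (A : {set 'I_n}) :
  depends_on (outside (enum A)) (fun x : n.-tuple T => \sum_(i in ~: A) L i x).
Proof.
move=> x y xy; apply: eq_bigr => i; rewrite inE => iA; rewrite xy //.
by rewrite inE mem_enum.
Qed.

Let mW (A : {set 'I_n}) : measurable_fun setT (fun x : n.-tuple T => \sum_(i in ~: A) L i x).
Proof.
apply: (@integrableT_measurable _ _ R M).
by apply: integrableT_sum => i _; exact: (L1 i).1.
Qed.

Let iFg (A : {set 'I_n}) : (1 <= #|A| <= k)%N -> integrableT M (fun x => F A x * g 1 (S x)).
Proof.
move=> Ak; have [fm _] := F_moment Ak.
have a1 : 1 <= a by case/andP: a12 => /ltW.
apply: (@integrableT_le _ _ R M (fun x => F A x * g 1 (S x)) (fun x => K * `|F A x|)).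
- apply: measurable_funM; first exact: fm.1.
  by apply: (measurableT_comp (measurable_g _) (integrableT_measurable iS)); lia.
- by move=> x; rewrite normrM mulrC ler_wpM2r // g_bound //; lia.
- by apply: integrableTZ; apply: integrableT_norm; exact: finite_moment_integrable a1 fm.
Qed.

Lemma integral_F_diff (A : {set 'I_n}) : (1 <= #|A| <= k)%N ->
  \int[M]_x (F A x * g 1 (S x)) =
  \int[M]_x (F A x * diff [seq L i x | i <- enum A] (g 1) (\sum_(i in ~: A) L i x)).
Proof.
move=> Ak; have [fm _] := F_moment Ak.
have a1 : 1 <= a by case/andP: a12 => /ltW.
under eq_Rintegral do rewrite (S_split A).
apply: (integral_degenerate_diff l_measurable (K := K)).
- exact: finite_moment_integrable a1 fm.
- by move=> i; rewrite mem_enum; exact: F_degenerate.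
- by apply: measurable_g; lia.
- by move=> v; apply: g_bound; lia.
- exact: enum_uniq.
- exact: mW.
- exact: dW.
Qed.

Definition subset_cst (j : nat) : R := 2 ^+ j + 5 * j%:R + lindeberg_cst R + 2.

Let lc0 : 0 <= lindeberg_cst R.
Proof. by rewrite /lindeberg_cst; have := moment_cst_ge0 R 3; lra. Qed.

Let tr_ge0 (A : {set 'I_n}) : (1 <= #|A| <= k)%N -> 0 <= tau #|A| + rest #|A|.
Proof.
move=> Ak; rewrite -(F_moment Ak).2 addr_ge0 //.
  by apply: Rintegral_ge0 => x _; exact: powR_ge0.
have [_ b0] := beta_gt0 n0 L2 L3.
by rewrite /rest mulr_ge0 ?(ltW b0) // exprn_ge0 // mulr_ge0 // invr_ge0 ler0n.
Qed.

Lemma subset_expansion (A : {set 'I_n}) : (1 <= #|A| <= k)%N ->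
  `|\int[M]_x (F A x * g 1 (S x)) -
    (if (#|A| <= p)%N then mm #|A| * normal_mean (g #|A|.+1) else 0)|
  <= subset_cst #|A| * K * (tau #|A| + rest #|A|).
Proof.
move=> Ak; have [A0 Ak'] := andP Ak; have [fm Fa] := F_moment Ak.
set j := #|A| in Ak A0 Ak' Fa *; have tr0 := tr_ge0 Ak; rewrite -/j in tr0.
have [ob1 ob2 ob3 ob4] := order_bounds Ak'.
have sj : size (enum A) = j by rewrite -cardE.
have [b1 b0] := beta_gt0 n0 L2 L3.
rewrite (integral_F_diff Ak).
pose W (x : n.-tuple T) := \sum_(i in ~: A) L i x.
have pj0 : 0 <= 2 ^+ j :> R by rewrite exprn_ge0.
have j0 : 0 <= j%:R :> R by rewrite ler0n.
have [jp|jp] := leqP j p; last first.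
  rewrite subr0; apply: (@le_trans _ _ (2 ^+ j * K * (tau j + rest j))).
    rewrite -Fa; apply: (high_order MX n0 l_measurable L2 L3 a12 ab fm (enum_uniq _) sj A0 _
      (h := fun i => g i.+1)).
    + by rewrite leNgt -p_cutoff // -ltnNge.
    + by apply: smooth_g; exact: ltnW.
    + by apply: measurable_g; exact: ob2.
    + exact: mW.
  rewrite ler_wpM2r // ler_wpM2r // /subset_cst; move: lc0; lra.
have jb : j%:R * b < 2 * j%:R + 1 by rewrite -p_cutoff.
have sm : smooth K j.+1 (fun i => g i.+1) by exact: smooth_g.
have mg i : (i <= j)%N -> measurable_fun setT (g i.+1) by move=> ij; apply: measurable_g; exact: ob2.
have [iV bV] := low_order MX n0 l_measurable L2 L3 a12 ab fm (enum_uniq _) sj A0 jb sm mg (mW A).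
have [iX bX] := mixed_moment MX n0 l_measurable L2 L3 a12 ab fm (enum_uniq _) sj A0 jb.
rewrite Fa -/(rest j) in bV bX.
have ePA x : \prod_(i <- enum A) L i x = \prod_(i in A) L i x by rewrite big_enum.
have mmE : \int[M]_x (F A x * \prod_(i <- enum A) L i x) = mm j.
  by under eq_Rintegral do rewrite ePA; apply: F_mixed; rewrite A0.
have dG : depends_on A (fun x => F A x * \prod_(i <- enum A) L i x).
  move=> x y xy; rewrite (F_depends Ak xy); congr (_ * _).
  by rewrite !ePA; apply: eq_bigr => i iA; rewrite xy.
have dH : depends_on (~: A) (fun x => g j.+1 (W x)).
  by move=> x y xy; rewrite /W (eq_bigr (fun i => L i y)) // => i iA; rewrite xy.
have lipj : lip K (g j.+1) by apply: lip_g; exact: ob2.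
have iW : integrableT M W by apply: integrableT_sum => i _; exact: (L1 i).1.
have iH := integrable_lip lipj iW.
have iGH := integrable_indep MX dG dH iX iH.
have eGH := integral_indep MX dG dH iX iH.
have main : \int[M]_x (F A x * diff [seq L i x | i <- enum A] (g 1) (W x)) =
   \int[M]_x (F A x * (diff [seq L i x | i <- enum A] (g 1) (W x)
             - (\prod_(i <- enum A) L i x) * g j.+1 (W x)))
   + mm j * \int[M]_x g j.+1 (W x).
  rewrite -mmE -eGH -(integralTD iV iGH); apply: integralT_eq => x; ring.
rewrite main.
have na := normal_approximation_subset MX n0 L1 L2 L3 A
  (taylor_class_g ob3) lipj (g_bound ob4).
rewrite -/j in na.
rewrite mmE in bX.
set u := \int[M]_x (F A x * (_ - _)) in bV *.
set v := \int[M]_x g j.+1 _ in na *; set w := normal_mean _ in na *.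
have -> : u + mm j * v - mm j * w = u + mm j * (v - w) by ring.
apply: le_trans (ler_normD _ _) _; rewrite normrM.
set dl := Num.min 1 beta in bX na.
have cK : 0 <= (lindeberg_cst R + 3 * j%:R + 2) * K.
  by rewrite mulr_ge0 //; move: lc0; lra.
have : `|mm j| * `|v - w| <= (lindeberg_cst R + 3 * j%:R + 2) * K * (tau j + rest j).
  apply: le_trans (ler_wpM2l (normr_ge0 _) na) _.
  by rewrite mulrCA ler_wpM2l.
have := mulr_ge0 (mulr_ge0 pj0 K0) tr0.
rewrite /subset_cst; move: bV; lra.
Qed.

Let fmT : finite_moment M a TT.
Proof.
have a02 : 0 < a <= 2 by have := a12; lra.
by apply: finite_moment_sum => // A Ak; exact: (F_moment Ak).1.
Qed.

Let gammaE : \sum_(A : {set 'I_n} | (1 <= #|A| <= k)%N) tau #|A| = gamma.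
Proof. exact: sum_by_card. Qed.

Lemma moment_TT_le : \int[M]_x (`|TT x| `^ a) <= 4 ^+ k * gamma.
Proof.
rewrite -gammaE; under eq_bigr => A Ak do rewrite -(F_moment Ak).2.
apply: (degenerate_norm_sum a12 (D := finset.set0)) => A Ak; split.
- exact: finset.sub0set.
- by rewrite cards0 add0n; case/andP: Ak.
- exact: F_depends.
- exact: (F_moment Ak).1.
- by move=> i; exact: F_degenerate.
Qed.

Lemma quadratic_remainder :
  `|\int[M]_x (g 0 (S x + TT x) - g 0 (S x) - TT x * g 1 (S x))| <= 2 * K * (4 ^+ k * gamma).
Proof.
have [a1 a2] := andP a12; have a0 : 0 < a by lra.
have [mT iT] := fmT.
have h0 : (0 < k + 4)%N by rewrite addn4.
have h1 : (1 < k + 4)%N by rewrite addn4.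
have h2 : (1 <= 2 <= k + 4)%N by rewrite addn4.
have h2' : (1 <= 1 <= k + 4)%N by rewrite addn4.
have iTT := finite_moment_integrable (ltW a1) fmT.
have j1 := integrable_lip (lip_g h0) (integrableTD iS iTT).
have j0 := integrable_lip (lip_g h0) iS.
have le x t : `|g 0 (x + t) - g 0 x - t * g 1 x| <= 2 * K * `|t| `^ a.
  rewrite -(mulr_powRB1 (normr_ge0 t) a0) mulrA -[2 * K * _]mulrA.
  rewrite [t * _]mulrC; apply: interpolation => //; first by lra.
    apply: le_trans (ler_normB _ _) _; rewrite mulrDl mul1r lerD ?lip_g //.
    by rewrite normrM ler_wpM2r // g_bound.
  by rewrite -mulrA -expr2; exact: (taylor2 _ _ (g_derive h0) (g_derive h1) (g_bound h2)).
have iTg : integrableT M (fun x => TT x * g 1 (S x)).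
  apply: (@integrableT_le _ _ R M _ (fun x => K * `|TT x|)).
  - apply: measurable_funM => //.
    by apply: (measurableT_comp (measurable_g h1)); exact: integrableT_measurable iS.
  - by move=> x; rewrite normrM mulrC ler_wpM2r // g_bound.
  - by apply: integrableTZ; exact: integrableT_norm.
apply: (@le_trans _ _ (\int[M]_x (2 * K * `|TT x| `^ a))).
  apply: integralT_norm_le.
  - by apply: integrableTB => //; exact: integrableTB.
  - exact: integrableTZ.
  - by move=> x; exact: le.
by rewrite integralTZ // ler_wpM2l ?mulr_ge0 // moment_TT_le.
Qed.

Let main_term := \sum_(1 <= j < p.+1) 'C(n, j)%:R * mm j * normal_mean (g j.+1).

Lemma subset_cst_mono i j : (i <= j)%N -> subset_cst i <= subset_cst j.
Proof.
move=> ij; rewrite /subset_cst !lerD // ?ler_wpM2l ?ler_nat // ler_weXn2l //; lra.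
Qed.

Lemma linear_term :
  `|\int[M]_x (TT x * g 1 (S x)) - main_term| <=
    subset_cst k * K * (gamma + k%:R * 2 ^+ k * beta).
Proof.
have [_ b0] := beta_gt0 n0 L2 L3.
have E : main_term = \sum_(A : {set 'I_n} | (1 <= #|A| <= k)%N)
    (if (#|A| <= p)%N then mm #|A| * normal_mean (g #|A|.+1) else 0).
  rewrite (@sum_by_card R n k (fun j => if (j <= p)%N then mm j * normal_mean (g j.+1) else 0)).
  rewrite /main_term (big_nat_widen _ _ k.+1) ?ltnS // big_mkcond /=.
  by apply: eq_bigr => j _; rewrite ltnS; case: ifP => _; rewrite ?mulr0 ?mulrA.
under eq_Rintegral do rewrite mulr_suml.
rewrite integralT_sum; last by move=> A Ak; exact: iFg.
rewrite E -sumrB; apply: le_trans (ler_norm_sum _ _ _) _.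
apply: (@le_trans _ _ (\sum_(A : {set 'I_n} | (1 <= #|A| <= k)%N)
    subset_cst k * K * (tau #|A| + rest #|A|))).
  apply: ler_sum => A Ak; apply: le_trans (subset_expansion Ak) _.
  rewrite ler_wpM2r ?tr_ge0 // ler_wpM2r // subset_cst_mono //.
  by case/andP: Ak.
have ck : 0 <= subset_cst k * K.
  rewrite mulr_ge0 // /subset_cst; have := exprn_ge0 k (ler0n R 2); have := ler0n R k.
  by have := lc0; lra.
rewrite -mulr_sumr ler_wpM2l // big_split /= gammaE lerD2l.
rewrite (@sum_by_card R n k rest).
apply: (@le_trans _ _ (\sum_(1 <= j < k.+1) 2 ^+ k * beta)); last first.
  by rewrite sumr_const_nat subSS subn0 -[leRHS]mulrA mulr_natl.
rewrite big_nat_cond [leRHS]big_nat_cond; apply: ler_sum => j /andP[/andP[j1 jk] _].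
rewrite /rest exprMn mulrA ler_wpM2r ?(ltW b0) //.
apply: (@le_trans _ _ (2 ^+ j)); last by rewrite ler_weXn2l //; lra.
rewrite mulrCA ler_piMr ?exprn_ge0 // exprVn ler_pdivrMr ?exprn_gt0 ?ltr0n // mul1r.
by rewrite -natrX ler_nat bin_le_expn.
Qed.

Definition expansion_cst : R :=
  2 * 4 ^+ k + lindeberg_cst R + subset_cst k * (1 + k%:R * 2 ^+ k).

Theorem smooth_expansion :
  `|\int[M]_x g 0 (S x + TT x) - (normal_mean (g 0) + main_term)| <=
    expansion_cst * K * (beta + gamma).
Proof.
have [a1 a2] := andP a12; have [_ b0] := beta_gt0 n0 L2 L3.
have h0 : (0 < k + 4)%N by rewrite addn4.
have h1 : (1 < k + 4)%N by rewrite addn4.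
have h2' : (1 <= 1 <= k + 4)%N by rewrite addn4.
have [mT iT] := fmT.
have iTT := finite_moment_integrable (ltW a1) fmT.
have j1 := integrable_lip (lip_g h0) (integrableTD iS iTT).
have j0 := integrable_lip (lip_g h0) iS.
have iTg : integrableT M (fun x => TT x * g 1 (S x)).
  apply: (@integrableT_le _ _ R M _ (fun x => K * `|TT x|)).
  - apply: measurable_funM => //.
    by apply: (measurableT_comp (measurable_g h1)); exact: integrableT_measurable iS.
  - by move=> x; rewrite normrM mulrC ler_wpM2r // g_bound.
  - by apply: integrableTZ; exact: integrableT_norm.
have q := quadratic_remainder; have lin := linear_term.
have na := normal_approximation MX n0 L1 L2 L3 (taylor_class_g (leq0n k.+1)).
have g0 : 0 <= gamma.
  rewrite -gammaE; apply: sumr_ge0 => A Ak; rewrite -(F_moment Ak).2.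
  by apply: Rintegral_ge0 => x _; exact: powR_ge0.
move: q; rewrite (integralTB (integrableTB j1 j0) iTg) (integralTB j1 j0).
set u := \int[M]_x g 0 (S x + TT x); set v := \int[M]_x g 0 (S x).
set w := \int[M]_x (TT x * g 1 (S x)) in lin *; rewrite -/v in na.
set y := normal_mean (g 0) in na *; set z := main_term in lin * => q.
have -> : u - (y + z) = (u - v - w) + (v - y) + (w - z) by ring.
apply: le_trans (ler_normD _ _) _.
apply: (@le_trans _ _ (2 * K * (4 ^+ k * gamma) + lindeberg_cst R * K * beta +
   subset_cst k * K * (gamma + k%:R * 2 ^+ k * beta))).
  by rewrite lerD // (le_trans (ler_normD _ _)) // lerD.
have p4 : 0 <= 4 ^+ k :> R by rewrite exprn_ge0.
have p2 : 0 <= k%:R * 2 ^+ k :> R by rewrite mulr_ge0 ?exprn_ge0.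
have cs : 0 <= subset_cst k.
  rewrite /subset_cst; have := exprn_ge0 k (ler0n R 2); have := ler0n R k.
  by have := lc0; lra.
have lc := lc0; rewrite /expansion_cst.
set e4 := 4 ^+ k in p4 *; set e2 := k%:R * 2 ^+ k in p2 *.
set cc := subset_cst k in cs *; set ll := lindeberg_cst R in lc *.
have kb := mulr_ge0 K0 (ltW b0); have kg := mulr_ge0 K0 g0.
have := mulr_ge0 p4 kb; have := mulr_ge0 lc kg; have := mulr_ge0 cs kb.
have := mulr_ge0 (mulr_ge0 cs p2) kg.
lra.
Qed.

End expansion.

Section mixed_moments.
Context d (T : measurableType d) (R : realType) (n k : nat).
Variable M : probability (n.-tuple T) R.
Hypothesis MX : product_law M.
Variables (l : T -> R) (beta : R).
Hypothesis n0 : (0 < n)%N.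
Hypothesis l_measurable : measurable_fun setT l.
Local Notation L i x := (l (tnth x i)).
Local Notation N := (n%:R : R).
Hypothesis L1 : forall i, integrableT M (fun x => L i x) /\ \int[M]_x (L i x) = 0.
Hypothesis L2 : forall i, integrableT M (fun x => L i x ^+ 2) /\
  N * \int[M]_x (L i x ^+ 2) = 1.
Hypothesis L3 : forall i, integrableT M (fun x => `|L i x| ^+ 3) /\
  N * \int[M]_x (`|L i x| ^+ 3) = beta.
Variables (a b : R).
Hypotheses (a12 : 1 < a < 2) (ab : a^-1 + b^-1 = 1) (b3 : b <= 3).
Implicit Types (A B : {set 'I_n}) (F : n.-tuple T -> R).

Lemma integrable_mixed (s : seq 'I_n) F : uniq s -> finite_moment M a F ->
  integrableT M (fun x => F x * \prod_(i <- s) L i x).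
Proof.
move=> us [mF iF]; have b2 := conjugate_gt2 a12 ab; have b3' := b3.
have b23 : 2 <= b <= 3 by lra.
have [iP _] := moment_prod_L MX n0 l_measurable L2 L3 us (fun=> b23) erefl.
apply: (@integrableT_le _ _ R M _
    (fun x => `|F x| `^ a + \prod_(i <- s) `|L i x| `^ b)).
- apply: measurable_funM => //.
  by apply: measurable_prod => i _; exact: (measurable_L l_measurable i).
- move=> x; rewrite -prod_powR // -normr_prod normrM.
  by apply: young_le => //; case/andP: a12.
- exact: integrableTD.
Qed.

Lemma mixed_moment_eq0 A B F : depends_on A F -> finite_moment M a F ->
  (forall i, i \in A -> degenerate M i F) -> A != B ->
  \int[M]_x (F x * \prod_(i in B) L i x) = 0.
Proof.
move=> FA fF Fdeg AB.
have iFL (C : {set 'I_n}) : integrableT M (fun x => F x * \prod_(i in C) L i x).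
  by apply: eq_integrableT (integrable_mixed (enum_uniq C) fF) => x; rewrite big_enum.
have [sAB|/fintype.subsetPn[i iA iB]] := boolP (A \subset B); last first.
  have := Fdeg i iA (fun x => \prod_(j in B) L j x).
  under eq_Rintegral do rewrite mulrC; apply.
    move=> x y xy; apply: eq_bigr => j jB; rewrite xy // !inE.
    by apply: contra iB => /eqP <-.
  by apply: eq_integrableT (iFL B) => x; rewrite mulrC.
have /fintype.subsetPn[i iB iA] : ~~ (B \subset A).
  by apply: contra AB => sBA; rewrite finset.eqEsubset sAB.
have E x : F x * \prod_(j in B) L j x = L i x * (F x * \prod_(j in B :\ i) L j x).
  rewrite (big_setD1 i iB) /=; ring.
under eq_Rintegral do rewrite E.
have [i1 e1] := L1 i.
have dL : depends_on [set i] (fun x : n.-tuple T => L i x) by exact: depends_on_coord.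
have dR : depends_on (~: [set i]) (fun x => F x * \prod_(j in B :\ i) L j x).
  move=> x y xy; congr (_ * _).
    apply: FA => j jA; apply: xy; rewrite !inE.
    by apply: contra iA => /eqP <-.
  by apply: eq_bigr => j; rewrite !inE => /andP[ji _]; rewrite xy // !inE.
by rewrite (integral_indep MX dL dR i1 (iFL _)) e1 mul0r.
Qed.

Lemma mixed_moment_sum (F : {set 'I_n} -> n.-tuple T -> R) B :
  (forall A, (1 <= #|A| <= k)%N -> [/\ depends_on A (F A), finite_moment M a (F A) &
     forall i, i \in A -> degenerate M i (F A)]) -> (1 <= #|B| <= k)%N ->
  \int[M]_x ((\prod_(i in B) L i x) * \sum_(A : {set 'I_n} | (1 <= #|A| <= k)%N) F A x) =
  \int[M]_x (F B x * \prod_(i in B) L i x).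
Proof.
move=> HF Bk; under eq_Rintegral do rewrite mulr_sumr.
have iFL A : (1 <= #|A| <= k)%N ->
    integrableT M (fun x => (\prod_(i in B) L i x) * F A x).
  move=> /HF[_ fF _].
  by apply: eq_integrableT (integrable_mixed (enum_uniq B) fF) => x; rewrite big_enum mulrC.
rewrite integralT_sum // (bigD1 B) //= [X in _ + X]big1 ?addr0.
  by under eq_Rintegral do rewrite mulrC.
move=> A /andP[Ak AB]; have [dA fA degA] := HF A Ak.
under eq_Rintegral do rewrite mulrC.
exact: (mixed_moment_eq0 dA fA degA AB).
Qed.

End mixed_moments.

(** * Derivatives of the normal distribution function *)

Section normal_distribution_derivatives.
Context (R : realType).
Local Notation mu := (@lebesgue_measure R).
Implicit Types (q : {poly R}) (h : R -> R) (x y : R) (m : nat).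

Lemma is_derive_Phi x : is_derive x 1 (@Phi R) (gauss 1 x).
Proof.
have PhiE : @Phi R = fun y => \int[mu]_(t in [set` Interval -oo%O (BRight y)]) (gauss 1 t).
  apply/funext => y; rewrite /Phi.
  have -> : [set u : R | u <= y] = [set` Interval -oo%O (BRight y)].
    by apply/seteqP; split=> u /=; rewrite in_itv.
  by [].
have [] := @continuous_FTC1 R (gauss 1) -oo%O x (x + 1).
- by rewrite ltrDl.
- apply: (integrableS measurableT) => //.
  exact: integrable_gauss.
- by rewrite ltNyr.
- exact: continuous_gauss.
rewrite -PhiE => dP eP; apply: DeriveDef; first exact: dP.
by rewrite -derive1E eP.
Qed.

Fixpoint hermite (j : nat) : {poly R} :=
  if j is j'.+1 then (hermite j')^`() - 'X * hermite j' else 1.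

Lemma is_derive_poly_gauss q x :
  is_derive x 1 (fun y => q.[y] * gauss 1 y) ((q^`() - 'X * q).[x] * gauss 1 x).
Proof.
have h := is_deriveM (is_derive_poly q x) (is_derive_gauss x (@ltr01 R)).
apply: (is_derive_eq h); rewrite !hornerE /GRing.scale /= expr1n divr1; ring.
Qed.

Lemma dern_gauss j : dern j (@gauss R 1) = fun y => (hermite j).[y] * gauss 1 y.
Proof.
elim: j => [|j IH]; first by apply/funext => y /=; rewrite hornerE mul1r.
rewrite /dern iterS -/(dern j _) IH; apply/funext => y.
by rewrite derive1E; have h := is_derive_poly_gauss (hermite j) y; rewrite derive_val.
Qed.

Lemma dern_Phi j : dern j.+1 (@Phi R) = fun y => (hermite j).[y] * gauss 1 y.
Proof.
rewrite -dern_gauss /dern iterSr; congr (iter _ _ _); apply/funext => y.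
by rewrite derive1E; have h := is_derive_Phi y; rewrite derive_val.
Qed.

Lemma derive1_Np (kappa : nat -> R) (p : nat) x :
  derive1 (Np kappa p) x = gauss 1 x +
    \sum_(1 <= j < p.+1) (-1) ^+ j.+1 * kappa j * ((hermite j.+1).[x] * gauss 1 x).
Proof.
have -> : Np kappa p = fun y => Phi y +
    \sum_(1 <= j < p.+1) (-1) ^+ j.+1 * kappa j * ((hermite j).[y] * gauss 1 y).
  by apply/funext => y; congr (_ + _); apply: eq_bigr => j _; rewrite dern_Phi.
have hs : is_derive x 1 (fun y =>
    \sum_(1 <= j < p.+1) (-1) ^+ j.+1 * kappa j * ((hermite j).[y] * gauss 1 y))
    (\sum_(1 <= j < p.+1) (-1) ^+ j.+1 * kappa j * ((hermite j.+1).[x] * gauss 1 x)).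
  elim: (index_iota 1 p.+1) => [|j s IH].
    rewrite big_nil; under eq_fun do rewrite big_nil; exact: is_derive_cst.
  rewrite big_cons; under eq_fun do rewrite big_cons.
  exact: (is_deriveD (is_deriveZ ((-1) ^+ j.+1 * kappa j)
    (is_derive_poly_gauss (hermite j) x)) IH).
have h := is_deriveD (is_derive_Phi x) hs.
by rewrite derive1E (@derive_val _ _ _ _ _ _ _ h).
Qed.

Definition poly_growth m h := exists A, forall y, `|h y| <= A * (1 + `|y| ^+ m).

Lemma poly_growthM m m' h h' : poly_growth m h -> poly_growth m' h' ->
  poly_growth (m + m') (fun y => h y * h' y).
Proof.
move=> [A hA] [B hB]; exists (4 * (A * B)) => y.
have le1 i : (i <= m + m')%N -> `|y| ^+ i <= 1 + `|y| ^+ (m + m').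
  move=> im; have [y1|/ltW y1] := leP `|y| 1.
    by apply: (@le_trans _ _ 1); rewrite ?exprn_ile1 // lerDl exprn_ge0.
  by apply: (@le_trans _ _ (`|y| ^+ (m + m'))); rewrite ?ler_weXn2l // lerDr.
have A0 : 0 <= A * (1 + `|y| ^+ m) by apply: le_trans (hA y).
have B0 : 0 <= B * (1 + `|y| ^+ m') by apply: le_trans (hB y).
have pA : 0 < 1 + `|y| ^+ m by rewrite ltr_wpDr ?exprn_ge0.
have pB : 0 < 1 + `|y| ^+ m' by rewrite ltr_wpDr ?exprn_ge0.
rewrite pmulr_lge0 // in A0; rewrite pmulr_lge0 // in B0.
rewrite normrM; apply: le_trans (ler_pM _ _ (hA y) (hB y)) _ => //.
have -> : A * (1 + `|y| ^+ m) * (B * (1 + `|y| ^+ m')) =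
   A * B * (1 + `|y| ^+ m + `|y| ^+ m' + `|y| ^+ (m + m')) by rewrite exprD; ring.
rewrite [4 * _]mulrC -[leRHS]mulrA ler_wpM2l ?mulr_ge0 //.
have := le1 m (leq_addr _ _); have := le1 m' (leq_addl _ _).
have : 0 <= `|y| ^+ (m + m') by rewrite exprn_ge0.
lra.
Qed.

Lemma poly_growth_horner q : poly_growth (size q) (fun y => q.[y]).
Proof.
exists (\sum_(i < size q) `|q`_i|) => y; rewrite horner_coef.
apply: le_trans (ler_norm_sum _ _ _) _; rewrite mulr_suml; apply: ler_sum => i _.
rewrite normrM normrX ler_wpM2l //.
have [y1|/ltW y1] := leP `|y| 1.
  by apply: (@le_trans _ _ 1); rewrite ?exprn_ile1 // lerDl exprn_ge0.
by apply: (@le_trans _ _ (`|y| ^+ size q)); rewrite ?ler_weXn2l ?(ltnW (ltn_ord i)) // lerDr.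
Qed.

Lemma lip_poly_growth A h : lip A h -> poly_growth 1 h.
Proof. by move=> hA; exists (`|h 0| + A) => y; have := lip_growth hA 0 y; rewrite add0r. Qed.

Lemma poly_growth_gauss_bounded m h : poly_growth m h ->
  exists C, forall y, `|h y * gauss 1 y| <= C.
Proof.
move=> [A hA]; pose B i := moment_cst R i * 1 ^+ i * normal_peak (Num.sqrt 2 * 1).
exists (`|A| * (B 0%N + B m)) => y.
have g0 := gauss_ge0 1 y.
rewrite normrM (ger0_norm g0).
apply: (@le_trans _ _ (`|A| * (1 + `|y| ^+ m) * gauss 1 y)).
  rewrite ler_wpM2r //; apply: le_trans (hA y) _.
  by rewrite ler_wpM2r ?ler_norm // addr_ge0 ?exprn_ge0.
rewrite -mulrA ler_wpM2l // mulrDl lerD //.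
  by have := gauss_moment_bounded 0 y (@ltr01 R); rewrite expr0.
exact: gauss_moment_bounded.
Qed.

Lemma integrable_poly_growth_gauss m h : measurable_fun setT h -> poly_growth m h ->
  integrableT mu (fun y => h y * gauss 1 y).
Proof. by move=> mh [A hA]; exact: (integrable_mul_gauss (@ltr01 R) mh hA). Qed.

Lemma measurable_horner q : measurable_fun setT (fun y => q.[y]).
Proof. by apply: continuous_measurable_fun; exact: continuous_horner. Qed.

Lemma integrable_hermite_gauss A h q : lip A h ->
  integrableT mu (fun y => h y * (q.[y] * gauss 1 y)).
Proof.
move=> hA; have k := integrable_poly_growth_gauss
  (measurable_funM (lip_measurable hA) (measurable_horner q))
  (poly_growthM (lip_poly_growth hA) (poly_growth_horner q)).
by apply: eq_integrableT k => y; rewrite mulrA.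
Qed.

Lemma integral_hermite_step A A' h h' j : lip A h -> lip A' h' ->
  (forall x, is_derive x 1 h (h' x)) ->
  \int[mu]_y (h y * ((hermite j.+1).[y] * gauss 1 y)) =
  - \int[mu]_y (h' y * ((hermite j).[y] * gauss 1 y)).
Proof.
move=> hA hA' dh.
have k := integrable_hermite_gauss (hermite j.+1) hA.
have k' := integrable_hermite_gauss (hermite j) hA'.
apply/eqP; rewrite -subr_eq0 opprK; apply/eqP; rewrite -(integralTD k k').
have [C hC] := poly_growth_gauss_bounded (poly_growthM (poly_growth_horner 'X)
  (poly_growthM (lip_poly_growth hA) (poly_growth_horner (hermite j)))).
apply: (@integral_derive0 R (fun y => h y * ((hermite j).[y] * gauss 1 y)) _ C).
- move=> x; have d := is_deriveM (dh x) (is_derive_poly_gauss (hermite j) x).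
  by apply: (is_derive_eq d); rewrite /GRing.scale /=; ring.
- move=> y; apply: cvgD.
    apply: cvgM; first exact: lip_continuous hA y.
    by apply: cvgM; [exact: continuous_horner|exact: continuous_gauss].
  apply: cvgM; first exact: lip_continuous hA' y.
  by apply: cvgM; [exact: continuous_horner|exact: continuous_gauss].
- exact: integrableTD.
- move=> y; have := hC y; rewrite hornerX -normrM => H; apply: le_trans H.
  by rewrite le_eqVlt; apply/orP; left; apply/eqP; congr (`|_|); ring.
Qed.

Lemma integral_hermite (g : nat -> R -> R) A i j :
  (forall m, (m < i + j)%N -> forall x : R, is_derive x 1 (g m) (g m.+1 x)) ->
  (forall m, (m <= i + j)%N -> lip A (g m)) ->
  \int[mu]_y (g i y * ((hermite j).[y] * gauss 1 y)) =
  (-1) ^+ j * \int[mu]_y (g (i + j)%N y * gauss 1 y).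
Proof.
elim: j i => [|j IH] i dg lg.
  by rewrite addn0 expr0 mul1r; apply: integralT_eq => y /=; rewrite (hornerC 1) mul1r.
rewrite (integral_hermite_step j (lg i _) (lg i.+1 _) (dg i _)); try lia.
have dg' m : (m < i.+1 + j)%N -> forall x : R, is_derive x 1 (g m) (g m.+1 x).
  by move=> mij; apply: dg; lia.
have lg' m : (m <= i.+1 + j)%N -> lip A (g m) by move=> mij; apply: lg; lia.
by rewrite (IH i.+1 dg' lg') addSnnS exprS mulN1r mulNr.
Qed.

Lemma integral_Np (g : nat -> R -> R) A (kappa : nat -> R) (p : nat) :
  (forall m, (m < p.+1)%N -> forall x : R, is_derive x 1 (g m) (g m.+1 x)) ->
  (forall m, (m <= p.+1)%N -> lip A (g m)) ->
  integrableT mu (fun y => g 0%N y * derive1 (Np kappa p) y) /\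
  \int[mu]_y (g 0%N y * derive1 (Np kappa p) y) =
  \int[mu]_y (g 0%N y * gauss 1 y) +
    \sum_(1 <= j < p.+1) kappa j * \int[mu]_y (g j.+1 y * gauss 1 y).
Proof.
move=> dg lg.
have E y : g 0%N y * derive1 (Np kappa p) y = g 0%N y * gauss 1 y +
   \sum_(1 <= j < p.+1) (-1) ^+ j.+1 * kappa j * (g 0%N y * ((hermite j.+1).[y] * gauss 1 y)).
  rewrite derive1_Np mulrDr mulr_sumr; congr (_ + _); apply: eq_bigr => j _; ring.
have k j := integrable_hermite_gauss (hermite j) (lg 0%N (leq0n _)).
have k0 : integrableT mu (fun y => g 0%N y * gauss 1 y).
  by apply: eq_integrableT (k 0%N) => y /=; rewrite (hornerC 1) mul1r.
have ks j : integrableT mu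
    (fun y => (-1) ^+ j.+1 * kappa j * (g 0%N y * ((hermite j.+1).[y] * gauss 1 y))).
  exact: integrableTZ.
have kS := integrableT_sum (index_iota 1 p.+1) (P := xpredT) (fun j _ => ks j).
split; first by apply: eq_integrableT (integrableTD k0 kS) => y; rewrite E.
rewrite (integralT_eq mu E) (integralTD k0 kS); congr (_ + _).
rewrite integralT_sum //; rewrite big_nat_cond [RHS]big_nat_cond.
apply: eq_bigr => j /andP[/andP[j1 jp] _].
have dg' m : (m < 0 + j.+1)%N -> forall x : R, is_derive x 1 (g m) (g m.+1 x).
  by move=> mj; apply: dg; lia.
have lg' m : (m <= 0 + j.+1)%N -> lip A (g m) by move=> mj; apply: lg; lia.
by rewrite integralTZ // (integral_hermite dg' lg') add0n mulrACA -expr2 sqrr_sign mul1r.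
Qed.

End normal_distribution_derivatives.

(** * Reduction to the law of the sample *)

Section sample_law.
Context d (Omega : measurableType d) (R : realType) (P : probability Omega R).
Context d' (T : measurableType d') (n : nat) (X : 'I_n -> Omega -> T).
Hypothesis X_iid : iid P X.

Definition sample (w : Omega) : n.-tuple T := [tuple X i w | i < n].

Lemma tnth_sample w i : tnth (sample w) i = X i w.
Proof. by rewrite tnth_mktuple. Qed.

Lemma measurable_sample : measurable_fun setT sample.
Proof.
apply/measurable_fun_tnthP => i; rewrite /comp.
by under eq_fun do rewrite tnth_sample; exact: X_iid.1.
Qed.

HB.instance Definition _ := isMeasurableFun.Build _ _ _ _ sample measurable_sample.

Definition sample_law : probability (n.-tuple T) R := distribution P sample.

Lemma sample_lawE A : sample_law A = P (sample @^-1` A).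
Proof. by []. Qed.

Lemma sample_product_law : product_law sample_law.
Proof.
move=> B mB; rewrite sample_lawE.
have -> : sample @^-1` rectangle B = \bigcap_(i in [set: 'I_n]) (X i @^-1` B i).
  apply/seteqP; split=> w /=.
    by move=> h i _; have := h i; rewrite tnth_sample.
  by move=> h i; rewrite tnth_sample; exact: h.
rewrite (X_iid.2.1 B mB); apply: eq_bigr => i _; rewrite sample_lawE.
by congr (P _); apply/funext => w /=; rewrite tnth_sample.
Qed.

Lemma sample_identical_marginals : identical_marginals sample_law.
Proof.
move=> i j B mB; rewrite !sample_lawE.
have E m : sample @^-1` [set x | B (tnth x m)] = X m @^-1` B.
  by apply/funext => w /=; rewrite tnth_sample.
by rewrite !E; exact: X_iid.2.2.
Qed.

Lemma integrable_sample (F : n.-tuple T -> R) : measurable_fun setT F ->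
  integrableT P (fun w => F (sample w)) -> integrableT sample_law F.
Proof.
move=> mF iF; rewrite /integrableT /sample_law /distribution.
apply: integrable_pushforward => //; exact/measurable_EFinP.
Qed.

Lemma integral_sample (F : n.-tuple T -> R) : integrableT sample_law F ->
  integrableT P (fun w => F (sample w)) /\
  \int[P]_w F (sample w) = \int[sample_law]_x F x.
Proof.
move=> iF; have mF := integrableT_measurable iF.
have iP : integrableT P (fun w => F (sample w)).
  apply/integrableP; split.
    by apply/measurable_EFinP; exact: measurableT_comp mF measurable_sample.
  move/integrableP : iF => [_]; rewrite /sample_law /distribution.
  rewrite ge0_integral_pushforward ?preimage_setT //.
  by apply: measurableT_comp => //; exact/measurable_EFinP.
split=> //; congr fine; rewrite /sample_law /distribution.
rewrite integral_pushforward ?preimage_setT //; exact/measurable_EFinP.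
Qed.

Lemma integral_sample_set (F : n.-tuple T -> R) U : integrableT sample_law F -> measurable U ->
  (\int[sample_law]_(x in U) (F x)%:E = \int[P]_(w in sample @^-1` U) (F (sample w))%:E)%E.
Proof.
move=> iF mU; have mF := integrableT_measurable iF.
rewrite /sample_law /distribution integral_pushforward //.
- exact/measurable_EFinP.
- apply: (integrableS measurableT) => //; last exact: (integral_sample iF).1.
  by rewrite -[X in measurable X]setTI; exact: measurable_sample.
Qed.

Lemma TA_sample (t : forall j : nat, j.-tuple T -> R) A w :
  TA X t A w = TA (@coord d' T n) t A (sample w).
Proof.
rewrite /TA; congr (@t _ _); apply: eq_from_tnth => i.
by rewrite !tnth_mktuple /coord tnth_sample.
Qed.

(* [merge] with a fixed outer part makes a set that does not depend on the coordinates
   outside of [A] the preimage of itself under a map that only involves [X i], [i \in A]. *)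
Lemma sample_sigma_algebra (A : {set 'I_n}) (U : set (n.-tuple T)) (x0 : n.-tuple T) :
  measurable U -> depends_on A U ->
  <<s \big[setU/set0]_(i < n | i \in A) preimage_set_system setT (X i) measurable >>
    (sample @^-1` U).
Proof.
move=> mU dU; set G := <<s _ >>.
pose r w := merge A x0 (sample w).
have -> : sample @^-1` U = r @^-1` U.
  by apply/funext => w /=; apply: dU => i iA; rewrite /r merge_in.
have sG : sigma_algebra setT G by exact: smallest_sigma_algebra.
suff H : measurable `<=` [set V | G (r @^-1` V)] by exact: H.
apply: smallest_sub.
  split.
  - by rewrite /= preimage_set0; exact: sigma_algebra0.
  - by move=> V /= GV; rewrite setTD preimage_setC -setTD; exact: sigma_algebraCD.
  - by move=> V GV /=; rewrite preimage_bigcup; exact: sigma_algebra_bigcup.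
rewrite -bigcup_seq /=; apply: bigcup_sub => i _ _ [B mB <-] /=.
have [iA|iA] := boolP (i \in A).
  apply: sub_sigma_algebra; rewrite -bigcup_seq_cond; exists i => /=.
    by rewrite mem_index_enum.
  exists B => //; rewrite !setTI; apply/funext => w /=.
  by rewrite /r merge_in // tnth_sample.
have [Bx|Bx] := pselect (B (tnth x0 i)).
  have -> : r @^-1` (setT `&` (fun x => tnth x i) @^-1` B) = setT.
    by apply/seteqP; split=> w //= _; rewrite /r merge_notin.
  by rewrite -(setD0 setT); apply: sigma_algebraCD; exact: sigma_algebra0.
have -> : r @^-1` (setT `&` (fun x => tnth x i) @^-1` B) = set0.
  by apply/seteqP; split=> w //= -[_]; rewrite /r merge_notin.
exact: sigma_algebra0.
Qed.

End sample_law.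

Lemma p_alpha_k_cutoff (R : realType) (alpha : R) (k j : nat) : 1 < alpha < 2 ->
  (1 <= j <= k)%N -> (j <= p_alpha_k alpha k)%N =
  (j%:R * (alpha / (alpha - 1)) < 2 * j%:R + 1).
Proof.
move=> /andP[a1 a2] /andP[j1 jk].
have cutE m : (m%:R < (alpha - 1) / (2 - alpha)) =
    (m%:R * (alpha / (alpha - 1)) < 2 * m%:R + 1 :> R).
  rewrite ltr_pdivlMr ?subr_gt0 // mulrA ltr_pdivrMr ?subr_gt0 //.
  by apply/idP/idP; lra.
rewrite -cutE; apply/idP/idP => [jp|cut]; last first.
  by apply: (@leq_bigmax_seq _ _ _ (fun i => i)); rewrite // mem_index_iota ltnS.
have : (p_alpha_k alpha k == 0)%N || ((p_alpha_k alpha k)%:R < (alpha - 1) / (2 - alpha)).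
  rewrite /p_alpha_k; elim/big_ind : _ => [//|x y hx hy|i ci]; last by rewrite ci orbT.
  by rewrite /maxn; case: ifP.
case/orP => [/eqP p0|]; first by move: jp j1; rewrite p0 leqn0 => /eqP ->.
by apply: le_lt_trans; rewrite ler_nat.
Qed.

Lemma p_alpha_k_le (R : realType) (alpha : R) (k : nat) : (p_alpha_k alpha k <= k)%N.
Proof.
rewrite /p_alpha_k big_nat_cond; elim/big_ind : _ => // [x y xk yk|i].
  by rewrite geq_max xk.
by rewrite ltnS => /andP[/andP[]].
Qed.

Lemma p_alpha_k1 (R : realType) (k : nat) : p_alpha_k (1 : R) k = 0%N.
Proof. by rewrite /p_alpha_k big_pred0 // => j; rewrite subrr mul0r ltNge ler0n. Qed.

Section statistic.
Context (R : realType) (n k : nat) (alpha : R) (hn : (0 < n)%N).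
Context (d : measure_display) (Omega : measurableType d) (P : probability Omega R).
Variables (X : 'I_n -> Omega -> R) (l : R -> R) (t : forall j : nat, j.-tuple R -> R).
Hypothesis alpha_ge1 : 1 <= alpha < 2.
Hypothesis X_iid : iid P X.
Hypothesis l_measurable : measurable_fun setT l.
Hypothesis t_measurable : forall j, (1 <= j <= k)%N -> measurable_fun setT (@t j).
Hypothesis t_symmetric : forall j (s : j.-tuple R) (sg : 'I_j -> 'I_j), (1 <= j <= k)%N ->
  injective sg -> t [tuple tnth s (sg i) | i < j] = t s.
Local Notation i0 := (Ordinal hn).
Hypothesis L_integrable : P.-integrable setT (EFin \o Lv X l i0).
Hypothesis L_mean : (\int[P]_w (Lv X l i0 w)%:E = 0)%E.
Hypothesis L_variance : ((n%:R)%:E * \int[P]_w ((Lv X l i0 w) ^+ 2)%:E = 1)%E.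
Hypothesis T_degenerate : forall j, (1 <= j <= k)%N -> (j <= n)%N ->
  P.-integrable setT (EFin \o Tfirst X t j) /\
  cond_exp_zero P (sigma_2_to X j) (Tfirst X t j).
Hypothesis beta_finite : (\int[P]_w (`|Lv X l i0 w| ^+ 3)%:E < +oo)%E.
Hypothesis gamma_finite : forall j, (1 <= j <= k)%N -> (j <= n)%N ->
  (\int[P]_w (powR `|Tfirst X t j w| alpha)%:E < +oo)%E.

Local Notation M := (sample_law X_iid).
Local Notation L i x := (l (tnth x i)).
Local Notation N := (n%:R : R).
Local Notation TAn := (TA (@coord _ R n) t).
Local Notation beta := (beta_ X l P i0).
Local Notation gamma := (gamma_ X t k P alpha).

Let MX : product_law M. Proof. exact: sample_product_law. Qed.
Let Mid : identical_marginals M. Proof. exact: sample_identical_marginals. Qed.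
Let N0 : 0 < N. Proof. by rewrite ltr0n. Qed.

Lemma integral_L (f : R -> R) : measurable_fun setT f ->
  integrableT P (fun w => f (Lv X l i0 w)) ->
  forall i, integrableT M (fun x => f (L i x)) /\
  \int[M]_x f (L i x) = \int[P]_w f (Lv X l i0 w).
Proof.
move=> mf iP i.
have mfL : measurable_fun setT (fun x : n.-tuple R => f (L i0 x)).
  exact: (measurableT_comp mf (measurable_L l_measurable i0)).
have E w : f (L i0 (sample X w)) = f (Lv X l i0 w) by rewrite tnth_sample.
have i1 : integrableT M (fun x => f (L i0 x)).
  apply: integrable_sample => //.
  by apply: eq_integrableT iP => w; rewrite E.
have [_ e] := integral_sample i1.
have Ei x : f (L i x) = (fun x => f (L i0 x)) (permute (tperm i0 i) x).
  by rewrite tnth_permute tpermL.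
split.
  by apply: eq_integrableT (integrable_permute MX Mid (tperm i0 i) i1) => x; rewrite Ei.
under eq_Rintegral do rewrite Ei.
rewrite (integral_permute MX Mid _ i1) -e.
by apply: integralT_eq => w; rewrite E.
Qed.

Let mLv : measurable_fun setT (Lv X l i0).
Proof. exact: (measurableT_comp l_measurable (X_iid.1 i0)). Qed.

Lemma L_first i : integrableT M (fun x => L i x) /\ \int[M]_x (L i x) = 0.
Proof.
have [iL eL] := @integral_L id (@measurable_id _ _ setT) L_integrable i; split=> //.
by rewrite eL /Rintegral L_mean.
Qed.

Lemma L_second i : integrableT M (fun x => L i x ^+ 2) /\ N * \int[M]_x (L i x ^+ 2) = 1.
Proof.
have I0 : (0 <= \int[P]_w ((Lv X l i0 w) ^+ 2)%:E)%E.
  by apply: integral_ge0 => w _; rewrite lee_fin sqr_ge0.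
have Ioo : (\int[P]_w ((Lv X l i0 w) ^+ 2)%:E < +oo)%E.
  rewrite ltey; apply/eqP => I; move: L_variance; rewrite I.
  by rewrite gt0_muley // lte_fin.
have iP : integrableT P (fun w => Lv X l i0 w ^+ 2).
  apply: integrableT_ltey => //; first exact: measurable_funX.
  by move=> w; exact: sqr_ge0.
have [iL eL] := @integral_L (fun y => y ^+ 2) (@exprn_measurable R setT 2) iP i.
split=> //; rewrite eL; apply: EFin_inj; rewrite EFinM.
by rewrite -(integralT_EFin iP) L_variance.
Qed.

Lemma L_third i : integrableT M (fun x => `|L i x| ^+ 3) /\
  N * \int[M]_x (`|L i x| ^+ 3) = beta.
Proof.
have m3 : measurable_fun setT (fun y : R => `|y| ^+ 3).
  by apply: measurable_funX; exact: normr_measurable.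
have iP : integrableT P (fun w => `|Lv X l i0 w| ^+ 3).
  apply: integrableT_ltey => //; exact: (measurableT_comp m3 mLv).
by have [iL eL] := integral_L m3 iP i; split=> //; rewrite eL.
Qed.

Lemma TfirstE j w : Tfirst X t j w = TAn (first n j) (sample X w).
Proof. by rewrite /Tfirst TA_sample. Qed.

Lemma Tfirst_facts j : (1 <= j <= k)%N -> (j <= n)%N ->
  [/\ integrableT M (TAn (first n j)),
      integrableT M (fun x => `|TAn (first n j) x| `^ alpha),
      \int[M]_x (`|TAn (first n j) x| `^ alpha) = \int[P]_w (`|Tfirst X t j w| `^ alpha) &
      degenerate M i0 (TAn (first n j))].
Proof.
move=> jk jn; have [iT cT] := T_degenerate jk jn.
have cf : #|first n j| = j by exact: card_first.
have mT : measurable_fun setT (TAn (first n j)).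
  by apply: (measurable_TA t_measurable); rewrite cf.
have iTM : integrableT M (TAn (first n j)).
  by apply: integrable_sample => //; apply: eq_integrableT iT => w; rewrite TfirstE.
have mTa := measurable_norm_powR alpha mT.
have iTa : integrableT M (fun x => `|TAn (first n j) x| `^ alpha).
  apply: integrable_sample => //; apply: integrableT_ltey.
  - exact: (measurableT_comp mTa (measurable_sample X_iid)).
  - by move=> w; exact: powR_ge0.
  - by under eq_integral do rewrite -TfirstE; exact: gamma_finite.
split=> //.
  by rewrite -(integral_sample iTa).2; apply: integralT_eq => w; rewrite TfirstE.
move=> G Gi iG; apply: (integral_ae_degenerate MX Gi iTM iG).
apply: (ae_degenerate MX (A := first n j)) => //; first exact: depends_on_TA.
move=> U mU dU; rewrite (integral_sample_set iTM mU).
under eq_integral do rewrite -TfirstE.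
apply: cT; rewrite /sigma_2_to.
have := @sample_sigma_algebra _ _ _ _ _ X _ _ [tuple 0 | _ < n] mU dU.
congr (<<s _ >> _); apply: eq_bigl => i; rewrite !inE /=.
by congr andb; rewrite lt0n.
Qed.

Lemma TA_facts (A : {set 'I_n}) : (1 <= #|A| <= k)%N ->
  [/\ depends_on A (TAn A), integrableT M (TAn A), finite_moment M alpha (TAn A),
      \int[M]_x (`|TAn A x| `^ alpha) = \int[P]_w (`|Tfirst X t #|A| w| `^ alpha) &
      forall i, i \in A -> degenerate M i (TAn A)].
Proof.
move=> Ak; have An : (#|A| <= n)%N by rewrite -[n in leqRHS]card_ord max_card.
have cf := card_first An.
have fk : (1 <= #|first n #|A| | <= k)%N by rewrite cf.
have [iT ia ea dT] := Tfirst_facts Ak An.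
have i0f : i0 \in first n #|A| by rewrite inE; case/andP: Ak.
have perm_to i : i \in A -> exists s : {perm 'I_n}, s @: first n #|A| = A /\ s i0 = i.
  by move=> iA; apply: exists_perm_imset => //; rewrite cf.
have [i1 i1A] : exists i, i \in A.
  by apply/set0Pn; rewrite -cards_eq0 -lt0n; case/andP: Ak.
have [s [sA _]] := perm_to _ i1A.
have mA := measurable_TA t_measurable Ak.
have [iA eA] := integral_TA_permute t_symmetric MX Mid (g := fun y => `|y| `^ alpha) sA fk ia.
have [iA' _] := integral_TA_permute t_symmetric MX Mid (g := id) sA fk iT.
split.
- exact: depends_on_TA.
- exact: iA'.
- exact: (conj mA iA).
- exact: (etrans eA ea).
- move=> i iinA; have [s' [sA' si]] := perm_to i iinA.
  have -> : TAn A = TAn (first n #|A|) \o permute s'.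
    by apply/funext => x; exact: (TA_permute t_symmetric).
  by rewrite -si; exact: degenerate_permute.
Qed.

Lemma integral_statistic (h : R -> R) A : lip A h ->
  integrableT M (fun x => \sum_(B : {set 'I_n} | (1 <= #|B| <= k)%N) TAn B x) ->
  \int[P]_w h (SS X l t k w) =
  \int[M]_x h (\sum_i L i x + \sum_(B : {set 'I_n} | (1 <= #|B| <= k)%N) TAn B x).
Proof.
move=> hA iT; have iL : integrableT M (fun x => \sum_i L i x).
  by apply: integrableT_sum => i _; exact: (L_first i).1.
have := (integral_sample (integrable_lip hA (integrableTD iL iT))).2 => <-.
apply: integralT_eq => w; congr (h (_ + _)).
  by apply: eq_bigr => i _; rewrite tnth_sample.
by apply: eq_bigr => B _; rewrite TA_sample.
Qed.

Local Notation TTn := (fun x => \sum_(B : {set 'I_n} | (1 <= #|B| <= k)%N) TAn B x).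
Local Notation normal_mean h := (\int[lebesgue_measure]_y (h y * gauss 1 y)).

Let mm j := \int[M]_x (TAn (first n j) x * \prod_(i in first n j) L i x).

Lemma kappa_mixed_moment j (b : R) : 1 < alpha -> alpha^-1 + b^-1 = 1 -> b <= 3 ->
  (1 <= j <= k)%N -> kappa X l t k P j = 'C(n, j)%:R * mm j.
Proof.
move=> a1 ab b3 jk; rewrite /kappa.
have [jn|nj] := leqP j n; last by rewrite bin_small ?mul0r.
have a12 : 1 < alpha < 2 by rewrite a1; case/andP: alpha_ge1.
have cf : #|first n j| = j by exact: card_first.
congr (_ * _).
have fk : (1 <= #|first n j| <= k)%N by rewrite cf.
have HF (A : {set 'I_n}) : (1 <= #|A| <= k)%N ->
    [/\ depends_on A (TAn A), finite_moment M alpha (TAn A) &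
        forall i, i \in A -> degenerate M i (TAn A)].
  by move=> /TA_facts[].
have E := mixed_moment_sum MX hn l_measurable L_first L_second L_third a12 ab b3 HF fk.
have iFL (A : {set 'I_n}) : (1 <= #|A| <= k)%N ->
    integrableT M (fun x => TAn A x * \prod_(i in first n j) L i x).
  move=> /HF[_ fA _].
  apply: eq_integrableT (integrable_mixed MX hn l_measurable L_second L_third a12 ab b3
    (enum_uniq (first n j)) fA) => x.
  by rewrite big_enum.
rewrite /mm -E.
have iS : integrableT M (fun x => (\prod_(i in first n j) L i x) * TTn x).
  apply: eq_integrableT (integrableT_sum (index_enum _) iFL) => x.
  by rewrite mulr_sumr; apply: eq_bigr => A _; rewrite mulrC.
rewrite -(integral_sample iS).2; apply: integralT_eq => w; congr (_ * _).
  by apply: eq_big => i; [rewrite inE|rewrite tnth_sample].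
by apply: eq_bigr => B _; rewrite TA_sample.
Qed.

Lemma mixed_moment_card (A : {set 'I_n}) (b : R) : 1 < alpha -> alpha^-1 + b^-1 = 1 ->
  b <= 3 -> (1 <= #|A| <= k)%N ->
  \int[M]_x (TAn A x * \prod_(i in A) L i x) = mm #|A|.
Proof.
move=> a1 ab b3 Ak; have An : (#|A| <= n)%N by rewrite -[n in leqRHS]card_ord max_card.
have a12 : 1 < alpha < 2 by rewrite a1; case/andP: alpha_ge1.
have cf := card_first An.
have fk : (1 <= #|first n #|A| | <= k)%N by rewrite cf.
have [i1 i1A] : exists i, i \in A.
  by apply/set0Pn; rewrite -cards_eq0 -lt0n; case/andP: Ak.
have i0f : i0 \in first n #|A| by rewrite inE; case/andP: Ak.
have [s [sA _]] : exists s : {perm 'I_n}, s @: first n #|A| = A /\ s i0 = i1.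
  by apply: exists_perm_imset => //; rewrite cf.
have [_ _ fA _ _] := TA_facts fk.
have iFL : integrableT M (fun x => TAn (first n #|A|) x * \prod_(i in first n #|A|) L i x).
  apply: eq_integrableT (integrable_mixed MX hn l_measurable L_second L_third a12 ab b3
    (enum_uniq (first n #|A|)) fA) => x.
  by rewrite big_enum.
rewrite /mm -(integral_permute MX Mid s iFL); apply: integralT_eq => x.
rewrite (TA_permute t_symmetric x sA fk); congr (_ * _).
rewrite -[in LHS]sA big_imset /=; last by move=> i j _ _; exact: perm_inj.
by apply: eq_bigr => i _; rewrite tnth_permute.
Qed.

Lemma expansion_gt1 (g : nat -> R -> R) (K : R) : 1 < alpha ->
  (forall i, (i < k + 4)%N -> forall x : R, is_derive x 1 (g i) (g i.+1 x)) ->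
  (forall i, (1 <= i <= k + 4)%N -> forall x, `|g i x| <= K) ->
  `|\int[P]_w g 0%N (SS X l t k w) - \int[lebesgue_measure]_u
      (g 0%N u * derive1 (Np (kappa X l t k P) (p_alpha_k alpha k)) u)|
  <= expansion_cst R k * K * (beta + gamma).
Proof.
move=> a1 dg bg; have a2 : alpha < 2 by case/andP: alpha_ge1.
have a12 : 1 < alpha < 2 by rewrite a1.
pose b := alpha / (alpha - 1); set p := p_alpha_k alpha k.
have ab : alpha^-1 + b^-1 = 1 by rewrite /b invf_div; field; lra.
have pk : (p <= k)%N by exact: p_alpha_k_le.
have cut j : (1 <= j <= k)%N -> (j <= p)%N = (j%:R * b < 2 * j%:R + 1).
  exact: p_alpha_k_cutoff.
have b3 j : (1 <= j <= p)%N -> b <= 3.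
  move=> /andP[j1 jp]; have jk : (1 <= j <= k)%N by rewrite j1 (leq_trans jp).
  by apply: (conjugate_le3 j1); rewrite -cut.
have F_mom (A : {set 'I_n}) : (1 <= #|A| <= k)%N -> finite_moment M alpha (TAn A) /\
    \int[M]_x (`|TAn A x| `^ alpha) = \int[P]_w (`|Tfirst X t #|A| w| `^ alpha).
  by move=> /TA_facts[].
have F_dep (A : {set 'I_n}) : (1 <= #|A| <= k)%N -> depends_on A (TAn A) by move=> /TA_facts[].
have F_deg (A : {set 'I_n}) i : (1 <= #|A| <= k)%N -> i \in A -> degenerate M i (TAn A).
  by move=> /TA_facts[_ _ _ _]; apply.
have F_mix (A : {set 'I_n}) : (1 <= #|A| <= p)%N ->
    \int[M]_x (TAn A x * \prod_(i in A) L i x) = mm #|A|.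
  move=> Ap; have [A1 Ap'] := andP Ap.
  by apply: (mixed_moment_card a1 ab (b3 _ Ap)); rewrite A1 (leq_trans Ap').
have := smooth_expansion MX hn l_measurable L_first L_second L_third a12 ab cut pk dg bg
  (tau := fun j => \int[P]_w (`|Tfirst X t j w| `^ alpha)) (mm := mm)
  F_dep F_mom F_deg F_mix.
have lipg i : (i <= k.+3)%N -> lip K (g i).
  move=> ik x y; have i4 : (i < k + 4)%N by rewrite addn4.
  by apply: (taylor1 _ _ (dg i i4)) => z; apply: bg; rewrite ltnS.
have iT : integrableT M TTn by apply: integrableT_sum => A /TA_facts[].
rewrite -(integral_statistic (lipg 0%N (leq0n _)) iT).
have dgp m : (m < p.+1)%N -> forall x : R, is_derive x 1 (g m) (g m.+1 x).
  by move=> mp; apply: dg; rewrite addn4 (leq_trans mp) // !ltnS leqW // leqW // leqW.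
have lgp m : (m <= p.+1)%N -> lip K (g m).
  by move=> mp; apply: lipg; rewrite (leq_trans mp) // ltnS leqW // leqW.
have [_ ->] := integral_Np (kappa X l t k P) dgp lgp.
move=> H.
have -> : \sum_(1 <= j < p.+1) kappa X l t k P j * normal_mean (g j.+1) =
    \sum_(1 <= j < p.+1) 'C(n, j)%:R * mm j * normal_mean (g j.+1).
  rewrite big_nat_cond [RHS]big_nat_cond; apply: eq_bigr => j /andP[/andP[j1 jp] _].
  have jp' : (1 <= j <= p)%N by rewrite j1.
  by rewrite (kappa_mixed_moment a1 ab (b3 j jp')) // j1 (leq_trans _ pk).
exact: H.
Qed.

Lemma absolute_moment_TT : alpha = 1 -> integrableT M TTn /\ \int[M]_x `|TTn x| <= gamma.
Proof.
move=> a1; have iTA (A : {set 'I_n}) : (1 <= #|A| <= k)%N -> integrableT M (TAn A).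
  by move=> /TA_facts[].
have iT : integrableT M TTn by exact: integrableT_sum.
split=> //.
have -> : gamma = \sum_(A : {set 'I_n} | (1 <= #|A| <= k)%N) \int[M]_x `|TAn A x|.
  rewrite /gamma_ -sum_by_card; apply: eq_bigr => A /TA_facts[_ _ _ e _].
  by rewrite -e; apply: integralT_eq => x; rewrite a1 powRr1.
rewrite -integralT_sum; last by move=> A Ak; exact: integrableT_norm (iTA A Ak).
apply: integralT_le.
- exact: integrableT_norm.
- by apply: integrableT_sum => A Ak; exact: integrableT_norm (iTA A Ak).
- by move=> x; exact: ler_norm_sum.
Qed.

Lemma expansion_eq1 (g : nat -> R -> R) (A K1 K3 : R) : alpha = 1 ->
  (forall i, (i < 3)%N -> forall x : R, is_derive x 1 (g i) (g i.+1 x)) ->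
  (forall x, `|g 1%N x| <= K1) -> (forall x, `|g 2%N x| <= A) ->
  (forall x, `|g 3%N x| <= K3) ->
  `|\int[P]_w g 0%N (SS X l t k w) - \int[lebesgue_measure]_u
      (g 0%N u * derive1 (Np (kappa X l t k P) (p_alpha_k alpha k)) u)|
  <= K1 * gamma + lindeberg_cst R * K3 * beta.
Proof.
move=> a1 dg b1 b2 b3; have [iT eT] := absolute_moment_TT a1.
have l0 : lip K1 (g 0%N) by move=> x y; exact: (taylor1 _ _ (dg 0%N isT) b1).
have l1 : lip A (g 1%N) by move=> x y; exact: (taylor1 _ _ (dg 1%N isT) b2).
have l2 : lip K3 (g 2%N) by move=> x y; exact: (taylor1 _ _ (dg 2%N isT) b3).
have K10 : 0 <= K1 by exact: le_trans (normr_ge0 _) (b1 0).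
have A0 : 0 <= A by exact: le_trans (normr_ge0 _) (b2 0).
have K30 : 0 <= K3 by exact: le_trans (normr_ge0 _) (b3 0).
pose B := K1 + A + K3.
have lipW h c : lip c h -> c <= B -> lip B h.
  by move=> hc cB x y; apply: le_trans (hc x y) _; rewrite ler_wpM2r.
have [B1 B2 B3] : [/\ K1 <= B, A <= B & K3 <= B] by rewrite /B; split; lra.
have cl : taylor_class K3 (g 0%N) (g 1%N) (g 2%N).
  exists B; split; last first.
    by move=> x y; exact: (taylor3 _ _ (dg 0%N isT) (dg 1%N isT) (dg 2%N isT)).
  split; [exact: lipW l0 B1|exact: lipW l1 B2|exact: lipW l2 B3| |].
    by move=> x; exact: le_trans (b1 x) B1.
  by move=> x; exact: le_trans (b2 x) B2.
have na := normal_approximation MX hn L_first L_second L_third cl.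
have -> : p_alpha_k alpha k = 0%N by rewrite a1 p_alpha_k1.
rewrite (integral_statistic l0 iT).
have dg0 m : (m < 1)%N -> forall x : R, is_derive x 1 (g m) (g m.+1 x).
  by case: m => // _; exact: dg.
have lg0 m : (m <= 1)%N -> lip B (g m).
  by case: m => [|[|]] // _; [exact: lipW l0 B1|exact: lipW l1 B2].
have [_ ->] := integral_Np (kappa X l t k P) dg0 lg0.
rewrite big_geq // addr0.
have iS : integrableT M (fun x => \sum_i L i x).
  by apply: integrableT_sum => i _; exact: (L_first i).1.
have j1 := integrable_lip l0 (integrableTD iS iT); have j0 := integrable_lip l0 iS.
set u := \int[M]_x _; set w := normal_mean _ in na *; set v := \int[M]_x _ in na.
have uv : `|u - v| <= K1 * gamma.
  rewrite /u /v -(integralTB j1 j0).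
  apply: le_trans (ler_wpM2l K10 eT).
  rewrite -integralTZ; last exact: integrableT_norm.
  apply: integralT_norm_le.
  - exact: integrableTB.
  - by apply: integrableTZ; exact: integrableT_norm.
  - by move=> x; exact: l0.
rewrite (_ : u - w = (u - v) + (v - w)); last by ring.
by apply: le_trans (ler_normD _ _) _; exact: lerD.
Qed.

End statistic.

Section complex_valued.
Context (R : realType).
Implicit Types (f h : R -> R[i]) (z : R[i]).

Lemma cabs_ge0 z : 0 <= cabs z. Proof. exact: sqrtr_ge0. Qed.

Lemma norm_Re_le z : `|complex.Re z| <= cabs z.
Proof. by rewrite -sqrtr_sqr ler_wsqrtr // lerDl sqr_ge0. Qed.

Lemma norm_Im_le z : `|complex.Im z| <= cabs z.
Proof. by rewrite -sqrtr_sqr ler_wsqrtr // lerDr sqr_ge0. Qed.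

Lemma cabs_le z : cabs z <= `|complex.Re z| + `|complex.Im z|.
Proof.
rewrite -[leRHS]ger0_norm ?addr_ge0 // -sqrtr_sqr ler_wsqrtr //.
rewrite sqrrD !real_normK ?num_real // [leRHS]addrAC lerDl.
by rewrite mulrn_wge0 // mulr_ge0.
Qed.

Lemma cabs_le_supnorm h x : cbounded h -> cabs (h x) <= supnorm h.
Proof.
move=> [K hK]; apply: sup_ubound; last by exists x.
by exists K => _ [y _ <-]; exact: hK.
Qed.

Lemma supnorm_ge0 h : cbounded h -> 0 <= supnorm h.
Proof. by move=> /(@cabs_le_supnorm h 0); apply: le_trans; exact: cabs_ge0. Qed.

Lemma is_derive_dern (g : R -> R) m i (x : R) : rCn m g -> (i < m)%N ->
  is_derive x 1 (dern i g) (dern i.+1 g x).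
Proof.
move=> [dg _] im; apply: DeriveDef; first exact: dg.
by rewrite /dern iterS derive1E.
Qed.

Lemma cabs_integral_sub d (Omega : measurableType d) (P : probability Omega R)
    (f : R -> R[i]) (S : Omega -> R) (D : R -> R) (c : R) :
  `|\int[P]_w (complex.Re (f (S w))) -
    \int[lebesgue_measure]_u (complex.Re (f u) * D u)| <= c ->
  `|\int[P]_w (complex.Im (f (S w))) -
    \int[lebesgue_measure]_u (complex.Im (f u) * D u)| <= c ->
  cabs (cint P setT (fun w => f (S w)) -
        cint lebesgue_measure setT (fun u => f u * Complex (D u) 0)) <= 2 * c.
Proof.
move=> hRe hIm; apply: le_trans (cabs_le _) _; rewrite /cint /=.
have eR u : complex.Re (f u * Complex (D u) 0) = complex.Re (f u) * D u.
  by case: (f u) => a b /=; rewrite mulr0 subr0.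
have eI u : complex.Im (f u * Complex (D u) 0) = complex.Im (f u) * D u.
  by case: (f u) => a b /=; rewrite mulr0 add0r.
under [X in `|_ - X| + _]eq_Rintegral do rewrite eR.
under [X in _ + `|_ - X|]eq_Rintegral do rewrite eI.
by move: hRe hIm; lra.
Qed.

End complex_valued.

Lemma add_bound_le (F : realFieldType) (c u v b g : F) :
  0 <= c -> 0 <= u -> 0 <= v -> 0 <= b -> 0 <= g ->
  u * g + c * v * b <= (1 + c) * (u + v) * (b + g).
Proof.
move=> c0 u0 v0 b0 g0; rewrite -subr_ge0.
rewrite (_ : _ - _ = u * b + v * b + v * g + c * (u * b) + c * (u * g) + c * (v * g)); last by ring.
by rewrite !addr_ge0 ?mulr_ge0.
Qed.

Lemma double_bound_le (F : realFieldType) (c c' C g : F) :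
  0 <= c' -> 0 <= C -> 0 <= g -> 2 * (c * C * g) <= (2 * c + c') * C * g.
Proof. by move=> c'0 C0 g0; rewrite !mulrA !ler_wpM2r // lerDl. Qed.

Theorem theorem6 (R : realType) (k : nat) (alpha : R) :
  1 <= alpha < 2 ->
  exists c : R, 0 < c /\
  forall (n : nat) (hn : (0 < n)%N)
    (d : measure_display) (Omega : measurableType d) (P : probability Omega R)
    (X : 'I_n -> Omega -> R) (l : R -> R)
    (t : forall j : nat, j.-tuple R -> R) (f : R -> R[i]),
  (* X_1, ..., X_n are i.i.d. random variables *)
  iid P X ->
  (* l and t_j are Borel, t_j symmetric *)
  measurable_fun setT l ->
  (forall j, (1 <= j <= k)%N -> measurable_fun setT (t j)) ->
  (forall j (s : j.-tuple R) (sg : 'I_j -> 'I_j), (1 <= j <= k)%N ->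
     injective sg -> t j [tuple tnth s (sg i) | i < j] = t j s) ->
  (* E L_1 = 0 and n E L_1^2 = 1 *)
  P.-integrable setT (EFin \o Lv X l (Ordinal hn)) ->
  (\int[P]_w (Lv X l (Ordinal hn) w)%:E = 0)%E ->
  ((n%:R)%:E * \int[P]_w ((Lv X l (Ordinal hn) w) ^+ 2)%:E = 1)%E ->
  (* t_j(X_1..X_j) integrable and degenerate: E[t_j(X_1..X_j) | X_2..X_j] = 0 *)
  (forall j, (1 <= j <= k)%N -> (j <= n)%N ->
     P.-integrable setT (EFin \o Tfirst X t j) /\
     cond_exp_zero P (sigma_2_to X j) (Tfirst X t j)) ->
  (* beta < oo *)
  (\int[P]_w (`|Lv X l (Ordinal hn) w| ^+ 3)%:E < +oo)%E ->
  (* gamma^(alpha) < oo *)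
  (forall j, (1 <= j <= k)%N -> (j <= n)%N ->
     (\int[P]_w (powR `|Tfirst X t j w| alpha)%:E < +oo)%E) ->
  (* regularity of f *)
  (alpha = 1 -> cCn 3 f /\
     cbounded (cdern 1 f) /\ cbounded (cdern 2 f) /\ cbounded (cdern 3 f)) ->
  (1 < alpha -> cCn (k + 4) f /\
     forall j, (1 <= j <= k + 4)%N -> cbounded (cdern j f)) ->
  let C := if alpha == 1 then supnorm (cdern 1 f) + supnorm (cdern 3 f)
           else \sum_(1 <= j < k + 5) supnorm (cdern j f) in
  let p := p_alpha_k alpha k in
  cabs (cint P setT (fun w => f (SS X l t k w))
        - cint lebesgue_measure setT
            (fun u => f u * Complex (derive1 (Np (kappa X l t k P) p) u) 0))
  <= c * C * (beta_ X l P (Ordinal hn) + gamma_ X t k P alpha).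
Proof.
move=> a12; pose c1 : R := 2 * (1 + lindeberg_cst R); pose c2 : R := 2 * expansion_cst R k.
have lc : 0 <= lindeberg_cst R by rewrite /lindeberg_cst; have := moment_cst_ge0 R 3; lra.
have ec : 0 < expansion_cst R k.
  have p2 : 0 <= 2 ^+ k :> R by rewrite exprn_ge0.
  have p4 : 0 < 4 ^+ k :> R by rewrite exprn_gt0.
  have k0 : 0 <= k%:R :> R by rewrite ler0n.
  have sc : 0 <= subset_cst R k by rewrite /subset_cst; lra.
  rewrite /expansion_cst; have := mulr_ge0 sc (addr_ge0 ler01 (mulr_ge0 k0 p2)); lra.
have c10 : 0 < c1 by rewrite /c1; lra.
have c20 : 0 < c2 by rewrite /c2; lra.
exists (c1 + c2); split; first exact: addr_gt0.
move=> n hn d Omega P X l t f X_iid ml mt sym iL EL VL degT b3 gfin f1 f2.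
cbv zeta; set C := (X in _ <= _ * X * _); set p := p_alpha_k _ _.
set bt := beta_ X l P (Ordinal hn); set gm := gamma_ X t k P alpha.
have bt0 : 0 <= bt.
  by rewrite /bt /beta_ mulr_ge0 ?ler0n //; apply: Rintegral_ge0 => w _; rewrite exprn_ge0.
have gm0 : 0 <= gm.
  rewrite /gm /gamma_; apply: sumr_ge0 => j _; rewrite mulr_ge0 ?ler0n //.
  by apply: Rintegral_ge0 => w _; exact: powR_ge0.
pose fRe u := complex.Re (f u); pose fIm u := complex.Im (f u).
have [a1|a1] := eqVneq alpha 1.
  have [cf [bf1 [bf2 bf3]]] := f1 a1.
  have CE : C = supnorm (cdern 1 f) + supnorm (cdern 3 f) by rewrite /C a1 eqxx.
  have s1 := supnorm_ge0 bf1; have s3 := supnorm_ge0 bf3.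
  have bd j (h : R -> R) (bj : cbounded (cdern j f)) x : h = fRe \/ h = fIm ->
      `|dern j h x| <= supnorm (cdern j f).
    move=> hh; apply: le_trans (cabs_le_supnorm x bj).
    by case: hh => ->; [exact: (norm_Re_le (cdern j f x))|exact: (norm_Im_le (cdern j f x))].
  have real (h : R -> R) : rCn 3 h -> h = fRe \/ h = fIm ->
      `|\int[P]_w h (SS X l t k w) - \int[lebesgue_measure]_u
         (h u * derive1 (Np (kappa X l t k P) p) u)| <= (1 + lindeberg_cst R) * C * (bt + gm).
    move=> ch hh.
    have := expansion_eq1 X_iid ml mt sym iL EL VL degT b3 gfin a1 (g := fun i => dern i h)
      (fun i im x => is_derive_dern x ch im)
      (fun x => bd 1%N h bf1 x hh) (fun x => bd 2%N h bf2 x hh) (fun x => bd 3%N h bf3 x hh).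
    move=> H; apply: le_trans H _; rewrite CE -/bt -/gm.
    exact: add_bound_le.
  apply: le_trans (cabs_integral_sub (real fRe cf.1 (or_introl erefl))
    (real fIm cf.2 (or_intror erefl))) _.
  have C0 : 0 <= C by rewrite CE addr_ge0.
  by apply: double_bound_le; rewrite ?addr_ge0 // ltW.
have a1' : 1 < alpha by rewrite lt_def a1; case/andP: a12.
have [cf bf] := f2 a1'.
have CE : C = \sum_(1 <= j < k + 5) supnorm (cdern j f) by rewrite /C (negbTE a1).
have sj j : (1 <= j <= k + 4)%N -> 0 <= supnorm (cdern j f) by move=> /bf /supnorm_ge0.
have leC j : (1 <= j <= k + 4)%N -> supnorm (cdern j f) <= C.
  move=> jk; rewrite CE (bigD1_seq j) ?iota_uniq //=; last by rewrite mem_index_iota addnS ltnS.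
  rewrite lerDl big_nat_cond; apply: sumr_ge0 => i /andP[ik _]; apply: sj.
  by rewrite addnS ltnS in ik.
have C0 : 0 <= C.
  have k1 : (1 <= 1 <= k + 4)%N by rewrite addn4.
  exact: le_trans (sj _ k1) (leC _ k1).
have bd j (h : R -> R) x : h = fRe \/ h = fIm -> (1 <= j <= k + 4)%N -> `|dern j h x| <= C.
  move=> hh jk; apply: le_trans (leC j jk); apply: le_trans (cabs_le_supnorm x (bf j jk)).
  by case: hh => ->; [exact: (norm_Re_le (cdern j f x))|exact: (norm_Im_le (cdern j f x))].
have real (h : R -> R) : rCn (k + 4) h -> h = fRe \/ h = fIm ->
    `|\int[P]_w h (SS X l t k w) - \int[lebesgue_measure]_u
       (h u * derive1 (Np (kappa X l t k P) p) u)| <= expansion_cst R k * C * (bt + gm).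
  move=> ch hh.
  exact: (expansion_gt1 a12 X_iid ml mt sym iL EL VL degT b3 gfin a1' (g := fun i => dern i h)
      (fun i im x => is_derive_dern x ch im) (fun j jk x => bd j h x hh jk)).
apply: le_trans (cabs_integral_sub (real fRe cf.1 (or_introl erefl))
  (real fIm cf.2 (or_intror erefl))) _.
by rewrite [c1 + c2]addrC; apply: double_bound_le; rewrite ?addr_ge0 // ltW.
Qed.
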